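(* Let $q$ be a power of an odd prime and $G=\mathrm{GL}_2(\mathbb{F}_q)$. An irreducible complex representation $V$ of $G$ is self-dual if and only if $V$ belongs (up to isomorphism) to one of the following sets, where $1=1_{\mathbb{F}_q^\times}$ denotes the trivial character of $\mathbb{F}_q^\times$: - $\{\chi_{1}^1,\ \chi_{-1}^1\}$; - $\{\chi_{1}^q,\ \chi_{-1}^q\}$; - $\{\chi_{(\alpha,\alpha^{-1})}^{q+1}\mid\alpha\in\widehat{\mathbb{F}_q^\times},\ \alpha^2\neq1\}\cup\{\chi_{(1,-1)}^{q+1}\}$; - $\{\chi_\Lambda^{-1}\mid\Lambda\in\widehat{T_{-1}}\text{ indecomposable},\ \bar\Lambda=1\}$.
   Context: A representation is self-dual if it is isomorphic to its dual. $\widehat{A}$ is the group of characters $A\to\mathbb{C}^\times$ of a finite abelian group $A$. Here $-1$ in subscripts denotes $-(1_{\mathbb{F}_q^\times})$, the unique nontrivial character of $\mathbb{F}_q^\times$ whose square is trivial (in general, for $\alpha\in\widehat{\mathbb{F}_q^\times}$, $-\alpha$ denotes the solution of $X^2=\alpha^2$ in $\widehat{\mathbb{F}_q^\times}$ different from $\alpha$). $B\subset G$ is the subgroup of upper-triangular matrices. For $\alpha,\beta\in\widehat{\mathbb{F}_q^\times}$, $(\alpha,\beta)$ is the character of $B$ given by $\begin{pmatrix}x&z\\0&y\end{pmatrix}\mapsto\alpha(x)\beta(y)$. $T_{-1}\subset G$ is the anisotropic torus, i.e. the image of $\mathbb{F}_{q^2}^\times$ acting by multiplication on $\mathbb{F}_{q^2}\cong\mathbb{F}_q^2$.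 A character $\Lambda\in\widehat{T_{-1}}$ is decomposable if $\Lambda=\alpha\circ\det$ (restricted to $T_{-1}$) for some $\alpha\in\widehat{\mathbb{F}_q^\times}$, and indecomposable otherwise; $\bar\Lambda\in\widehat{\mathbb{F}_q^\times}$ is $\bar\Lambda(x)=\Lambda(xI)$. The irreducible representations of $G$ are: $\chi_\alpha^1=\alpha\circ\det$; $\chi_\alpha^q$, of dimension $q$, determined by $\mathrm{Ind}_B^G(\alpha,\alpha)=\chi_\alpha^1\oplus\chi_\alpha^q$; $\chi_{(\beta,\gamma)}^{q+1}=\mathrm{Ind}_B^G(\beta,\gamma)$ for $\beta\ne\gamma$, of dimension $q+1$; and, for $\Lambda$ indecomposable, the cuspidal representation $\chi_\Lambda^{-1}$ (the superscript $-1$ is only part of the notation) of dimension $q-1$, whose character is $(q-1)\bar\Lambda(x)$ at $xI$, $-\bar\Lambda(x)$ at $\begin{pmatrix}x&1\\0&x\end{pmatrix}$, $0$ at elements with two distinct eigenvalues in $\mathbb{F}_q$, and $-(\Lambda(t)+\Lambda(t)^q)$ at non-scalar $t\in T_{-1}$. *)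

(* Defs.v *)
From HB Require Import structures.
From mathcomp Require Import all_boot all_order all_algebra all_fingroup.
From mathcomp Require Import all_solvable all_field all_character.

Set Implicit Arguments.
Unset Strict Implicit.
Unset Printing Implicit Defensive.

Import GroupScope GRing.Theory.
Local Open Scope ring_scope.

(* Homomorphisms A -> K^*, for A a subgroup of gT. Only the values on A are   *)
(* meaningful, and these are nonzero since x \in A implies x^-1 \in A.        *)
Record lin_char (K : fieldType) (gT : finGroupType) (A : {set gT}) := LinChar {
  lc_fun :> gT -> K;
  lc_fun1 : lc_fun 1%g = 1;
  lc_funM : {in A &, {morph lc_fun : x y / (x * y)%g >-> x * y}} }.

Section Characters.

Variables (K : fieldType) (gT : finGroupType) (A : {set gT}).

Lemma triv_char1 : (fun _ : gT => 1 : K) 1%g = 1.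
Proof. by []. Qed.

Lemma triv_charM :
  {in A &, {morph (fun _ : gT => 1 : K) : x y / (x * y)%g >-> x * y}}.
Proof. by move=> x y _ _; rewrite mulr1. Qed.

Definition triv_char : lin_char K A := LinChar triv_char1 triv_charM.

Variable lam : lin_char K A.

Lemma inv_char1 : (fun x => (lam x)^-1) 1%g = 1.
Proof. by rewrite /= lc_fun1 invr1. Qed.

Lemma inv_charM :
  {in A &, {morph (fun x => (lam x)^-1) : x y / (x * y)%g >-> x * y}}.
Proof. by move=> x y Ax Ay; rewrite /= lc_funM // invfM. Qed.

Definition inv_char : lin_char K A := LinChar inv_char1 inv_charM.

End Characters.

Section Representations.

Variables (K : fieldType) (gT : finGroupType).

Lemma dual_mx_repr (G : {group gT}) n (rG : mx_representation K G n) :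
  mx_repr G (fun g => (rG g^-1%g)^T).
Proof.
split=> [|g h Gg Gh]; first by rewrite invg1 repr_mx1 trmx1.
by rewrite invMg repr_mxM ?groupV // trmx_mul.
Qed.

Definition dual_repr (G : {group gT}) n (rG : mx_representation K G n) :
  mx_representation K G n := MxRepresentation (dual_mx_repr rG).

Definition self_dual (G : {group gT}) n (rG : mx_representation K G n) : Prop :=
  mx_rsim rG (dual_repr rG).

Variables (G H : {group gT}) (lam : lin_char K H).

(* The induced representation, in the basis given by the representatives r_i  *)
(* of the cosets H r_i: the (i, j) entry at g is lam (r_i g r_j^-1), or 0     *)
(* if r_i g r_j^-1 is not in H.                                               *)
Definition Ind_mx (g : gT) : 'M[K]_#|rcosets H G| :=
  \matrix_(i, j) let h := (repr (enum_val i) * g * (repr (enum_val j))^-1)%g in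
                 if h \in H then lam h else 0.

Hypothesis sHG : H \subset G.

Lemma Ind_mx_repr : mx_repr G Ind_mx.
Proof.
have rP (i : 'I_#|rcosets H G|) : repr (enum_val i) \in G /\
    enum_val i = H :* repr (enum_val i).
  have /rcosetsP[x Gx Dx] := enum_valP i; split; last first.
    by rewrite Dx rcoset_repr.
  rewrite Dx; have /rcosetP[h Hh ->] := mem_repr_rcoset H x.
  by rewrite groupM // (subsetP sHG).
split.
  apply/matrixP=> i j; rewrite !mxE /= mulg1 -mem_rcoset.
  have [_ Di] := rP i; have [_ Dj] := rP j.
  rewrite -Dj; case: (altP (i =P j)) => [->|ne_ij].
    by rewrite Dj mem_repr_rcoset -Dj mulgV lc_fun1.
  rewrite ifN //; apply: contra ne_ij => ij; apply/eqP/enum_val_inj.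
  by rewrite Di Dj; apply/rcoset_eqP; rewrite -Dj.
move=> g h Gg Gh; apply/matrixP=> i k; rewrite !mxE /=.
have [Gi Di] := rP i.
have cosij : H :* (repr (enum_val i) * g)%g \in rcosets H G.
  by apply/rcosetsP; exists (repr (enum_val i) * g)%g; rewrite ?groupM.
pose j := enum_rank_in cosij (H :* (repr (enum_val i) * g)%g).
have Ej : enum_val j = H :* (repr (enum_val i) * g)%g by rewrite enum_rankK_in.
have [Gj Dj] := rP j.
have Hij : (repr (enum_val i) * g * (repr (enum_val j))^-1)%g \in H.
  by rewrite -mem_rcoset -Dj Ej rcoset_refl.
rewrite (bigD1 j) //= big1 => [|l ne_lj]; last first.
  have [_ Dl] := rP l.
  rewrite !mxE /= ifN ?mul0r // -mem_rcoset -Dl.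
  apply: contra ne_lj => il; apply/eqP/enum_val_inj; rewrite Ej Dl.
  by apply/esym/rcoset_eqP; rewrite -Dl.
rewrite addr0 !mxE /= Hij.
have -> : (repr (enum_val i) * (g * h) * (repr (enum_val k))^-1 =
    repr (enum_val i) * g * (repr (enum_val j))^-1 *
    (repr (enum_val j) * h * (repr (enum_val k))^-1))%g.
  by rewrite !mulgA mulgKV.
by rewrite groupMl //; case: ifP => [Hjk|]; rewrite ?mulr0 // lc_funM.
Qed.

Definition Ind_repr : mx_representation K G #|rcosets H G| :=
  MxRepresentation Ind_mx_repr.

End Representations.

Section GL2.

Variables (K : fieldType) (F : finFieldType).

Notation GL2 := 'GL_2[F]%G.
Notation Fchar := (lin_char K [set: {unit F}]).

Lemma unit_detGL (g : {'GL_2[F]}) : \det (GLval g) \is a GRing.unit.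
Proof. by rewrite unitfE GL_det. Qed.

Definition detGL (g : {'GL_2[F]}) : {unit F} := FinRing.unit F (unit_detGL g).

Lemma unit_scalGL (x : {unit F}) : ((val x)%:M : 'M[F]_2) \is a GRing.unit.
Proof. by rewrite -[_ \is a _]/(_ \in unitmx) unitmxE det_scalar unitrX ?(valP x). Qed.

Definition scalGL (x : {unit F}) : {'GL_2[F]} := FinRing.unit _ (unit_scalGL x).

Lemma detGLM (g h : {'GL_2[F]}) : detGL (g * h) = (detGL g * detGL h)%g.
Proof. by apply/val_inj; rewrite /= det_mulmx. Qed.

Lemma char_det_mx_repr (alpha : Fchar) :
  mx_repr GL2 (fun g => (alpha (detGL g))%:M : 'M[K]_1).
Proof.
split=> [|g h _ _]; last by rewrite detGLM lc_funM ?inE // scalar_mxM.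
suff -> : detGL 1 = 1%g by rewrite lc_fun1.
by apply/val_inj; rewrite /= det1.
Qed.

(* chi_alpha^1 *)
Definition char_det_repr (alpha : Fchar) : mx_representation K GL2 1 :=
  MxRepresentation (char_det_mx_repr alpha).

Definition Borel : {set {'GL_2[F]}} := [set g : {'GL_2[F]} | GLval g 1 0 == 0].

Lemma GL2_mul (g h : {'GL_2[F]}) i k :
  GLval (g * h)%g i k = GLval g i 0 * GLval h 0 k + GLval g i 1 * GLval h 1 k.
Proof.
rewrite GL_MxE mxE !big_ord_recl big_ord0 addr0; congr (_ + _ * _);
  by congr (GLval _ _ _); apply/val_inj.
Qed.

Lemma Borel_group_set : group_set Borel.
Proof.
apply/group_setP; split=> [|g h]; first by rewrite inE GL_1E mxE.
by rewrite !inE GL2_mul => /eqP-> /eqP->; rewrite mul0r mulr0 addr0.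
Qed.

Canonical Borel_group := Group Borel_group_set.

Lemma Borel_sub : Borel_group \subset GL2.
Proof. by apply/subsetP=> g _; rewrite inE. Qed.

(* x as an element of F^* when x != 0 (and the junk value 1 when x = 0). *)
Definition to_unit (x : F) : {unit F} := insubd (1%g : {unit F}) x.

Lemma to_unitM (x y : F) :
  x != 0 -> y != 0 -> to_unit (x * y) = (to_unit x * to_unit y)%g.
Proof.
move=> nz_x nz_y; apply/val_inj.
by rewrite /= !val_insubd !unitfE mulf_neq0 ?nz_x ?nz_y.
Qed.

Lemma Borel_diag (g : {'GL_2[F]}) :
  g \in Borel -> GLval g 0 0 != 0 /\ GLval g 1 1 != 0.
Proof.
rewrite inE => /eqP g10; have := GL_det g.
have -> : \det (GLval g) = GLval g 0 0 * GLval g 1 1.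
  rewrite -det_tr det_trig; last first.
    apply/is_trig_mxP=> -[[|[|i]] // Hi] [[|[|j]] // Hj] _.
    by rewrite mxE -g10; congr (GLval g _ _); apply/val_inj.
  rewrite !big_ord_recl big_ord0 mulr1 !mxE.
  by congr (GLval g _ _ * GLval g _ _); apply/val_inj.
by rewrite mulf_eq0 negb_or => /andP.
Qed.

Section BorelChar.

Variables alpha beta : Fchar.

Definition Borel_fun (g : {'GL_2[F]}) : K :=
  alpha (to_unit (GLval g 0 0)) * beta (to_unit (GLval g 1 1)).

Lemma Borel_fun1 : Borel_fun 1%g = 1.
Proof.
have E : to_unit 1 = 1%g by apply/val_inj; rewrite val_insubd unitr1.
by rewrite /Borel_fun GL_1E !mxE /= E !lc_fun1 mulr1.
Qed.

Lemma Borel_funM :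
  {in Borel &, {morph Borel_fun : g h / (g * h)%g >-> g * h}}.
Proof.
move=> g h Bg Bh; rewrite /Borel_fun !GL2_mul.
have [/[!inE] /eqP g10 /eqP h10] := (Bg, Bh).
have [g0 g1] := Borel_diag Bg; have [h0 h1] := Borel_diag Bh.
rewrite g10 h10 mulr0 addr0 mul0r add0r !to_unitM // !lc_funM ?inE //.
by rewrite mulrACA.
Qed.

(* (alpha, beta) *)
Definition Borel_char : lin_char K Borel := LinChar Borel_fun1 Borel_funM.

(* Ind_B^G (alpha, beta); it is chi_(alpha, beta)^(q+1) if alpha != beta. *)
Definition Ind_Borel : mx_representation K GL2 #|rcosets Borel GL2| :=
  Ind_repr (H := Borel_group) Borel_char Borel_sub.

End BorelChar.

(* rV is chi_alpha^q: Ind_B^G (alpha, alpha) is isomorphic to the direct sum  *)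
(* of chi_alpha^1 and rV.                                                     *)
Definition is_chi_q (alpha : Fchar) n (rV : mx_representation K GL2 n) : Prop :=
  mx_rsim (Ind_Borel alpha alpha)
    (dadd_grepr (Representation (char_det_repr alpha)) (Representation rV)).

Section Torus.

Variables (L : fieldExtType F) (e : 2.-tuple L).

(* The matrix of the multiplication by a in the basis e of L, acting on       *)
(* column vectors.                                                            *)
Definition mulL_mx (a : L) : 'M[F]_2 := \matrix_(i, j) coord e i (a * e`_j).

(* The elements of L are the \sum_k v 0 k *: e`_k, for v in the finite type   *)
(* 'rV[F]_2; GLval g is invertible, so only nonzero ones contribute.          *)
Definition torus : {set {'GL_2[F]}} :=
  [set g : {'GL_2[F]} |
    [exists v : 'rV[F]_2, GLval g == mulL_mx (\sum_k v 0 k *: e`_k)]].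

Variable Lam : lin_char K torus.

Definition decomposable : Prop :=
  exists alpha : Fchar, {in torus, forall t, Lam t = alpha (detGL t)}.

Definition bar (x : {unit F}) : K := Lam (scalGL x).

(* rV is chi_Lam^(-1), given by its character. *)
Definition is_chi_cuspidal n (rV : mx_representation K GL2 n) : Prop :=
  [/\ forall x : {unit F}, \tr (rV (scalGL x)) = (#|F|%:R - 1) * bar x,
      forall (x : {unit F}) (g : {'GL_2[F]}),
        GLval g = (val x)%:M + delta_mx 0 1 -> \tr (rV g) = - bar x,
      forall (g : {'GL_2[F]}) (a b : F),
        a != b -> eigenvalue (GLval g) a -> eigenvalue (GLval g) b ->
        \tr (rV g) = 0
    & {in torus, forall t, ~~ is_scalar_mx (GLval t) ->
        \tr (rV t) = - (Lam t + Lam t ^+ #|F|)}].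

End Torus.

End GL2.

(* Main.v *)
Require Import Defs.
From HB Require Import structures.
From mathcomp Require Import all_boot all_order all_algebra all_fingroup.
From mathcomp Require Import all_solvable all_field all_character.
From mathcomp Require Import reals complex ring.

Set Implicit Arguments.
Unset Strict Implicit.
Unset Printing Implicit Defensive.

Import Order.TTheory GRing.Theory Num.Theory.
Local Open Scope ring_scope.

(** Write q for the cardinal of F, G for GL(2, F), B for the subgroup of upper
triangular matrices, U for the unipotent ones, T for the anisotropic torus. An
irreducible representation V is studied through the vectors fixed by U.

If U fixes a nonzero vector, then it fixes an eigenvector of B, because the
diagonal matrices commute and stabilise the space fixed by U
(Borel_eigenvector). Frobenius reciprocity makes V a quotient of some
I = Ind (alpha, beta). As B has two double cosets in G, there are few maps
between two such induced representations (Mackey_nonzero, Mackey_equal): I is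
irreducible when alpha and beta differ (quotient_Ind_neq), and otherwise it is
the sum of alpha \o det and of another irreducible representation
(quotient_Ind_eq). In the basis of cosets the dual of I is exactly
Ind (alpha^-1, beta^-1). If V is self-dual, then I -> V = V^* -> I^* is a
nonzero map between induced representations, so that either alpha and beta have
squares 1 or alpha beta = 1 (self_dual_quotient). The converse uses the
isomorphism between Ind (alpha, beta) and Ind (beta, alpha) (swap_rsim) and, for
chi_alpha^q, the fact that an irreducible representation is self-dual if and
only if its character takes the same values at g and g^-1 (self_dualE).

If U fixes no nonzero vector, then the elements of U act on V with the sum 0.
This determines the character of V on B: it is 0 at non-scalar split elements,
and at a unipotent element other than 1 it is -m, where n = m (q - 1) is the
dimension of V; m is a natural number, since it is the multiplicity in V of a
character of U (cusp_split, cusp_uni, cusp_dim). The class function of T called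
the defect of V is m times the character induced to T from the central character
of V, minus the character of V. Its Fourier coefficients d_j are integers, their
sum is its value 2 m at 1, and the sum of their squares is 2, by Parseval and
because the character of V has norm 1 on G (nonsplit_sum turns the latter into a
statement about T). As the d_j^2 - d_j are nonnegative integers with the sum
2 - 2 m, we get m = 1 and the defect is a sum of two distinct characters
(defect_two_chars). This yields the multiplicity one theorem for U together with
the parameter Lambda. Conjugation of t to t^q in G exchanges the two characters,
and the case where it fixes both of them, that is, where they factor through
the determinant, contradicts the orthogonality of V to alpha \o det
(defect_not_det). If V is self-dual, then inversion also preserves the pair;
since it cannot fix Lambda, it agrees with Lambda |-> Lambda^q, which means that
Lambda is trivial on the norms t^(q + 1), that is, on the scalars
(cuspidal_parameter). Conversely, such a Lambda gives a character of V that is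
invariant under inversion (cuspidal_self_dual). *)

(** * Schur's lemma and orthogonality over an algebraically closed field *)

Section Intertwiners.

Variables (K : numClosedFieldType) (gT : finGroupType) (G : {group gT}).

Definition intertwines n m (rV : mx_representation K G n)
    (rW : mx_representation K G m) (X : 'M[K]_(n, m)) : Prop :=
  {in G, forall g, rV g *m X = X *m rW g}.

Variables (n m : nat) (rV : mx_representation K G n).
Variable rW : mx_representation K G m.

Lemma intertwiner_ker_module (X : 'M_(n, m)) :
  intertwines rV rW X -> mxmodule rV (kermx X).
Proof.
move=> homX; apply/mxmoduleP=> g Gg; apply/sub_kermxP.
by rewrite -mulmxA homX // mulmxA mulmx_ker mul0mx.
Qed.

Lemma intertwiner_free (X : 'M_(n, m)) :
  mx_irreducible rV -> intertwines rV rW X -> X != 0 -> row_free X.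
Proof.
case/mx_irrP=> _ irrV homX nzX; rewrite -kermx_eq0.
apply: contraR nzX => /(irrV _ (intertwiner_ker_module homX)) fullK.
by rewrite -[X]mul1mx; apply/eqP/sub_kermxP; rewrite sub1mx.
Qed.

Lemma intertwiner_full (X : 'M_(n, m)) :
  mx_irreducible rW -> intertwines rV rW X -> X != 0 -> row_full X.
Proof.
case/mx_irrP=> _ irrW homX nzX; suff: row_full <<X>>%MS by rewrite /row_full mxrank_gen.
apply: irrW; last by rewrite -mxrank_eq0 genmxE mxrank_eq0.
rewrite (eqmx_module _ (genmxE X)).
by apply/mxmoduleP=> g Gg; rewrite -homX // submxMl.
Qed.

Lemma intertwiner_rsim (X : 'M_(n, m)) :
  row_free X -> row_full X -> intertwines rV rW X -> mx_rsim rV rW.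
Proof.
move=> freeX fullX homX; apply: (MxReprSim (B := X)) => //.
by rewrite -(eqP freeX) (eqP fullX).
Qed.

Lemma Schur_rsim (X : 'M_(n, m)) :
  mx_irreducible rV -> mx_irreducible rW -> intertwines rV rW X -> X != 0 ->
  mx_rsim rV rW.
Proof.
move=> irrV irrW homX nzX; apply: (intertwiner_rsim _ _ homX).
  exact: intertwiner_free homX nzX.
exact: intertwiner_full homX nzX.
Qed.

Lemma Schur_scalar (X : 'M_n) :
  mx_irreducible rV -> intertwines rV rV X -> exists c, X = c%:M.
Proof.
move=> irrV homX; apply/is_scalar_mxP.
apply: (@mx_abs_irr_cent_scalar _ _ _ _ rV).
  exact: group_closure_closed_field.
by apply/centgmxP=> g Gg; rewrite homX.
Qed.

Definition averaged (X : 'M[K]_(n, m)) : 'M[K]_(n, m) :=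
  \sum_(g in G) rV g^-1%g *m X *m rW g.

Lemma averaged_intertwines (X : 'M_(n, m)) : intertwines rV rW (averaged X).
Proof.
move=> h Gh; rewrite /averaged mulmx_sumr mulmx_suml.
rewrite (reindex_inj (mulIg h)) /= (eq_bigl (mem G)); last first.
  by move=> g; rewrite /= groupMr.
apply: eq_bigr => g Gg; rewrite !mulmxA -repr_mxM ?groupV ?groupM //.
by rewrite invMg mulKVg repr_mxM // mulmxA.
Qed.

(** The scalar product of two characters is the trace of X |-> averaged X, read
off the elementary matrices. *)
Lemma sum_trace_averaged :
  \sum_(g in G) \tr (rV g^-1%g) * \tr (rW g) =
    \sum_i \sum_j averaged (delta_mx i j) i j.
Proof.
under eq_bigr => g _ do rewrite mulr_suml.
rewrite exchange_big; apply: eq_bigr => i _ /=.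
under eq_bigr => g _ do rewrite mulr_sumr.
rewrite exchange_big; apply: eq_bigr => j _ /=.
rewrite /averaged summxE; apply: eq_bigr => g _.
rewrite mxE (bigD1 j) //= big1 ?addr0 => [|k nkj]; last first.
  rewrite mxE big1 ?mul0r // => l _.
  by rewrite mxE (negPf nkj) andbF mulr0.
rewrite mxE (bigD1 i) //= big1 ?addr0 => [|k nki]; last first.
  by rewrite mxE (negPf nki) mulr0.
by rewrite mxE !eqxx mulr1.
Qed.

End Intertwiners.

Section CharacterOrthogonality.

Variables (K : numClosedFieldType) (gT : finGroupType) (G : {group gT}).

(** By Schur's lemma the average of a matrix is a scalar, which its trace
determines. *)
Lemma irr_trace_norm n (rV : mx_representation K G n) :
  mx_irreducible rV ->
  \sum_(g in G) \tr (rV g^-1%g) * \tr (rV g) = #|G|%:R.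
Proof.
move=> irrV; have [n_gt0 _] := (mx_irrP _).1 irrV.
rewrite sum_trace_averaged.
have nzn : n%:R != 0 :> K by rewrite pnatr_eq0 -lt0n.
have avgE i j : averaged rV rV (delta_mx i j) =
    (#|G|%:R * (i == j)%:R / n%:R)%:M.
  have [c Dc] := Schur_scalar irrV (averaged_intertwines rV rV (delta_mx i j)).
  rewrite Dc; congr (_%:M); apply: (mulIf nzn); rewrite divfK //.
  rewrite [c * _]mulr_natr -(mxtrace_scalar n c) -Dc /averaged raddf_sum /=.
  transitivity (\sum_(g in G) ((i == j)%:R : K)).
    apply: eq_bigr => g Gg; rewrite mxtrace_mulC mulmxA -repr_mxM ?groupV //.
    rewrite mulgV repr_mx1 mul1mx /mxtrace (bigD1 i) //= big1 ?addr0.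
      by rewrite mxE eqxx.
    by move=> k nki; rewrite mxE (negPf nki).
  by rewrite sumr_const mulr_natl.
under eq_bigr => i _ do under eq_bigr => j _ do rewrite avgE mxE.
transitivity (\sum_(i < n) (#|G|%:R / n%:R : K)).
  apply: eq_bigr => i _; rewrite (bigD1 i) //= big1 ?addr0 ?eqxx ?mulr1 //.
  by move=> j; rewrite eq_sym => /negPf->.
by rewrite sumr_const card_ord -[LHS]mulr_natr divfK.
Qed.

(** An irreducible representation is determined by its character: otherwise
every averaged matrix vanishes, and so does the scalar product. *)
Lemma irr_trace_rsim n m (rV : mx_representation K G n)
    (rW : mx_representation K G m) :
    mx_irreducible rV -> mx_irreducible rW ->
  {in G, forall g, \tr (rV g) = \tr (rW g)} -> mx_rsim rV rW.
Proof.
move=> irrV irrW eqVW.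
have : \sum_i \sum_j averaged rV rW (delta_mx i j) i j != 0.
  rewrite -sum_trace_averaged.
  rewrite (eq_bigr (fun g => \tr (rV g^-1%g) * \tr (rV g))); last first.
    by move=> g Gg; rewrite (eqVW g).
  by rewrite irr_trace_norm // pnatr_eq0 -lt0n cardG_gt0.
have [nz _|all0] := boolP [exists i, exists j,
    averaged rV rW (delta_mx i j) != 0].
  have [i /existsP[j nzA]] := existsP nz.
  exact: Schur_rsim (averaged_intertwines _ _ _) nzA.
case/eqP; rewrite big1 // => i _; rewrite big1 // => j _.
move: all0; rewrite negb_exists => /forallP/(_ i).
rewrite negb_exists => /forallP/(_ j).
by rewrite negbK => /eqP->; rewrite mxE.
Qed.

(** A submodule U of the dual corresponds to its annihilator in V, the kernel of
the transpose of U. *)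
Lemma dual_irr n (rV : mx_representation K G n) :
  mx_irreducible rV -> mx_irreducible (dual_repr rV).
Proof.
move=> irrV; have [n_gt0 _] := (mx_irrP _).1 irrV; apply/mx_irrP; split=> // U modU nzU.
have modK : mxmodule rV (kermx U^T).
  apply/mxmoduleP=> g Gg; apply/sub_kermxP; rewrite -mulmxA.
  have /(mxmoduleP modU)/submxP[B DB] : g^-1%g \in G by rewrite groupV.
  have -> : rV g *m U^T = U^T *m B^T.
    by rewrite -[LHS]trmxK trmx_mul trmxK -trmx_mul -DB /= invgK.
  by rewrite mulmxA mulmx_ker mul0mx.
have [_ simV] := (mx_irrP _).1 irrV.
have [k0|nzk] := eqVneq (kermx U^T) 0.
  by move/eqP: k0; rewrite kermx_eq0 /row_free /row_full mxrank_tr.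
case/eqP: nzU; apply: trmx_inj; rewrite trmx0 -[U^T]mul1mx.
by apply/sub_kermxP; rewrite sub1mx simV.
Qed.

Lemma trace_dual n (rV : mx_representation K G n) g :
  \tr (dual_repr rV g) = \tr (rV g^-1%g).
Proof. by rewrite /= mxtrace_tr. Qed.

Lemma self_dual_trace n (rV : mx_representation K G n) : self_dual rV ->
  {in G, forall g, \tr (rV g^-1%g) = \tr (rV g)}.
Proof. by move=> sdV g Gg; rewrite -trace_dual -(mxtrace_rsim sdV). Qed.

Lemma self_dualE n (rV : mx_representation K G n) : mx_irreducible rV ->
  self_dual rV <-> {in G, forall g, \tr (rV g^-1%g) = \tr (rV g)}.
Proof.
move=> irrV; split=> [|eqV]; first exact: self_dual_trace.
by apply: irr_trace_rsim => [||g Gg]; rewrite ?trace_dual ?eqV //; apply: dual_irr.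
Qed.

(** The trace of V is the difference of the traces of I and of A. *)
Lemma self_dual_summand (rI rA : representation K G) n
    (rV : mx_representation K G n) :
    mx_irreducible rV -> mx_rsim rI (dadd_grepr rA (Representation rV)) ->
  self_dual rI -> self_dual rA -> self_dual rV.
Proof.
move=> irrV simI sdI sdA; apply/(self_dualE irrV) => g Gg.
have trE h : h \in G -> \tr (rV h) = \tr (rI h) - \tr (rA h).
  by move=> Gh; rewrite (mxtrace_rsim simI Gh) /= mxtrace_block addrC addKr.
by rewrite !trE ?groupV // !self_dual_trace.
Qed.

Lemma dual_rsim n m (rV : mx_representation K G n)
    (rW : mx_representation K G m) :
  mx_rsim rV rW -> mx_rsim (dual_repr rV) (dual_repr rW).
Proof.
move/mx_rsim_sym=> simWV; have [B eq_mn freeB homB] := simWV.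
have fullB : row_full B by rewrite -[row_full B]/(\rank B == n) (eqP freeB) eq_mn.
apply: (@intertwiner_rsim _ _ _ _ _ _ _ B^T).
- by rewrite /row_free mxrank_tr.
- by rewrite /row_full mxrank_tr.
move=> g Gg /=; rewrite -!trmx_mul homB ?groupV //.
Qed.

End CharacterOrthogonality.

(** * Multiplicities of linear characters *)

Section Multiplicity.

Variable K : numClosedFieldType.

(** In a factorisation P = C R of full rank, idempotence forces R C = 1. *)
Lemma trace_idempotent n (P : 'M[K]_n) : P *m P = P -> \tr P = (\rank P)%:R.
Proof.
move=> PP; have DP := mulmx_base P.
have freeC : row_free (row_base P) by apply: row_base_free.
have fullC : row_full (col_base P) by apply: col_base_full.
suff RC : row_base P *m col_base P = 1%:M.
  by rewrite -{1}DP mxtrace_mulC RC mxtrace1.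
apply: (row_full_inj fullC); apply: (row_free_inj freeC).
by rewrite /= mulmx1 (mulmxA (col_base P)) DP -mulmxA DP.
Qed.

(** The projection onto the f-isotypic part is idempotent; its trace, the scalar
product of f and of the character, is thus a rank. *)
Lemma multiplicity_nat (gT : finGroupType) (H : {group gT}) n
    (rH : mx_representation K H n) (f : gT -> K) :
    f 1%g = 1 -> {in H &, {morph f : x y / (x * y)%g >-> x * y}} ->
  exists k : nat, \sum_(h in H) f h^-1%g * \tr (rH h) = (k * #|H|)%:R.
Proof.
move=> f1 fM; pose P := #|H|%:R^-1 *: \sum_(h in H) f h^-1%g *: rH h.
have nzH : #|H|%:R != 0 :> K by rewrite pnatr_eq0 -lt0n.
have mulP h : h \in H -> rH h *m P = f h *: P.
  move=> Hh; rewrite /P -scalemxAr scalerA mulrC -scalerA; congr (_ *: _).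
  rewrite mulmx_sumr scaler_sumr.
  rewrite [RHS](reindex_inj (mulgI h)) /=.
  rewrite [RHS](eq_bigl (mem H)); last by move=> g; rewrite /= groupMl.
  apply: eq_bigr => g Hg; rewrite repr_mxM // -scalemxAr scalerA; congr (_ *: _).
  by rewrite invMg mulrC -fM ?groupM ?groupV // mulgKV.
have PP : P *m P = P.
  rewrite {1}/P -scalemxAl mulmx_suml.
  under eq_bigr => h Hh do rewrite -scalemxAl mulP // scalerA -fM ?groupV // mulVg f1 scale1r.
  by rewrite sumr_const -scaler_nat scalerA mulVf // scale1r.
exists (\rank P); rewrite natrM -trace_idempotent // /P mxtraceZ raddf_sum /=.
rewrite mulrAC mulVf // mul1r; apply: eq_bigr => h _.
by rewrite mxtraceZ.
Qed.

End Multiplicity.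

(** * Two-by-two matrices *)

Section Matrix2.

Variable F : fieldType.
Implicit Types A B : 'M[F]_2.

Lemma ord2P (P : 'I_2 -> Prop) : P 0 -> P 1 -> forall i, P i.
Proof.
move=> P0 P1 [[|[|i]] lti] //.
  by have -> : Ordinal lti = 0 by apply/val_inj.
by have -> : Ordinal lti = 1 by apply/val_inj.
Qed.

Lemma sum2 (V : nmodType) (f : 'I_2 -> V) : \sum_i f i = f 0 + f 1.
Proof.
rewrite !big_ord_recl big_ord0 addr0; congr (f _ + f _); exact/val_inj.
Qed.

Lemma mx2_eq A B :
  A 0 0 = B 0 0 -> A 0 1 = B 0 1 -> A 1 0 = B 1 0 -> A 1 1 = B 1 1 -> A = B.
Proof.
move=> e00 e01 e10 e11; apply/matrixP; apply: ord2P; by apply: ord2P.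
Qed.

Lemma mulmx2E A B i k : (A *m B) i k = A i 0 * B 0 k + A i 1 * B 1 k.
Proof. by rewrite mxE sum2. Qed.

Lemma det2E A : \det A = A 0 0 * A 1 1 - A 0 1 * A 1 0.
Proof.
rewrite (expand_det_row _ 0) sum2 /cofactor !det_mx11 !mxE /=.
rewrite addn0 expr0 mul1r expr1 mulN1r mulrN.
by congr (_ * A _ _ - _ * A _ _); apply/val_inj.
Qed.

Lemma tr2E A : \tr A = A 0 0 + A 1 1.
Proof. exact: sum2. Qed.

Definition mk2 (a b c d : F) : 'M[F]_2 :=
  \matrix_(i, j) if i == 0 then (if j == 0 then a else b)
                 else if j == 0 then c else d.

Lemma mk2E a b c d : (mk2 a b c d 0 0 = a) * (mk2 a b c d 0 1 = b) *
  (mk2 a b c d 1 0 = c) * (mk2 a b c d 1 1 = d).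
Proof. by rewrite !mxE. Qed.

Lemma scalar2E (a : F) : (a%:M : 'M[F]_2) = mk2 a 0 0 a.
Proof. by apply: mx2_eq; rewrite mk2E mxE. Qed.

Lemma is_scalar2 A :
  is_scalar_mx A = [&& A 0 0 == A 1 1, A 0 1 == 0 & A 1 0 == 0].
Proof.
apply/is_scalar_mxP/and3P=> [[a ->] | [/eqP eA /eqP A01 /eqP A10]].
  by rewrite scalar2E !mk2E !eqxx.
by exists (A 0 0); rewrite scalar2E; apply: mx2_eq; rewrite mk2E.
Qed.

(** A vector v that is not an eigenvector of A gives a basis (v, v A), in which A
becomes its companion matrix. Hence the trace and the determinant classify the
non-scalar matrices up to conjugation. *)
Lemma companion2 A : ~~ is_scalar_mx A ->
  exists2 P, P \in unitmx & P *m A = mk2 0 1 (- \det A) (\tr A) *m P.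
Proof.
move=> nsA.
suff [x [y nz]] : exists x y, x * (x * A 0 1 + y * A 1 1)
    - y * (x * A 0 0 + y * A 1 0) != 0.
  exists (mk2 x y (x * A 0 0 + y * A 1 0) (x * A 0 1 + y * A 1 1)).
    by rewrite unitmxE det2E !mk2E unitfE.
  by apply: mx2_eq; rewrite !mulmx2E !mk2E ?det2E ?tr2E; ring.
have [A01|nz] := eqVneq (A 0 1) 0; last first.
  by exists 1, 0; rewrite !mul0r subr0 addr0 !mul1r.
have [A10|nz] := eqVneq (A 1 0) 0; last first.
  by exists 0, 1; rewrite !mul0r sub0r add0r !mul1r oppr_eq0.
exists 1, 1; rewrite !mul1r A01 A10 add0r addr0 subr_eq0.
by apply: contraNneq nsA => eqA; rewrite is_scalar2 A01 A10 eqA !eqxx.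
Qed.

Lemma conj2 A B : ~~ is_scalar_mx A -> ~~ is_scalar_mx B ->
    \tr A = \tr B -> \det A = \det B ->
  exists2 P, P \in unitmx & P *m A = B *m P.
Proof.
move=> /companion2[P uP PA] /companion2[Q uQ QB] eqt eqd.
exists (invmx Q *m P); first by rewrite unitmx_mul unitmx_inv uQ.
apply: (can_inj (mulKmx uQ)); rewrite !mulmxA QB mulmxV // mul1mx PA eqt eqd.
by rewrite -(mulmxA _ Q) mulmxV // mulmx1.
Qed.

(** A commutes with B when the vectors (A 0 0 - A 1 1, A 0 1, A 1 0) and
(B 0 0 - B 1 1, B 0 1, B 1 0) are proportional; the first one is not 0. *)
Lemma commutant2 A B : ~~ is_scalar_mx A -> A *m B = B *m A ->
  exists a b, B = a%:M + b *: A.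
Proof.
move=> nsA cAB.
have e00 : A 0 1 * B 1 0 = B 0 1 * A 1 0.
  have := congr1 (fun M : 'M_2 => M 0 0) cAB; rewrite !mulmx2E mulrC => /addrI.
  by [].
have e01 : (A 0 0 - A 1 1) * B 0 1 = A 0 1 * (B 0 0 - B 1 1).
  have := congr1 (fun M : 'M_2 => M 0 1) cAB; rewrite !mulmx2E => e.
  by apply/eqP; rewrite -subr_eq0; apply/eqP; move/eqP: e; rewrite -subr_eq0 => /eqP <-; ring.
have e10 : (A 0 0 - A 1 1) * B 1 0 = A 1 0 * (B 0 0 - B 1 1).
  have := congr1 (fun M : 'M_2 => M 1 0) cAB; rewrite !mulmx2E => e.
  by apply/eqP; rewrite -subr_eq0; apply/eqP; move/eqP: e; rewrite eq_sym -subr_eq0 => /eqP <-; ring.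
suff [b [eb1 eb2 eb3]] : exists b, [/\ B 0 1 = b * A 0 1, B 1 0 = b * A 1 0
    & B 0 0 - B 1 1 = b * (A 0 0 - A 1 1)].
  exists (B 1 1 - b * A 1 1), b; rewrite scalar2E.
  have B00 : B 0 0 = B 1 1 + b * (A 0 0 - A 1 1) by rewrite -eb3 addrC subrK.
  by apply: mx2_eq; rewrite mxE mk2E mxE ?eb1 ?eb2 ?B00; ring.
have [A01|nz] := eqVneq (A 0 1) 0; last first.
  exists (B 0 1 / A 0 1); split; first by rewrite divfK.
    by apply: (mulfI nz); rewrite e00; field.
  by apply: (mulfI nz); rewrite -e01; field.
have [A10|nz] := eqVneq (A 1 0) 0; last first.
  exists (B 1 0 / A 1 0); split; last by apply: (mulfI nz); rewrite -e10; field.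
    by apply: (mulIf nz); rewrite -e00; field.
  by rewrite divfK.
have nz : A 0 0 - A 1 1 != 0.
  by rewrite subr_eq0; apply: contra nsA => eqA; rewrite is_scalar2 A01 A10 eqA !eqxx.
exists ((B 0 0 - B 1 1) / (A 0 0 - A 1 1)); rewrite A01 A10 !mulr0 divfK //.
split=> //; apply: (mulfI nz); rewrite mulr0 ?e01 ?e10 ?A01 ?A10 mul0r //.
Qed.

Lemma CayleyHamilton2 A : A *m A = \tr A *: A - (\det A)%:M.
Proof.
by rewrite scalar2E; apply: mx2_eq; rewrite !mulmx2E !mxE /= ?det2E ?tr2E; ring.
Qed.

Lemma det_adj2 A : \det ((\tr A)%:M - A) = \det A.
Proof.
by rewrite !det2E tr2E !mxE /= !mulr1n !mulr0n; ring.
Qed.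

Lemma eigenvalue2 A x :
  eigenvalue A x = (x ^+ 2 - \tr A * x + \det A == 0).
Proof.
rewrite /eigenvalue /eigenspace kermx_eq0 row_free_unit unitmxE unitfE negbK.
congr (_ == 0); rewrite !det2E tr2E !mxE /= !mulr1n !mulr0n; ring.
Qed.

End Matrix2.

Lemma conjg_eq (gT : finGroupType) (x g h : gT) :
  (x * g = h * x)%g -> (g ^ x^-1 = h)%g.
Proof. by move=> e; rewrite conjgE invgK mulgA e mulgK. Qed.

(** With this form of the type, products, powers and conjugates are those of the
finite group structure, to which the general theorems on finite groups apply. *)
Notation gl2 F := (FinGroup.sort {'GL_2[F]}).

(** * Matrices in GL(2, F) *)

Section GL2.

Variable F : finFieldType.
Implicit Types g h : gl2 F.
Implicit Types x y : F.
Notation GL2 := 'GL_2[F]%G.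

Definition gl (M : 'M[F]_2) : gl2 F := insubd (1%g : gl2 F) M.

Lemma glK (M : 'M[F]_2) : \det M != 0 -> GLval (gl M) = M.
Proof.
move=> nz; rewrite /gl; apply: insubdK.
by rewrite -[_ \in _]/(M \in unitmx) unitmxE unitfE.
Qed.

Lemma GLval_inj : injective (@GLval 2 F).
Proof. exact: val_inj. Qed.

Lemma glM_mx g h : GLval (g * h)%g = GLval g *m GLval h.
Proof. by []. Qed.

Lemma GLval1 : GLval (1%g : gl2 F) = 1%:M.
Proof. by []. Qed.

Lemma GLvalV g : GLval g^-1%g = invmx (GLval g).
Proof. exact: GL_VxE. Qed.

Lemma GLval_unit g : GLval g \in unitmx.
Proof. exact: GL_unitmx. Qed.

Lemma inv2E g : GLval g^-1%g = (\det (GLval g))^-1 *: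
  mk2 (GLval g 1 1) (- GLval g 0 1) (- GLval g 1 0) (GLval g 0 0).
Proof.
have nz := GL_det g; apply: (can_inj (mulKmx (GLval_unit g))).
rewrite -glM_mx mulgV GLval1; rewrite scalar2E -scalemxAr.
by apply: mx2_eq; rewrite [RHS]mxE !mulmx2E !mk2E; move: nz; rewrite det2E => nz; field.
Qed.

Lemma conjGL (A B : gl2 F) :
    ~~ is_scalar_mx (GLval A) -> ~~ is_scalar_mx (GLval B) ->
    \tr (GLval A) = \tr (GLval B) -> \det (GLval A) = \det (GLval B) ->
  exists u : gl2 F, (A ^ u = B)%g.
Proof.
move=> nsA nsB eqt eqd; have [P uP PA] := conj2 nsA nsB eqt eqd.
have DP : GLval (gl P) = P by rewrite glK // -unitfE -unitmxE.
exists (gl P)^-1%g; apply: conjg_eq; apply: GLval_inj.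
by rewrite !glM_mx DP.
Qed.

Lemma tr_conj g (x : gl2 F) : \tr (GLval (g ^ x)%g) = \tr (GLval g).
Proof.
rewrite conjgE 2!glM_mx mxtrace_mulC -mulmxA GLvalV mulmxV ?GLval_unit //.
by rewrite mulmx1.
Qed.

Lemma det_conj g (x : gl2 F) : \det (GLval (g ^ x)%g) = \det (GLval g).
Proof.
rewrite conjgE 2!glM_mx !det_mulmx GLvalV det_inv mulrC mulfK //.
exact: GL_det.
Qed.

Lemma scalarGL_conj g (x : gl2 F) :
  is_scalar_mx (GLval (g ^ x)%g) = is_scalar_mx (GLval g).
Proof.
have sconj h (y : gl2 F) : is_scalar_mx (GLval h) -> is_scalar_mx (GLval (h ^ y)%g).
  move=> /is_scalar_mxP[a Da]; rewrite conjgE 2!glM_mx Da.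
  apply/is_scalar_mxP; exists a.
  by rewrite -scalar_mxC mulmxA GLvalV mulVmx ?GLval_unit // mul1mx.
by apply/idP/idP=> /sconj // /(_ x^-1%g); rewrite conjgK.
Qed.

Lemma scalGL_commute (x : {unit F}) g : commute (scalGL x) g.
Proof. by apply: GLval_inj; rewrite !glM_mx /= scalar_mxC. Qed.

Lemma is_scalarGL g : is_scalar_mx (GLval g) -> exists z, g = scalGL z.
Proof.
move=> /is_scalar_mxP[a Da].
have nza : a \is a GRing.unit.
  by rewrite unitfE; have := GL_det g; rewrite Da det_scalar expf_eq0.
by exists (FinRing.unit F nza); apply: GLval_inj.
Qed.

(** ** Unipotent and diagonal elements *)

Definition uni x : gl2 F := gl (mk2 1 x 0 1).

Definition dia (a d : {unit F}) : gl2 F := gl (mk2 (val a) 0 0 (val d)).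

Lemma uniE x : GLval (uni x) = mk2 1 x 0 1.
Proof. by rewrite glK // det2E !mk2E mulr0 subr0 mulr1 oner_eq0. Qed.

Lemma unitF_neq0 (a : {unit F}) : val a != 0.
Proof. by rewrite -unitfE (valP a). Qed.

Lemma diaE (a d : {unit F}) : GLval (dia a d) = mk2 (val a) 0 0 (val d).
Proof. by rewrite glK // det2E !mk2E mulr0 subr0 mulf_neq0 ?unitF_neq0. Qed.

Lemma uniD x y : uni (x + y) = (uni x * uni y)%g.
Proof.
apply: GLval_inj; rewrite glM_mx !uniE.
by apply: mx2_eq; rewrite mulmx2E !mk2E; ring.
Qed.

Lemma uni0 : uni 0 = 1%g.
Proof. by apply: GLval_inj; rewrite uniE GLval1 scalar2E. Qed.

Lemma diaM (a d a' d' : {unit F}) :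
  dia (a * a')%g (d * d')%g = (dia a d * dia a' d')%g.
Proof.
apply: GLval_inj; rewrite glM_mx !diaE.
by apply: mx2_eq; rewrite mulmx2E !mk2E /=; ring.
Qed.

Lemma dia_uni (a d : {unit F}) x :
  (dia a d * uni x)%g = (uni (val a * x / val d)%R * dia a d)%g.
Proof.
apply: GLval_inj; rewrite !glM_mx !diaE !uniE.
by have nz := unitF_neq0 d; apply: mx2_eq; rewrite !mulmx2E !mk2E; field.
Qed.

Lemma scal_dia (a : {unit F}) : scalGL a = dia a a.
Proof. by apply: GLval_inj; rewrite diaE -scalar2E. Qed.

Lemma uni_Borel x : uni x \in Borel F.
Proof. by rewrite inE uniE mk2E. Qed.

Lemma dia_Borel (a d : {unit F}) : dia a d \in Borel F.
Proof. by rewrite inE diaE mk2E. Qed.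

Lemma to_unitK (a : {unit F}) : to_unit (val a) = a.
Proof. by apply/val_inj; rewrite val_insubd (valP a). Qed.

Lemma val_to_unit x : x != 0 -> val (to_unit x) = x.
Proof. by move=> nz; rewrite val_insubd unitfE nz. Qed.

Lemma Borel_dec g : g \in Borel F ->
  g = mulg (dia (to_unit (GLval g 0 0)) (to_unit (GLval g 1 1)))
           (uni (GLval g 0 1 / GLval g 0 0)).
Proof.
move=> Bg; have [nz0 nz1] := Borel_diag Bg; move: Bg; rewrite inE => /eqP g10.
apply: GLval_inj; rewrite glM_mx diaE uniE !val_to_unit //.
by apply: mx2_eq; rewrite mulmx2E !mk2E ?g10; field.
Qed.

Lemma uni_nonscalar x : x != 0 -> ~~ is_scalar_mx (GLval (uni x)).
Proof. by move=> nz; rewrite is_scalar2 uniE !mk2E (negPf nz) andbF. Qed.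

Definition jordan (z : {unit F}) x : gl2 F := gl (mk2 (val z) x 0 (val z)).

Lemma jordanE z x : GLval (jordan z x) = mk2 (val z) x 0 (val z).
Proof. by rewrite glK // det2E !mk2E mulr0 subr0 mulf_neq0 ?unitF_neq0. Qed.

Lemma jordan_nonscalar z x : x != 0 -> ~~ is_scalar_mx (GLval (jordan z x)).
Proof. by move=> nz; rewrite is_scalar2 jordanE !mk2E (negPf nz) andbF. Qed.

Lemma jordan_inj z x z' x' : jordan z x = jordan z' x' -> (z, x) = (z', x').
Proof.
move=> /(congr1 (@GLval 2 F)); rewrite !jordanE => /matrixP eqm.
have := eqm 0 0; have := eqm 0 1; rewrite !mk2E => -> /val_inj->.
by [].
Qed.

Lemma tr_jordan z x : \tr (GLval (jordan z x)) = 2%:R * val z.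
Proof. by rewrite jordanE tr2E !mk2E; ring. Qed.

Lemma det_jordan z x : \det (GLval (jordan z x)) = val z ^+ 2.
Proof. by rewrite jordanE det2E !mk2E; ring. Qed.

Lemma jordan_scal_uni z x : jordan z x = mulg (scalGL z) (uni (x / val z)).
Proof.
apply: GLval_inj; rewrite jordanE glM_mx uniE /= scalar2E.
have nz := unitF_neq0 z.
by apply: mx2_eq; rewrite mulmx2E !mk2E; field.
Qed.

End GL2.

(** * Induced representations *)

Section Induced.

Variables (K : numClosedFieldType) (gT : finGroupType) (G H : {group gT}).
Hypothesis sHG : H \subset G.

Definition coset_rep (i : 'I_#|rcosets H G|) : gT := repr (enum_val i).

Lemma coset_repP i : coset_rep i \in G /\ enum_val i = (H :* coset_rep i)%g.
Proof.
rewrite /coset_rep; have /rcosetsP[x Gx Dx] := enum_valP i.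
split; last by rewrite Dx rcoset_repr.
rewrite Dx; have /rcosetP[h Hh ->] := mem_repr_rcoset H x.
by rewrite groupM // (subsetP sHG).
Qed.

Lemma coset_repG i : coset_rep i \in G.
Proof. by case: (coset_repP i). Qed.

Lemma coset_rep_inj i j : (coset_rep i * (coset_rep j)^-1)%g \in H -> i = j.
Proof.
have [[_ Di] [_ Dj]] := (coset_repP i, coset_repP j).
rewrite -mem_rcoset => Hij; apply: enum_val_inj.
by rewrite Di Dj; apply/rcoset_eqP.
Qed.

Lemma coset_rep_ex g : g \in G ->
  exists j, exists2 h, h \in H & g = (h * coset_rep j)%g.
Proof.
move=> Gg; have cosg : (H :* g)%g \in rcosets H G by apply/rcosetsP; exists g.
pose j := enum_rank_in cosg (H :* g)%g; exists j.
have [_ Dj] := coset_repP j; rewrite enum_rankK_in // in Dj.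
exists (g * (coset_rep j)^-1)%g; last by rewrite mulgKV.
by rewrite -mem_rcoset -Dj rcoset_refl.
Qed.

Lemma unit_coset_ex : exists i0, coset_rep i0 \in H.
Proof.
have [i0 [h Hh D1]] := coset_rep_ex (group1 G); exists i0.
by rewrite -(groupMl _ Hh) -D1 group1.
Qed.

Variable lam : lin_char K H.
Notation Ind := (Ind_repr lam sHG).

Lemma lc_fun_neq0 h : h \in H -> lam h != 0.
Proof.
move=> Hh; apply/eqP=> l0; have := lc_fun1 lam.
rewrite -(mulgV h) lc_funM ?groupV // l0 mul0r => /esym/eqP.
by rewrite oner_eq0.
Qed.

Lemma lc_funV h : h \in H -> lam h^-1%g = (lam h)^-1.
Proof.
move=> Hh; apply: (mulfI (lc_fun_neq0 Hh)).
by rewrite -lc_funM ?groupV // mulgV lc_fun1 mulfV ?lc_fun_neq0.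
Qed.

Lemma IndE g i j : Ind g i j =
  let h := (coset_rep i * g * (coset_rep j)^-1)%g in
  if h \in H then lam h else 0.
Proof. by rewrite mxE. Qed.

Lemma Ind_entry g i j h : (coset_rep i * g = h * coset_rep j)%g -> h \in H ->
  Ind g i j = lam h.
Proof. by move=> e Hh; rewrite IndE /= e mulgK Hh. Qed.

Lemma Ind_row0 g i j k h : (coset_rep i * g = h * coset_rep j)%g -> h \in H ->
  k != j -> Ind g i k = 0.
Proof.
move=> e Hh nkj; rewrite IndE /= e -mulgA groupMl // ifN //.
by apply: contra nkj => /coset_rep_inj->.
Qed.

Lemma Ind_col0 g i j k h : (coset_rep i * g = h * coset_rep j)%g -> h \in H ->
  k != i -> Ind g k j = 0.
Proof.
move=> e Hh nki; rewrite IndE /= ifN //; apply: contra nki => Hk.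
apply/eqP/coset_rep_inj; rewrite -(groupMr _ (groupVr Hh)) in Hk.
suff -> : (coset_rep k * (coset_rep i)^-1 =
    coset_rep k * g * (coset_rep j)^-1 * h^-1)%g by [].
by rewrite -!mulgA -invMg -e invMg mulKVg.
Qed.

Lemma Ind_row g i j h : (coset_rep i * g = h * coset_rep j)%g -> h \in H ->
  row i (Ind g) = lam h *: delta_mx 0 j.
Proof.
move=> e Hh; apply/rowP=> k; rewrite [LHS]mxE [RHS]mxE [delta_mx _ _ _ _]mxE eqxx /=.
have [->|nkj] := eqVneq k j; first by rewrite mulr1 (Ind_entry e).
by rewrite mulr0 (Ind_row0 e).
Qed.

(** ** Maps out of an induced representation *)

Section MapsOut.

Variables (m : nat) (rW : mx_representation K G m).

(** Frobenius reciprocity, in the direction that builds the map: a vector on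
which H acts by lam extends to an intertwining map from Ind lam. *)
Definition Frobenius_mx (v : 'rV[K]_m) : 'M[K]_(#|rcosets H G|, m) :=
  \matrix_i (v *m rW (coset_rep i)).

Lemma Frobenius_intertwines (v : 'rV_m) :
  {in H, forall h, v *m rW h = lam h *: v} ->
  intertwines Ind rW (Frobenius_mx v).
Proof.
move=> lamv g Gg; apply/row_matrixP=> i; rewrite !row_mul.
have [j [h Hh e]] := coset_rep_ex (groupM (coset_repG i) Gg).
rewrite (Ind_row e Hh) -scalemxAl -rowE !rowK -mulmxA.
rewrite -repr_mxM ?coset_repG // e repr_mxM ?coset_repG ?(subsetP sHG h) //.
by rewrite mulmxA lamv // scalemxAl.
Qed.

Lemma Frobenius_neq0 (v : 'rV_m) : v != 0 -> Frobenius_mx v != 0.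
Proof.
move=> nzv; have [i0 _] := unit_coset_ex; apply: contra nzv => /eqP A0.
have /(congr1 (mulmx^~ (rW (coset_rep i0)^-1%g))) := congr1 (row i0) A0.
rewrite /Frobenius_mx rowK row0 mul0mx -mulmxA -repr_mxM ?groupV ?coset_repG //.
by rewrite mulgV repr_mx1 mulmx1 => ->.
Qed.

(** G permutes transitively the lines of the basis vectors, so a map out of the
induced representation is determined by its value on one of them. *)
Lemma Ind_intertwiner0 i0 (X : 'M_(#|rcosets H G|, m)) :
  intertwines Ind rW X -> row i0 X = 0 -> X = 0.
Proof.
move=> homX X0; apply/row_matrixP=> i; rewrite row0.
have Gg : ((coset_rep i0)^-1 * coset_rep i)%g \in G.
  by rewrite groupM ?groupV ?coset_repG.
have := congr1 (row i0) (homX _ Gg); rewrite !row_mul X0 mul0mx.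
rewrite (@Ind_row _ i0 i 1%g) ?group1 //; last by rewrite mulKVg mul1g.
by rewrite lc_fun1 scale1r -rowE.
Qed.

End MapsOut.

End Induced.

(** ** Mackey's analysis of the maps between two induced representations *)

(** Row i0 of X is a vector of Ind lam' on which H acts by lam. If b moves the
coset j to the coset k, it relates the entries of this row at j and k. *)
Lemma Mackey_entry (K : numClosedFieldType) (gT : finGroupType)
    (G H : {group gT}) (sHG : H \subset G) (lam lam' : lin_char K H)
    (X : 'M_#|rcosets H G|) i0 j k b h :
    intertwines (Ind_repr lam sHG) (Ind_repr lam' sHG) X -> coset_rep i0 \in H ->
    b \in H -> h \in H -> (coset_rep j * b = h * coset_rep k)%g ->
  lam b * X i0 k = X i0 j * lam' h.
Proof.
move=> homX Hi0 Hb Hh e.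
have := congr1 (fun M : 'M_#|rcosets H G| => M i0 k) (homX _ (subsetP sHG _ Hb)).
have Hc : (coset_rep i0 * b * (coset_rep i0)^-1)%g \in H.
  by rewrite !groupM ?groupV.
have ec : (coset_rep i0 * b =
    coset_rep i0 * b * (coset_rep i0)^-1 * coset_rep i0)%g by rewrite mulgKV.
rewrite [LHS]mxE [RHS]mxE.
rewrite (bigD1 i0) //= big1 ?addr0 => [|l nl]; last first.
  by rewrite (Ind_row0 sHG lam ec) ?mul0r.
rewrite [in RHS](bigD1 j) //= big1 ?addr0 => [|l nl]; last first.
  by rewrite (Ind_col0 sHG lam' e) ?mulr0.
rewrite -[Ind_mx _ lam _]/(Ind_repr lam sHG b) (Ind_entry sHG lam ec) //.
rewrite -[Ind_mx _ lam' _]/(Ind_repr lam' sHG b) (Ind_entry sHG lam' e) //.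
suff -> : lam (coset_rep i0 * b * (coset_rep i0)^-1)%g = lam b by [].
rewrite lc_funM ?groupM ?groupV // lc_funM // lc_funV // mulrAC.
by rewrite mulfV ?mul1r ?lc_fun_neq0.
Qed.

Section InducedDual.

Variables (K : numClosedFieldType) (gT : finGroupType) (G H : {group gT}).
Hypothesis sHG : H \subset G.

(** Each matrix of an induced representation has a single nonzero entry in each
row and column. *)
Lemma dual_Ind (lam lam' : lin_char K H) : {in H, forall h, lam' h = (lam h)^-1} ->
  forall g, dual_repr (Ind_repr lam sHG) g = Ind_repr lam' sHG g.
Proof.
move=> lamV g; apply/matrixP=> i j; rewrite mxE !IndE /=.
have -> : (coset_rep j * g^-1 * (coset_rep i)^-1 =
    (coset_rep i * g * (coset_rep j)^-1)^-1)%g by rewrite !invMg invgK mulgA.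
set h := (_ * _)%g; rewrite groupV; case: ifP => // Hh.
by rewrite lc_funV // lamV.
Qed.

Lemma Ind_ext (lam lam' : lin_char K H) : {in H, lam =1 lam'} ->
  forall g, Ind_repr lam sHG g = Ind_repr lam' sHG g.
Proof.
move=> eql g; apply/matrixP=> i j; rewrite !IndE /=.
by case: ifP => // Hh; rewrite eql.
Qed.

Lemma eq_repr_rsim n (rV rW : mx_representation K G n) :
  {in G, forall g, rV g = rW g} -> mx_rsim rV rW.
Proof.
move=> eqVW; apply: (@MxReprSim _ _ _ _ _ _ _ 1%:M) => // [|g Gg].
  by rewrite row_free_unit unitmx1.
by rewrite mulmx1 mul1mx eqVW.
Qed.

End InducedDual.

(** * The principal series of GL(2, F) *)

Section PrincipalSeries.

Variables (K : numClosedFieldType) (F : finFieldType).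
Notation GL2 := 'GL_2[F]%G.
Notation Fchar := (lin_char K [set: {unit F}]).
Notation Bgroup := (Borel_group F).
Notation rep := (@coset_rep _ GL2 Bgroup).
Notation index := 'I_#|rcosets Bgroup GL2|.
Implicit Types alpha beta : Fchar.

Lemma Borel_fun_mk alpha beta (x y : {unit F}) (g : gl2 F) :
  GLval g 0 0 = val x -> GLval g 1 1 = val y ->
  Borel_fun alpha beta g = alpha x * beta y.
Proof. by move=> g00 g11; rewrite /Borel_fun g00 g11 !to_unitK. Qed.

Lemma Borel_fun_det alpha (g : gl2 F) : g \in Borel F ->
  Borel_fun alpha alpha g = alpha (detGL g).
Proof.
move=> Bg; have [nz0 nz1] := Borel_diag Bg.
rewrite /Borel_fun -lc_funM ?inE //; congr (alpha _); apply: val_inj.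
rewrite /= !val_to_unit // det2E; move: Bg; rewrite inE => /eqP->.
by rewrite mulr0 subr0.
Qed.

Lemma rep_notin_Borel i0 j : rep i0 \in Borel F -> j != i0 ->
  GLval (rep j) 1 0 != 0.
Proof.
move=> Bi0; apply: contra => Bj; apply/eqP/(coset_rep_inj (Borel_sub F)).
by rewrite groupM ?groupV // inE.
Qed.

Section MackeyGL2.

Variables alpha beta alpha' beta' : Fchar.
Variables (X : 'M[K]_#|rcosets Bgroup GL2|) (i0 : index).
Hypotheses (homX : intertwines (Ind_Borel alpha beta) (Ind_Borel alpha' beta') X).
Hypothesis Bi0 : rep i0 \in Borel F.

Lemma Mackey_diag : X i0 i0 != 0 -> alpha =1 alpha' /\ beta =1 beta'.
Proof.
move=> nzX; suff eqB b : b \in Borel F ->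
    Borel_fun alpha beta b = Borel_fun alpha' beta' b.
  split=> x.
    have := eqB _ (dia_Borel x 1%g); rewrite !(@Borel_fun_mk _ _ x 1%g) ?diaE ?mk2E //.
    by rewrite !lc_fun1 !mulr1.
  have := eqB _ (dia_Borel 1%g x); rewrite !(@Borel_fun_mk _ _ 1%g x) ?diaE ?mk2E //.
  by rewrite !lc_fun1 !mul1r.
move=> Bb; pose h := (rep i0 * b * (rep i0)^-1)%g.
have Bh : h \in Borel F by rewrite !groupM ?groupV.
have := Mackey_entry homX Bi0 Bb Bh (esym (mulgKV _ _)).
rewrite /= mulrC => /(mulfI nzX) ->.
rewrite /h !Borel_funM ?groupM ?groupV // mulrAC.
rewrite -Borel_funM ?groupV // mulgV Borel_fun1 mul1r //.
Qed.

(** The torus element diag(x, y) can be moved inside B so as to fix a given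
line other than the one fixed by B, on which it then acts by x. *)
Lemma Mackey_offdiag j : j != i0 -> X i0 j != 0 ->
  alpha =1 beta' /\ beta =1 alpha'.
Proof.
move=> nji nzX; have := rep_notin_Borel Bi0 nji.
set r := rep j; set c := GLval r 1 0 => nzc.
suff eqB x y : alpha x * beta y = alpha' y * beta' x.
  split=> x; first by have := eqB x 1%g; rewrite !lc_fun1 mulr1 mul1r.
  by have := eqB 1%g x; rewrite !lc_fun1 mulr1 mul1r.
pose s := GLval r 1 1 / c.
pose b := gl (mk2 (val x) (s * (val x - val y)) 0 (val y)).
pose h := gl (mk2 (val y) (GLval r 0 0 * (val x - val y) / c) 0 (val x)).
have [nzx nzy] := (unitF_neq0 x, unitF_neq0 y).
have Db : GLval b = mk2 (val x) (s * (val x - val y)) 0 (val y).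
  by rewrite glK // det2E !mk2E mulr0 subr0 mulf_neq0.
have Dh : GLval h = mk2 (val y) (GLval r 0 0 * (val x - val y) / c) 0 (val x).
  by rewrite glK // det2E !mk2E mulr0 subr0 mulf_neq0.
have Bb : b \in Borel F by rewrite inE Db mk2E.
have Bh : h \in Borel F by rewrite inE Dh mk2E.
have e : (rep j * b = h * rep j)%g.
  apply: GLval_inj; rewrite !glM_mx -/r Db Dh.
  by apply: mx2_eq; rewrite !mulmx2E !mk2E /s -/c; field.
have := Mackey_entry homX Bi0 Bb Bh e; rewrite /= mulrC => /(mulfI nzX).
by rewrite (@Borel_fun_mk _ _ x y) ?(@Borel_fun_mk _ _ y x) ?Db ?Dh ?mk2E.
Qed.

Lemma Mackey_nonzero : X != 0 ->
  (alpha =1 alpha' /\ beta =1 beta') \/ (alpha =1 beta' /\ beta =1 alpha').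
Proof.
move=> nzX; have [j nzj] : exists j, X i0 j != 0.
  apply/existsP; apply: contraR nzX; rewrite negb_exists => /forallP X0.
  apply/eqP/(Ind_intertwiner0 homX (i0 := i0)); apply/rowP=> j; rewrite !mxE.
  by apply/eqP; rewrite -[_ == _]negbK X0.
have [eji|nji] := eqVneq j i0; first by left; apply: Mackey_diag; rewrite -{2}eji.
by right; apply: Mackey_offdiag nji nzj.
Qed.

End MackeyGL2.

(** U permutes transitively the cosets other than B, which leaves to row i0 one
free entry besides the one at i0. *)
Lemma Mackey_equal alpha (X : 'M[K]_#|rcosets Bgroup GL2|) i0 j k :
    intertwines (Ind_Borel alpha alpha) (Ind_Borel alpha alpha) X ->
    rep i0 \in Borel F -> j != i0 -> k != i0 ->
  X i0 k * alpha (detGL (rep k)) = X i0 j * alpha (detGL (rep j)).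
Proof.
move=> homX Bi0 nj nk.
have [nzj nzk] := (rep_notin_Borel Bi0 nj, rep_notin_Borel Bi0 nk).
pose t := GLval (rep k) 1 1 / GLval (rep k) 1 0
            - GLval (rep j) 1 1 / GLval (rep j) 1 0.
pose h := (rep j * uni t * (rep k)^-1)%g.
have Bh : h \in Borel F.
  rewrite inE; apply/eqP; rewrite /h 2!glM_mx inv2E uniE -scalemxAr mxE.
  rewrite !mulmx2E !mk2E /t.
  by have := GL_det (rep k) => nzd; field; rewrite nzj nzk.
have e : (rep j * uni t = h * rep k)%g by rewrite /h mulgKV.
have := Mackey_entry homX Bi0 (uni_Borel t) Bh e.
rewrite /= (@Borel_fun_mk _ _ 1%g 1%g) ?uniE ?mk2E // !lc_fun1 !mul1r => ->.
rewrite Borel_fun_det // -mulrA -lc_funM ?inE // -detGLM -e detGLM.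
suff -> : detGL (uni t) = 1%g by rewrite mulg1.
by apply: val_inj; rewrite /= det2E uniE !mk2E mulr0 subr0 mulr1.
Qed.

(** ** Exchanging the two characters *)

Lemma coset_product_eq (gT : finGroupType) (i j k l g h h' : gT) :
  (i * g = h * j -> l * g = h'^-1 * k ->
   h * (j * k^-1) = i * l^-1 * h'^-1)%g.
Proof.
move=> e e'; have -> : (h'^-1 = l * g * k^-1)%g by rewrite e' mulgK.
by rewrite mulgA -e !mulgA mulgKV.
Qed.

Section Swap.

Variables alpha beta : Fchar.

(** The function supported by the big double coset of B that transforms under B
by (alpha, beta) on the left and by (beta, alpha) on the right: it is the kernel
of an intertwining map. *)
Definition swap_kernel (g : gl2 F) : K :=
  if GLval g 1 0 == 0 then 0 else
    beta (to_unit (GLval g 1 0)) / alpha (to_unit (GLval g 1 0)) *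
    alpha (detGL g).

Definition swap_mx : 'M[K]_#|rcosets Bgroup GL2| :=
  \matrix_(i, j) swap_kernel (rep i * (rep j)^-1)%g.

Lemma detGL_Borel (b : gl2 F) : b \in Borel F ->
  detGL b = (to_unit (GLval b 0 0) * to_unit (GLval b 1 1)%R)%g.
Proof.
move=> Bb; have [nz0 nz1] := Borel_diag Bb; apply: val_inj.
rewrite /= !val_to_unit // det2E; move: Bb; rewrite inE => /eqP->.
by rewrite mulr0 subr0.
Qed.

Lemma Fchar_neq0 (al : Fchar) x : al x != 0.
Proof. exact: (@lc_fun_neq0 K _ [set: {unit F}]%G al x (in_setT x)). Qed.

Lemma FcharV (al : Fchar) x : al x^-1%g = (al x)^-1.
Proof. exact: (@lc_funV K _ [set: {unit F}]%G al x (in_setT x)). Qed.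

Lemma FcharM (al : Fchar) x y : al (x * y)%g = al x * al y.
Proof. by rewrite lc_funM ?inE. Qed.

Lemma swap_kernelMl (b g : gl2 F) : b \in Borel F ->
  swap_kernel (b * g)%g = Borel_fun alpha beta b * swap_kernel g.
Proof.
move=> Bb; have [nz0 nz1] := Borel_diag Bb; rewrite /swap_kernel GL2_mul.
have -> : GLval b 1 0 = 0 by move: Bb; rewrite inE => /eqP.
rewrite mul0r add0r mulf_eq0 (negPf nz1) /=; case: eqP => [_|/eqP nzg].
  by rewrite mulr0.
rewrite to_unitM // detGLM (detGL_Borel Bb) !FcharM /Borel_fun.
by field; rewrite !Fchar_neq0.
Qed.

Lemma swap_kernelMr (b g : gl2 F) : b \in Borel F ->
  swap_kernel (g * b)%g = swap_kernel g * Borel_fun beta alpha b.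
Proof.
move=> Bb; have [nz0 nz1] := Borel_diag Bb; rewrite /swap_kernel GL2_mul.
have -> : GLval b 1 0 = 0 by move: Bb; rewrite inE => /eqP.
rewrite mulr0 addr0 mulf_eq0 (negPf nz0) orbF; case: eqP => [_|/eqP nzg].
  by rewrite mul0r.
rewrite to_unitM // detGLM (detGL_Borel Bb) !FcharM /Borel_fun.
by field; rewrite !Fchar_neq0.
Qed.

Lemma swap_intertwines :
  intertwines (Ind_Borel alpha beta) (Ind_Borel beta alpha) swap_mx.
Proof.
move=> g Gg; apply/matrixP=> i k; rewrite [LHS]mxE [RHS]mxE.
have sB := Borel_sub F.
have [j [h Bh e]] := coset_rep_ex sB (groupM (coset_repG sB i) Gg).
have [l [h' Bh' e']] := coset_rep_ex sB
  (groupM (coset_repG sB k) (groupVr Gg)).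
have {}e' : (rep l * g = h'^-1 * rep k)%g.
  by apply: (mulgI h'); rewrite mulKVg mulgA -e' mulgKV.
rewrite (bigD1 j) //= big1 ?addr0 => [|x nx]; last first.
  by rewrite (Ind_row0 sB _ e) ?mul0r.
rewrite [in RHS](bigD1 l) //= big1 ?addr0 => [|x nx]; last first.
  by rewrite (Ind_col0 sB _ e') ?groupV ?mulr0.
rewrite (Ind_entry sB _ e) // (Ind_entry sB _ e') ?groupV // !mxE /=.
rewrite -(swap_kernelMl _ Bh) -(swap_kernelMr _ (groupVr Bh')).
by congr swap_kernel; apply: coset_product_eq e e'.
Qed.

Lemma swap_neq0 : swap_mx != 0.
Proof.
have [i0 Bi0] := unit_coset_ex (Borel_sub F).
pose w := gl (mk2 0 1 1 0 : 'M[F]_2).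
have Dw : GLval w = mk2 0 1 1 0.
  by rewrite glK // det2E !mk2E mul0r sub0r mulr1 oppr_eq0 oner_eq0.
have [j [h Bh e]] := coset_rep_ex (Borel_sub F) (in_setT w).
apply/eqP=> /matrixP/(_ j i0); rewrite !mxE /swap_kernel.
suff nz : GLval (rep j * (rep i0)^-1)%g 1 0 != 0.
  rewrite (negPf nz) => /eqP; rewrite !mulf_eq0 invr_eq0.
  by rewrite !(negPf (Fchar_neq0 _ _)).
have : (rep j * (rep i0)^-1)%g \notin Borel F.
  rewrite groupMr ?groupV // -(groupMl _ Bh) -e inE Dw mk2E oner_eq0 //.
by rewrite inE.
Qed.

End Swap.
End PrincipalSeries.

Section Splitting.

Variables (K : numClosedFieldType) (gT : finGroupType) (G : {group gT}).
Variables (n m : nat) (rU : mx_representation K G n).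
Variable rV : mx_representation K G m.

(** Maschke's theorem, as the existence of an equivariant section. *)
Lemma intertwiner_section (A : 'M_(n, m)) :
    intertwines rU rV A -> row_full A ->
  exists2 A', intertwines rV rU A' & A' *m A = 1%:M.
Proof.
move=> homA fullA; exists (#|G|%:R^-1 *: averaged rV rU (pinvmx A)).
  by move=> g Gg; rewrite -scalemxAr averaged_intertwines // scalemxAl.
rewrite -scalemxAl mulmx_suml (eq_bigr (fun _ => 1%:M)).
  rewrite sumr_const -scaler_nat scalerA mulVf ?scale1r //.
  by rewrite pnatr_eq0 -lt0n cardG_gt0.
move=> g Gg; rewrite -(mulmxA _ (rU g)) homA // mulmxA -(mulmxA _ (pinvmx A)).
by rewrite mulVpmx // mulmx1 -repr_mxM ?groupV // mulVg repr_mx1.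
Qed.

Lemma dual_intertwines (A : 'M_(n, m)) : intertwines rU rV A ->
  intertwines (dual_repr rV) (dual_repr rU) A^T.
Proof. by move=> homA g Gg; rewrite /= -!trmx_mul homA ?groupV. Qed.

Lemma intertwines_comp p (rW : mx_representation K G p) (A : 'M_(n, m))
    (B : 'M_(m, p)) :
  intertwines rU rV A -> intertwines rV rW B -> intertwines rU rW (A *m B).
Proof. by move=> homA homB g Gg; rewrite mulmxA homA // -!mulmxA homB. Qed.

End Splitting.

Section PrincipalSeriesQuotients.

Variables (K : numClosedFieldType) (F : finFieldType).
Notation GL2 := 'GL_2[F]%G.
Notation Fchar := (lin_char K [set: {unit F}]).
Notation Bgroup := (Borel_group F).
Notation rep := (@coset_rep _ GL2 Bgroup).
Notation nB := #|rcosets Bgroup GL2|.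
Notation index := 'I_#|rcosets Bgroup GL2|.
Implicit Types alpha beta : Fchar.

Variables (n : nat) (rV : mx_representation K GL2 n).
Hypothesis irrV : mx_irreducible rV.

Lemma scalar_intertwines m (rU : mx_representation K GL2 m) c :
  intertwines rU rU c%:M.
Proof. by move=> g _; rewrite scalar_mxC. Qed.

Lemma intertwinesB m p (rU : mx_representation K GL2 m)
    (rW : mx_representation K GL2 p) X Y :
  intertwines rU rW X -> intertwines rU rW Y -> intertwines rU rW (X - Y).
Proof. by move=> hX hY g Gg; rewrite mulmxBl mulmxBr hX ?hY. Qed.

(** By Mackey's analysis every endomorphism of Ind is a scalar, in particular the
product of A and of a section of A. *)
Lemma quotient_Ind_neq alpha beta (A : 'M_(nB, n)) :
    intertwines (Ind_Borel alpha beta) rV A -> A != 0 -> ~ alpha =1 beta ->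
  mx_rsim rV (Ind_Borel alpha beta).
Proof.
move=> homA nzA neqab; have fullA := intertwiner_full irrV homA nzA.
have [A' homA' A'A] := intertwiner_section homA fullA.
apply: mx_rsim_sym; apply: (intertwiner_rsim _ fullA homA).
have [i0 Bi0] := unit_coset_ex (Borel_sub F).
have [Y eY homY] : exists2 Y, A *m A' = Y &
    intertwines (Ind_Borel alpha beta) (Ind_Borel alpha beta) Y.
  by exists (A *m A') => //; apply: intertwines_comp homA homA'.
pose c := Y i0 i0.
have DY : Y = c%:M.
  apply/eqP; rewrite -subr_eq0; apply/eqP.
  have homD := intertwinesB homY (scalar_intertwines _ c).
  apply: (Ind_intertwiner0 homD (i0 := i0)); apply/rowP=> j; rewrite !mxE.
  have [->|nji] := eqVneq j i0; first by rewrite mulr1n subrr.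
  rewrite mulr0n subr0; apply/eqP/idPn=> nz.
  by have [] := Mackey_offdiag homY Bi0 nji nz.
have nzc : c != 0.
  apply: contraNneq nzA => c0; rewrite -[A]mulmx1 -A'A mulmxA eY DY c0.
  by rewrite mul_scalar_mx scale0r.
apply/row_freeP; exists (c^-1 *: A'); rewrite -scalemxAr eY DY.
by rewrite -mul_scalar_mx -scalar_mxM mulVf.
Qed.

Section EqualCharacters.

Variable alpha : Fchar.

(** The map from Ind (alpha, alpha) onto its quotient alpha \o det, and below it
the embedding of alpha \o det as a submodule. *)
Definition det_col : 'cV[K]_nB := \col_i alpha (detGL (rep i)).
Definition det_row : 'rV[K]_nB := \row_i (alpha (detGL (rep i)))^-1.

Lemma det_col_intertwines :
  intertwines (Ind_Borel alpha alpha) (char_det_repr alpha) det_col.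
Proof.
move=> g Gg; apply/colP=> i; rewrite /= mul_mx_scalar.
have sB := Borel_sub F.
have [j [h Bh e]] := coset_rep_ex sB (groupM (coset_repG sB i) Gg).
rewrite mxE (bigD1 j) //= big1 ?addr0 => [|k nk]; last first.
  by rewrite (Ind_row0 sB _ e) ?mul0r.
rewrite (Ind_entry sB _ e) // !mxE /= Borel_fun_det //.
by rewrite -FcharM -detGLM -e detGLM FcharM mulrC.
Qed.

Lemma det_row_intertwines :
  intertwines (char_det_repr alpha) (Ind_Borel alpha alpha) det_row.
Proof.
move=> g Gg; apply/rowP=> k; rewrite /= mul_scalar_mx.
have sB := Borel_sub F.
have [j [h Bh e]] := coset_rep_ex sB (groupM (coset_repG sB k) (groupVr Gg)).
have {}e : (rep j * g = h^-1 * rep k)%g.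
  by apply: (mulgI h); rewrite mulKVg mulgA -e mulgKV.
rewrite [RHS]mxE (bigD1 j) //= big1 ?addr0 => [|x nx]; last first.
  by rewrite (Ind_col0 sB _ e) ?groupV ?mulr0.
rewrite (Ind_entry sB _ e) ?groupV // !mxE /= Borel_fun_det ?groupV //.
have -> : h^-1%g = (rep j * g * (rep k)^-1)%g by rewrite e mulgK.
have detV x : detGL x^-1%g = (detGL x)^-1%g :> {unit F}.
  by apply: (mulgI (detGL x)); rewrite -detGLM !mulgV; apply: val_inj; rewrite /= det1.
by rewrite !detGLM detV !FcharM FcharV; field; rewrite !Fchar_neq0.
Qed.

Lemma det_row_col : det_row *m det_col = (nB%:R)%:M.
Proof.
apply/matrixP=> i j; rewrite !ord1 !mxE eqxx mulr1n.
transitivity (\sum_(k < nB) (1 : K)).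
  by apply: eq_bigr => k _; rewrite !mxE mulVf ?Fchar_neq0.
by rewrite sumr_const card_ord.
Qed.

Lemma char_det_irr : mx_irreducible (char_det_repr alpha).
Proof. by apply: mx_abs_irrW; rewrite linear_mx_abs_irr. Qed.

(** If V is not alpha \o det, then A kills the line of det_row. The product of A
and of a section of A is then 1 + d J, with J the endomorphism that factors
through alpha \o det, so that A and det_col have no common kernel. *)
Lemma quotient_Ind_eq (A : 'M_(nB, n)) :
    intertwines (Ind_Borel alpha alpha) rV A -> A != 0 ->
  mx_rsim rV (char_det_repr alpha) \/ is_chi_q alpha rV.
Proof.
move=> homA nzA; have fullA := intertwiner_full irrV homA nzA.
have [cA0|nzc] := eqVneq (det_row *m A) 0; last first.
  left; apply: mx_rsim_sym; apply: Schur_rsim char_det_irr irrV _ nzc.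
  exact: intertwines_comp det_row_intertwines homA.
right; have [A' homA' A'A] := intertwiner_section homA fullA.
have [i0 Bi0] := unit_coset_ex (Borel_sub F).
have [Y eY homY] : exists2 Y, A *m A' = Y &
    intertwines (Ind_Borel alpha alpha) (Ind_Borel alpha alpha) Y.
  by exists (A *m A') => //; apply: intertwines_comp homA homA'.
(* J factors through alpha \o det; the endomorphisms of Ind are the c + d J. *)
have [J eJ homJ] : exists2 J, det_col *m det_row = J &
    intertwines (Ind_Borel alpha alpha) (Ind_Borel alpha alpha) J.
  exists (det_col *m det_row) => //.
  exact: intertwines_comp det_col_intertwines det_row_intertwines.
have JE i j : J i j = alpha (detGL (rep i)) / alpha (detGL (rep j)).
  by rewrite -eJ mxE big_ord1 !mxE.
have [c [d DY]] : exists c d, Y = c%:M + d *: J.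
  have [d Dd] : exists d, forall j, j != i0 -> Y i0 j = d * J i0 j.
    have [k nk|all0] := pickP [pred k | k != i0]; last first.
      by exists 0 => j nj; have := all0 j; rewrite /= nj.
    exists (Y i0 k / J i0 k) => j nj.
    have := Mackey_equal homY Bi0 nj nk; rewrite !JE => e.
    apply: (mulIf (Fchar_neq0 alpha (detGL (rep j)))); rewrite -e.
    by field; rewrite !Fchar_neq0.
  exists (Y i0 i0 - d * J i0 i0), d.
  apply/eqP; rewrite -subr_eq0 opprD addrA; apply/eqP.
  have homdJ : intertwines (Ind_Borel alpha alpha) (Ind_Borel alpha alpha) (d *: J).
    by move=> g Gg; rewrite -scalemxAr homJ // scalemxAl.
  have homD := intertwinesB (intertwinesB homY
    (scalar_intertwines _ (Y i0 i0 - d * J i0 i0))) homdJ.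
  apply: (Ind_intertwiner0 homD (i0 := i0)); apply/rowP=> j.
  rewrite !mxE; have [->|nji] := eqVneq j i0.
    by rewrite mulr1n; ring.
  by rewrite (Dd j nji) mulr0n; ring.
have JA : J *m A = 0 by rewrite -eJ -mulmxA cA0 mulmx0.
have c1 : c = 1.
  have : Y *m A = A by rewrite -eY -mulmxA A'A mulmx1.
  rewrite DY mulmxDl -scalemxAl JA scaler0 addr0 mul_scalar_mx => /eqP.
  rewrite -subr_eq0 -{2}[A]scale1r -scalerBl scaler_eq0 (negPf nzA) orbF.
  by rewrite subr_eq0 => /eqP.
apply: (@intertwiner_rsim _ _ _ _ _ _ _ (row_mx det_col A)).
- apply/inj_row_free=> v; rewrite mul_mx_row => /eqP; rewrite row_mx_eq0.
  case/andP=> /eqP vC /eqP vA; have : v *m Y = 0 by rewrite -eY mulmxA vA mul0mx.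
  by rewrite DY c1 mulmxDr mulmx1 -scalemxAr -eJ mulmxA vC mul0mx scaler0 addr0.
- have nzB : nB%:R != 0 :> K.
    by rewrite pnatr_eq0 -lt0n; apply: leq_ltn_trans (ltn_ord i0).
  have full : row_full (col_mx det_row A' *m row_mx det_col A).
    rewrite mul_col_row det_row_col cA0 A'A row_full_unit unitmxE.
    by rewrite det_lblock det_scalar det1 mulr1 expr1 unitfE.
  rewrite /row_full eqn_leq rank_leq_col /=.
  by apply: leq_trans (mxrankS (submxMl (col_mx det_row A') _)); rewrite (eqP full).
move=> g Gg; rewrite mul_mx_row det_col_intertwines // homA //= mul_row_block.
by rewrite !mulmx0 addr0 add0r.
Qed.
End EqualCharacters.
End PrincipalSeriesQuotients.

(** ** The self-dual representations of the principal series *)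

Section QuadraticCharacters.

Variables (K : numClosedFieldType) (F : finFieldType).
Notation Fchar := (lin_char K [set: {unit F}]).

Lemma FcharX (alpha : Fchar) x k : alpha (x ^+ k)%g = alpha x ^+ k.
Proof.
elim: k => [|k IHk]; first by rewrite expg0 lc_fun1.
by rewrite expgS FcharM IHk exprS.
Qed.

Lemma units_cyclic : exists u : {unit F}, forall x, exists k, x = (u ^+ k)%g.
Proof.
have /cyclicP[u Du] := field_unit_group_cyclic [set: {unit F}]%G.
by exists u => x; apply/cycleP; rewrite -Du inE.
Qed.

(** F^x is cyclic, and such a character sends a generator to 1 or -1. *)
Lemma quadratic_char (sgn alpha : Fchar) :
    (exists x, sgn x != 1) -> (forall x, sgn x ^+ 2 = 1) ->
    (forall x, alpha x ^+ 2 = 1) ->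
  alpha =1 triv_char K [set: {unit F}] \/ alpha =1 sgn.
Proof.
move=> [y sgny] sgn2 alpha2; have [u gen_u] := units_cyclic.
have sgnu : sgn u = -1.
  have /eqP := sgn2 u; rewrite sqrf_eq1 => /orP[/eqP sgnu|/eqP//].
  by case/eqP: sgny; have [k ->] := gen_u y; rewrite FcharX sgnu expr1n.
have /eqP := alpha2 u; rewrite sqrf_eq1 => /orP[]/eqP alphau; [left | right].
  by move=> x; have [k ->] := gen_u x; rewrite FcharX alphau expr1n.
by move=> x; have [k ->] := gen_u x; rewrite !FcharX alphau sgnu.
Qed.

Lemma sqr1_inv (alpha : Fchar) x : alpha x ^+ 2 = 1 -> (alpha x)^-1 = alpha x.
Proof.
by move=> a2; apply: (mulIf (Fchar_neq0 alpha x)); rewrite mulVf ?Fchar_neq0.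
Qed.

End QuadraticCharacters.

Section SelfDualPrincipal.

Variables (K : numClosedFieldType) (F : finFieldType).
Notation GL2 := 'GL_2[F]%G.
Notation Fchar := (lin_char K [set: {unit F}]).
Implicit Types alpha beta : Fchar.

Lemma Ind_Borel_ext alpha beta alpha' beta' :
    alpha =1 alpha' -> beta =1 beta' ->
  mx_rsim (Ind_Borel alpha beta) (Ind_Borel alpha' beta').
Proof.
move=> eqa eqb; apply: eq_repr_rsim => g _; apply: Ind_ext => h _ /=.
by rewrite /Borel_fun eqa eqb.
Qed.

Lemma dual_Ind_Borel alpha beta alpha' beta' :
    (forall x, alpha' x = (alpha x)^-1) -> (forall x, beta' x = (beta x)^-1) ->
  forall g, dual_repr (Ind_Borel alpha beta) g = Ind_Borel alpha' beta' g.
Proof.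
move=> eqa eqb; apply: dual_Ind => h _ /=.
by rewrite /Borel_fun eqa eqb invfM.
Qed.

Lemma is_chi_q_ext alpha beta n (rV : mx_representation K GL2 n) :
  alpha =1 beta -> is_chi_q alpha rV -> is_chi_q beta rV.
Proof.
move=> eqab chiV; apply: mx_rsim_trans (Ind_Borel_ext _ _) _.
- by move=> x; symmetry; apply: eqab.
- by move=> x; symmetry; apply: eqab.
apply: mx_rsim_trans chiV _; apply: eq_repr_rsim => g _ /=; by rewrite eqab.
Qed.

Lemma char_det_ext alpha beta :
  alpha =1 beta -> mx_rsim (char_det_repr alpha) (char_det_repr beta).
Proof. by move=> eqab; apply: eq_repr_rsim => g _ /=; rewrite eqab. Qed.

Section Forward.

Variables (n : nat) (rV : mx_representation K GL2 n).
Hypothesis irrV : mx_irreducible rV.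

(** If V is a self-dual quotient of an induced representation I, then the
composite of I -> V, V = V^* and V^* -> I^* is a nonzero map between two induced
representations, so Mackey's analysis relates the inducing characters. *)
Lemma self_dual_quotient alpha beta (A : 'M_(#|rcosets (Borel_group F) GL2|, n)) :
    self_dual rV -> intertwines (Ind_Borel alpha beta) rV A -> A != 0 ->
  (forall x, alpha x ^+ 2 = 1) /\ (forall x, beta x ^+ 2 = 1) \/
  (forall x, alpha x * beta x = 1).
Proof.
move=> [B _ freeB homB] homA nzA; have fullA := intertwiner_full irrV homA nzA.
have homAt : intertwines (dual_repr rV)
    (Ind_Borel (inv_char alpha) (inv_char beta)) A^T.
  move=> g Gg; rewrite (dual_intertwines homA) //.
  by rewrite -(@dual_Ind_Borel alpha beta) //.
have homZ := intertwines_comp (intertwines_comp homA homB) homAt.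
have freeAt : row_free A^T by rewrite /row_free mxrank_tr; apply: fullA.
have nzZ : A *m B *m A^T != 0.
  apply: contraNneq nzA => Z0; apply/eqP; apply: (row_free_inj freeB).
  by apply: (row_free_inj freeAt); rewrite /= Z0 !mul0mx.
have [i0 Bi0] := unit_coset_ex (Borel_sub F).
have [[eqa eqb]|[eqa eqb]] := Mackey_nonzero homZ Bi0 nzZ; [left | right].
  by split=> x; rewrite expr2 1?{2}eqa 1?{2}eqb /= mulfV ?Fchar_neq0.
by move=> x; rewrite eqa /= mulVf ?Fchar_neq0.
Qed.

(** swap_mx composed with an isomorphism makes V a quotient of
Ind (beta, alpha) too. *)
Lemma swap_rsim alpha beta :
  mx_rsim rV (Ind_Borel alpha beta) -> ~ alpha =1 beta ->
  mx_rsim rV (Ind_Borel beta alpha).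
Proof.
move=> /mx_rsim_sym[B _ freeB homB] neqab.
have homA := intertwines_comp (@swap_intertwines _ _ beta alpha) homB.
apply: (quotient_Ind_neq irrV homA); last first.
  by move=> eqba; apply: neqab => x; rewrite eqba.
apply: contraNneq (swap_neq0 beta alpha) => A0; apply/eqP.
by apply: (row_free_inj freeB); rewrite /= A0 mul0mx.
Qed.

(** The vector v makes V a quotient of Ind (alpha, beta). *)
Lemma self_dual_principal (sgn alpha beta : Fchar) (v : 'rV[K]_n) :
    (exists x, sgn x != 1) -> (forall x, sgn x ^+ 2 = 1) ->
    v != 0 -> {in Borel F, forall b, v *m rV b = Borel_fun alpha beta b *: v} ->
    self_dual rV ->
  [\/ mx_rsim rV (char_det_repr (triv_char _ _)) \/
        mx_rsim rV (char_det_repr sgn),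
      is_chi_q (triv_char _ _) rV \/ is_chi_q sgn rV |
      (exists2 alpha : Fchar, exists x, alpha x ^+ 2 != 1 &
         mx_rsim rV (Ind_Borel alpha (inv_char alpha))) \/
        mx_rsim rV (Ind_Borel (triv_char _ _) sgn)].
Proof.
move=> sgn1 sgn2 nzv homv sdV.
have homA := Frobenius_intertwines (Borel_sub F) (lam := Borel_char alpha beta) homv.
have nzA := Frobenius_neq0 (Borel_sub F) rV nzv.
have sqr_ab := self_dual_quotient sdV homA nzA.
have quad := quadratic_char sgn1 sgn2.
have [/forallP eqab|neqab] := boolP [forall x, alpha x == beta x].
  have alpha2 x : alpha x ^+ 2 = 1.
    by case: sqr_ab => [[]|/(_ x)] //; rewrite -(eqP (eqab x)) expr2.
  have homA' : intertwines (Ind_Borel alpha alpha) rV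
      (Frobenius_mx (Borel_group F) rV v).
    move=> g Gg; rewrite -homA //.
    suff -> : Ind_Borel alpha alpha g = Ind_Borel alpha beta g by [].
    by apply: Ind_ext => h _ /=; rewrite /Borel_fun !(eqP (eqab _)).
  have [simV|chiV] := quotient_Ind_eq irrV homA' nzA.
    apply: Or31; case: (quad _ alpha2) => eqa; [left|right];
      exact: mx_rsim_trans simV (char_det_ext eqa).
  apply: Or32; case: (quad _ alpha2) => eqa; [left|right];
    exact: is_chi_q_ext eqa chiV.
have simV : mx_rsim rV (Ind_Borel alpha beta).
  apply: quotient_Ind_neq homA nzA _ => // eqab; case/forallP: neqab => x.
  by rewrite eqab.
apply: Or33; case: sqr_ab => [[alpha2 beta2]|ab1]; last first.
  have Db x : beta x = (alpha x)^-1.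
    by apply: (mulfI (Fchar_neq0 alpha x)); rewrite ab1 mulfV ?Fchar_neq0.
  left; exists alpha; last first.
    by apply: mx_rsim_trans simV _; apply: Ind_Borel_ext.
  apply/existsP; apply: contraR neqab; rewrite negb_exists => /forallP alpha2.
  apply/forallP=> x; rewrite Db sqr1_inv //; apply/eqP.
  by rewrite -[_ == _]negbK alpha2.
right; have [[eqa|eqa] [eqb|eqb]] := (quad _ alpha2, quad _ beta2).
- by case/forallP: neqab => x; rewrite eqa eqb.
- exact: mx_rsim_trans simV (Ind_Borel_ext eqa eqb).
- apply: mx_rsim_trans (Ind_Borel_ext eqb eqa); apply: swap_rsim simV _ => eqab.
  by case/forallP: neqab => x; rewrite eqab.
- by case/forallP: neqab => x; rewrite eqa eqb.
Qed.

End Forward.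

Lemma self_dual_rsim n m (rV : mx_representation K GL2 n)
    (rW : mx_representation K GL2 m) :
  mx_rsim rV rW -> self_dual rW -> self_dual rV.
Proof.
move=> simVW sdW; exact: mx_rsim_trans simVW (mx_rsim_trans sdW (mx_rsim_sym (dual_rsim simVW))).
Qed.

Lemma char_det_self_dual alpha : (forall x, alpha x ^+ 2 = 1) ->
  self_dual (char_det_repr alpha).
Proof.
move=> alpha2; apply: eq_repr_rsim => g _ /=; rewrite tr_scalar_mx.
congr (_%:M); rewrite -[LHS](sqr1_inv (alpha2 _)) -FcharV; congr (alpha _).
by apply: (mulgI (detGL g)); rewrite -detGLM !mulgV; apply: val_inj; rewrite /= det1.
Qed.

Lemma Ind_quadratic_self_dual alpha beta :
    (forall x, alpha x ^+ 2 = 1) -> (forall x, beta x ^+ 2 = 1) ->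
  self_dual (Ind_Borel alpha beta).
Proof.
move=> alpha2 beta2; apply: eq_repr_rsim => g _.
by symmetry; apply: dual_Ind_Borel => x; rewrite sqr1_inv.
Qed.

Lemma chi_q_self_dual alpha n (rV : mx_representation K GL2 n) :
    mx_irreducible rV -> (forall x, alpha x ^+ 2 = 1) -> is_chi_q alpha rV ->
  self_dual rV.
Proof.
move=> irrV alpha2 chiV.
apply: (self_dual_summand (rI := Representation (Ind_Borel alpha alpha)) irrV chiV).
  exact: Ind_quadratic_self_dual.
exact: char_det_self_dual.
Qed.

(** The dual of Ind (alpha, alpha^-1) is Ind (alpha^-1, alpha). *)
Lemma Ind_inv_self_dual alpha n (rV : mx_representation K GL2 n) :
    mx_irreducible rV -> (exists x, alpha x ^+ 2 != 1) ->
    mx_rsim rV (Ind_Borel alpha (inv_char alpha)) ->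
  self_dual rV.
Proof.
move=> irrV [x alpha2] simV.
have simV' : mx_rsim rV (Ind_Borel (inv_char alpha) alpha).
  apply: (swap_rsim irrV simV) => /(_ x) /= Dx; case/eqP: alpha2.
  by rewrite expr2 {2}Dx mulfV ?Fchar_neq0.
apply: mx_rsim_trans simV' _; apply: mx_rsim_sym.
apply: mx_rsim_trans (dual_rsim simV) _; apply: eq_repr_rsim => g _.
by apply: dual_Ind_Borel => y //=; rewrite invrK.
Qed.

End SelfDualPrincipal.

(** * Summing class functions *)

(** Count in two ways the pairs of an element s of S and of a conjugate of s. *)
Lemma class_sum (V : nmodType) (gT : finGroupType) (S R : {set gT}) (d m : nat)
    (f : gT -> V) :
    (forall g x, f (g ^ x)%g = f g) ->
    {in S, forall s, #|s ^: [set: gT]|%g = d} ->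
    {in S, forall s x, (s ^ x)%g \in R} ->
    {in R, forall g, #|[set s in S | g \in s ^: [set: gT]]|%g = m} ->
  (\sum_(g in R) f g) *+ m = (\sum_(s in S) f s) *+ d.
Proof.
move=> fJ classS SR countR.
transitivity (\sum_(s in S) \sum_(g in (s ^: [set: gT])%g) f g); last first.
  rewrite -sumrMnl; apply: eq_bigr => s Ss; rewrite -(classS s Ss) -sumr_const.
  by apply: eq_bigr => _ /imsetP[x _ ->].
rewrite -sumrMnl (exchange_big_dep (mem R)) /=; last first.
  by move=> s _ Ss /imsetP[x _ ->]; apply: SR.
apply: eq_bigr => g Rg; rewrite -(countR g Rg) -sumr_const.
by apply: eq_bigl => s; rewrite inE.
Qed.

Lemma card_class_centraliser (gT : finGroupType) (g : gT) (C : {set gT}) :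
    (forall h, (h \in C) = (g * h == h * g)%g) ->
  (#|g ^: [set: gT]|%g * #|C|)%N = #|[set: gT]|.
Proof.
move=> centC; rewrite -index_cent1 mulnC.
have -> : C = 'C_[set: gT][g]%g.
  by apply/setP=> h; rewrite centC inE in_setT; apply/eqP/cent1P => /esym.
exact: Lagrange (subsetIl _ _).
Qed.

Section ConjugatesOf.

Variable gT : finGroupType.

Definition conj_of (S : {set gT}) : {set gT} :=
  [set g | [exists s in S, g \in (s ^: [set: gT])%g]].

Lemma conj_ofP (S : {set gT}) g :
  reflect (exists2 s, s \in S & exists x, g = (s ^ x)%g) (g \in conj_of S).
Proof.
rewrite inE; apply: (iffP exists_inP) => [[s Ss /imsetP[x _ ->]]|[s Ss [x ->]]].
  by exists s => //; exists x.
by exists s; rewrite // memJ_class ?inE.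
Qed.

Lemma conj_of_sum (V : nmodType) (f : gT -> V) (S : {set gT}) d m :
    (forall g x, f (g ^ x)%g = f g) ->
    {in S, forall s, #|s ^: [set: gT]|%g = d} ->
    {in S, forall s, #|[set s' in S | s \in s' ^: [set: gT]]|%g = m} ->
  (\sum_(g in conj_of S) f g) *+ m = (\sum_(s in S) f s) *+ d.
Proof.
move=> fJ classS countS; apply: class_sum => // [s Ss x|g /conj_ofP[s Ss [x ->]]].
  by apply/conj_ofP; exists s => //; exists x.
rewrite -(countS s Ss); apply: eq_card => s'; rewrite !inE; congr (_ && _).
apply/imsetP/imsetP=> [[y _ Dy]|[y _ ->]]; last first.
  by exists (y * x)%g; rewrite ?inE // conjgM.
by exists (y * x^-1)%g; rewrite ?inE // conjgM -Dy conjgK.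
Qed.

End ConjugatesOf.

(** * The anisotropic torus *)

Lemma expf_pred_eq1 (R : idomainType) (b : R) n :
  (0 < n)%N -> b != 0 -> b ^+ n = b -> b ^+ n.-1 = 1.
Proof.
move=> n_gt0 nzb bn; apply: (mulIf nzb).
by rewrite mul1r -exprSr prednK.
Qed.

Lemma field_group_generator (gT : finGroupType) (G : {group gT})
    (L : fieldType) (f : gT -> L) :
    {in G &, {morph f : x y / (x * y)%g >-> x * y}} ->
    {in G, forall x, f x = 1 <-> x = 1%g} ->
  exists2 x, x \in G & (forall y, y \in G -> exists m, f y = f x ^+ m) /\
    (forall m, (f x ^+ m == 1) = (#|G| %| m)%N).
Proof.
move=> fM f1; have [x DG] := cyclicP (field_mul_group_cyclic fM f1).
have Gx : x \in G by rewrite DG cycle_id.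
have fX m : f (x ^+ m)%g = f x ^+ m.
  elim: m => [|m IHm]; first by rewrite expr0; apply/(f1 1%g (group1 G)).
  by rewrite expgS fM ?groupX // IHm exprS.
exists x => //; split=> [y|m].
  by rewrite DG => /cycleP[m ->]; exists m; rewrite fX.
rewrite DG -orderE order_dvdn -fX.
by apply/eqP/eqP => /f1 -> //; rewrite groupX.
Qed.

Section Torus.

Variables (F : finFieldType) (p k : nat).
Hypotheses (p_prime : prime p) (p_odd : odd p) (cardF : #|F| = (p ^ k)%N).
Variables (L : fieldExtType F) (e : 2.-tuple L).
Hypothesis basis_e : basis_of {:L} e.

Notation M := (mulL_mx e).
Notation T := (torus e).
Notation q := #|F|.

Lemma q_odd : odd q.
Proof. by rewrite cardF oddX p_odd orbT. Qed.

Lemma q_gt1 : (1 < q)%N.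
Proof. exact: finNzRing_gt1. Qed.

Lemma pcharF : p \in [pchar F].
Proof. exact: card_finPcharP cardF p_prime. Qed.

Lemma two_neq0 : 2%:R != 0 :> F.
Proof.
rewrite -(dvdn_pcharf pcharF) dvdn_prime2 //.
by apply: contraTneq p_odd => ->.
Qed.

Lemma coord_e v : v = \sum_i coord e i v *: e`_i.
Proof. exact: coord_basis basis_e (memvf v). Qed.

Lemma mulL_mxD a b : M (a + b) = M a + M b.
Proof. by apply/matrixP=> i j; rewrite !mxE mulrDl linearD. Qed.

Lemma mulL_mxZ c a : M (c *: a) = c *: M a.
Proof. by apply/matrixP=> i j; rewrite !mxE -scalerAl linearZ. Qed.

Lemma mulL_mxM a b : M (a * b) = M a *m M b.
Proof.
apply/matrixP=> i j; rewrite !mxE -mulrA {1}(coord_e (b * e`_j)).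
rewrite mulr_sumr linear_sum; apply: eq_bigr => l _ /=.
rewrite -scalerAr linearZ !mxE /=. by rewrite mulrC.
Qed.

Lemma mulL_mx1 : M 1 = 1%:M.
Proof.
apply/matrixP=> i j; by rewrite !mxE mul1r coord_free ?(basis_free basis_e) // eq_sym.
Qed.

Lemma mulL_mx_scalar c : M (c *: 1) = c%:M.
Proof. by rewrite mulL_mxZ mulL_mx1 scalemx1. Qed.

Lemma mulL_mx_eq0 a : M a = 0 -> a = 0.
Proof.
move=> Ma0; have ae j : a * e`_j = 0.
  case: (ltnP j 2) => [ltj|lej]; last by rewrite nth_default ?mulr0 ?size_tuple.
  rewrite (coord_e (a * _)) big1 // => i _.
  have /matrixP/(_ i (Ordinal ltj)) := Ma0; rewrite !mxE /= => ->.
  by rewrite scale0r.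
rewrite -[a]mulr1 (coord_e 1) mulr_sumr big1 // => i _.
by rewrite -scalerAr ae scaler0.
Qed.

Lemma mulL_mx_inj : injective M.
Proof.
move=> a b eqM; apply/eqP; rewrite -subr_eq0; apply/eqP/mulL_mx_eq0.
by rewrite -scaleN1r mulL_mxD mulL_mxZ eqM scaleN1r subrr.
Qed.

Lemma det_mulL_mx a : a != 0 -> \det (M a) != 0.
Proof.
move=> nza; rewrite -unitfE -unitmxE; case: (@mulmx1_unit F 2 (M a) (M a^-1)) => //.
by rewrite -mulL_mxM mulfV // mulL_mx1.
Qed.

Lemma torusP (g : gl2 F) : reflect (exists a, GLval g = M a) (g \in T).
Proof.
rewrite inE; apply: (iffP existsP) => [[v /eqP Dg]|[a Dg]].
  by exists (\sum_l v 0 l *: e`_l).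
exists (\row_l coord e l a); rewrite Dg {1}(coord_e a).
by apply/eqP; congr M; apply: eq_bigr => l _; rewrite mxE.
Qed.

Lemma gl_torus a : a != 0 -> gl (M a) \in T.
Proof. by move=> nza; apply/torusP; exists a; rewrite glK ?det_mulL_mx. Qed.

Lemma torus_group_set : group_set T.
Proof.
apply/group_setP; split=> [|g h /torusP[a Dg] /torusP[b Dh]]; apply/torusP.
  by exists 1; rewrite mulL_mx1.
by exists (a * b); rewrite mulL_mxM glM_mx Dg Dh.
Qed.

Canonical torus_group := Group torus_group_set.

Lemma torus_scal z : scalGL z \in T.
Proof. by apply/torusP; exists (val z *: 1); rewrite mulL_mx_scalar. Qed.

Lemma torus_val_neq0 (t : gl2 F) a : GLval t = M a -> a != 0.
Proof.
move=> Dt; have := GL_det t; apply: contraNneq => a0.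
by rewrite Dt a0 -(scale0r 0) mulL_mxZ scale0r det0.
Qed.

Lemma card_torus : #|T| = (q.-1 * q.+1)%N.
Proof.
pose f (v : 'rV[F]_2) := gl (M (\sum_l v 0 l *: e`_l)).
have nzf (v : 'rV[F]_2) : v != 0 -> \sum_l v 0 l *: e`_l != 0.
  apply: contra_neq => v0; apply/rowP=> i; rewrite mxE.
  have /freeP/(_ (fun l => v 0 l)) := basis_free basis_e; exact.
have -> : T = f @: [set~ 0].
  apply/setP=> t; apply/torusP/imsetP=> [[a Dt]|[v]]; last first.
    by rewrite !inE => /nzf nzv ->; exists (\sum_l v 0 l *: e`_l); rewrite glK ?det_mulL_mx.
  have nza := torus_val_neq0 Dt.
  exists (\row_l coord e l a).
    rewrite !inE; apply: contraNneq nza => r0; rewrite (coord_e a) big1 // => l _.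
    by have /rowP/(_ l) := r0; rewrite !mxE => ->; rewrite scale0r.
  apply: GLval_inj; rewrite Dt /f.
  have <- : a = \sum_l (\row_l coord e l a) 0 l *: e`_l.
    by rewrite {1}(coord_e a); apply: eq_bigr => l _; rewrite mxE.
  by rewrite glK ?det_mulL_mx.
rewrite card_in_imset => [|v w]; last first.
  rewrite !inE => /nzf nzv /nzf nzw /(congr1 (@GLval 2 F)).
  rewrite !glK ?det_mulL_mx // => /mulL_mx_inj eqvw; apply/rowP=> i.
  have /freeP/(_ (fun l => v 0 l - w 0 l)) := basis_free basis_e.
  move=> vw; apply/eqP; rewrite -subr_eq0; apply/eqP; apply: vw.
  under eq_bigr => l _ do rewrite scalerBl.
  by rewrite sumrB eqvw subrr.
by rewrite cardsC1 card_mx mul1n -subn1 -{2}(exp1n 2) subn_sqr subn1 addn1.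
Qed.

(** A finite group embedded in a field is cyclic, and L^x is carried by the finite
group T. *)
Lemma torus_generator : exists a0 : L,
  (forall a, a != 0 -> exists m, a = a0 ^+ m) /\
  (forall m, (a0 ^+ m == 1) = (q.-1 * q.+1 %| m)%N).
Proof.
pose f (t : gl2 F) : L := \sum_i (\sum_j GLval t i j * coord e j 1) *: e`_i.
have fE (t : gl2 F) a : GLval t = M a -> f t = a.
  move=> Dt; rewrite [RHS](coord_e a); apply: eq_bigr => i _; congr (_ *: _).
  rewrite -[in RHS](mulr1 a) {2}(coord_e 1) mulr_sumr linear_sum.
  by apply: eq_bigr => j _; rewrite Dt mxE -scalerAr linearZ /= mulrC.
have [||t0 _ [gen ord]] := @field_group_generator _ torus_group L f.
- move=> s t /torusP[a Da] /torusP[b Db]; rewrite (fE _ _ Da) (fE _ _ Db).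
  by apply: fE; rewrite glM_mx Da Db mulL_mxM.
- move=> t /torusP[a Da]; rewrite (fE _ _ Da); split=> [a1|t1].
    by apply: GLval_inj; rewrite Da a1 mulL_mx1.
  by apply: mulL_mx_inj; rewrite -Da t1 mulL_mx1.
exists (f t0); split=> [a nza|m]; last by rewrite ord card_torus.
have [m Dm] := gen _ (gl_torus nza); exists m; rewrite -Dm.
by rewrite (fE _ a) // glK ?det_mulL_mx.
Qed.

(** ** Frobenius on the torus *)

Lemma exprD_q (a b : L) : (a + b) ^+ q = a ^+ q + b ^+ q.
Proof.
apply: exprDn_pchar; rewrite cardF pnatX pnatE //.
by rewrite pchar_lalg pcharF.
Qed.

Lemma scalar_q (c : F) : (c *: 1 : L) ^+ q = c *: 1.
Proof. by rewrite exprZn expr1n expf_card. Qed.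

(** The theorem of Cayley and Hamilton, pulled back to L. *)
Lemma charpoly_root a : a * a + \det (M a) *: 1 = \tr (M a) *: a.
Proof.
apply: mulL_mx_inj; rewrite mulL_mxD mulL_mxM mulL_mx_scalar mulL_mxZ.
by rewrite CayleyHamilton2 subrK.
Qed.

Lemma charpoly_roots (a b : L) (tau delta : F) :
  a * a + delta *: 1 = tau *: a -> b * b + delta *: 1 = tau *: b ->
  b = a \/ b = tau *: 1 - a.
Proof.
move=> ra rb; have /eqP : (b - a) * (b - (tau *: 1 - a)) = 0.
  have -> : (b - a) * (b - (tau *: 1 - a)) =
      (b * b + delta *: 1) - (a * a + delta *: 1) - (tau *: 1) * (b - a) by ring.
  by rewrite rb ra -scalerAl mul1r scalerBr subrr.
by rewrite mulf_eq0 !subr_eq0 => /orP[]/eqP->; [left | right].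
Qed.

(** X^q - X has at most q roots in L, and the q scalars are among them. *)
Lemma Frobenius_fixed (a : L) : a ^+ q = a -> exists c : F, a = c *: 1.
Proof.
move=> aq; pose P : {poly L} := 'X^q - 'X.
pose rs : seq L := [seq c *: 1 | c : F].
have sizeP : size P = q.+1.
  by rewrite size_polyDl size_polyXn // size_polyN size_polyX ltnS q_gt1.
have nzP : P != 0 by rewrite -size_poly_eq0 sizeP.
have rootP (b : L) : b ^+ q = b -> root P b.
  by move=> bq; rewrite rootE !hornerE bq subrr.
have uniq_rs : uniq rs.
  rewrite map_inj_uniq ?enum_uniq // => c d /eqP.
  rewrite -subr_eq0 -scalerBl scaler_eq0 oner_eq0 orbF subr_eq0 => /eqP.
  exact.
have [/mapP[c _ ->]|a_rs] := boolP (a \in rs); first by exists c.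
have all_roots : all (root P) (a :: rs).
  rewrite /= rootP //=; apply/allP=> _ /mapP[c _ ->].
  by rewrite rootP ?scalar_q.
have := max_poly_roots nzP all_roots.
by rewrite /= a_rs uniq_rs sizeP size_map -cardE ltnn => /(_ isT).
Qed.

(** Frobenius permutes the roots a and tr a - a of the characteristic polynomial;
if it fixes a, then a is a scalar and these two roots agree. *)
Lemma mulL_mx_Frobenius a : M (a ^+ q) = (\tr (M a))%:M - M a.
Proof.
have rq : a ^+ q * a ^+ q + \det (M a) *: 1 = \tr (M a) *: a ^+ q.
  have /(congr1 (fun x => x ^+ q)) := charpoly_root a.
  by rewrite exprD_q exprMn scalar_q exprZn expf_card.
case: (charpoly_roots (charpoly_root a) rq) => [aq|->]; last first.
  by rewrite -[_ - a]/(_ + _) mulL_mxD mulL_mx_scalar -scaleN1r mulL_mxZ scaleN1r.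
rewrite aq; have [c ->] := Frobenius_fixed aq.
by rewrite mulL_mx_scalar mxtrace_scalar -[RHS]raddfB /= mulr2n addrK.
Qed.

Lemma norm_det a : a ^+ q.+1 = \det (M a) *: 1.
Proof.
apply: mulL_mx_inj; rewrite exprS mulL_mxM mulL_mx_Frobenius mulmxBr.
rewrite CayleyHamilton2 mul_mx_scalar opprB addrC subrK.
by rewrite mulL_mx_scalar.
Qed.

Lemma mulL_mx_is_scalar a : is_scalar_mx (M a) = (a ^+ q == a).
Proof.
apply/is_scalar_mxP/eqP=> [[c Dc]|/Frobenius_fixed[c ->]]; last first.
  by exists c; rewrite mulL_mx_scalar.
have -> : a = c *: 1 by apply: mulL_mx_inj; rewrite mulL_mx_scalar.
exact: scalar_q.
Qed.

(** The powers of a0 whose order divides q - 1 are those of a0 ^+ q.+1. *)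
Lemma scalar_power (a0 : L) (c : F) :
    (forall a, a != 0 -> exists m, a = a0 ^+ m) ->
    (forall m, (a0 ^+ m == 1) = (q.-1 * q.+1 %| m)%N) -> c != 0 ->
  exists m, c *: 1 = a0 ^+ (q.+1 * m).
Proof.
move=> gen ord nzc; have nzc1 : c *: 1 != 0 :> L.
  by rewrite scaler_eq0 oner_eq0 orbF.
have [m Dm] := gen _ nzc1.
have q1_gt0 : (0 < q.-1)%N by rewrite -ltnS prednK ?q_gt1 // ltnW ?q_gt1.
have : a0 ^+ (q.-1 * m) == 1.
  by rewrite (mulnC q.-1) exprM -Dm expf_pred_eq1 ?scalar_q // ltnW ?q_gt1.
rewrite ord (dvdn_pmul2l q1_gt0) => /dvdnP[l Dl].
by exists l; rewrite Dm Dl mulnC.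
Qed.

Lemma norm_onto (c : F) : c != 0 -> exists2 b : L, b != 0 & c *: 1 = b ^+ q.+1.
Proof.
move=> nzc; have [a0 [gen ord]] := torus_generator.
have [m Dm] := scalar_power gen ord nzc; exists (a0 ^+ m).
  apply: contraNneq nzc => m0; have : c *: 1 == 0 :> L.
    by rewrite Dm mulnC exprM m0 expr0n.
  by rewrite scaler_eq0 oner_eq0 orbF.
by rewrite Dm mulnC exprM.
Qed.

Lemma torus_centraliser (t g : gl2 F) : t \in T ->
  ~~ is_scalar_mx (GLval t) -> commute t g -> g \in T.
Proof.
move=> /torusP[a Dt] nst /(congr1 (@GLval 2 F)); rewrite !glM_mx => ctg.
have [x [y Dg]] := commutant2 nst ctg; apply/torusP; exists (x *: 1 + y *: a).
by rewrite Dg mulL_mxD mulL_mx_scalar mulL_mxZ Dt.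
Qed.

(** Conjugate elements of T have the same characteristic polynomial, of which a
and a^q are the only roots. *)
Lemma torus_conjugates (s t : gl2 F) a b : GLval s = M b -> GLval t = M a ->
    ~~ is_scalar_mx (GLval t) ->
  (exists x, s = (t ^ x)%g) <-> b = a \/ b = a ^+ q.
Proof.
move=> Ds Dt nst; split.
  case=> x Dx; have rb := charpoly_root b.
  rewrite -Ds Dx tr_conj det_conj Dt in rb.
  case: (charpoly_roots (charpoly_root a) rb) => [->|->]; [left | right] => //.
  apply: mulL_mx_inj; rewrite mulL_mx_Frobenius.
  by rewrite -[_ - a]/(_ + _) mulL_mxD mulL_mx_scalar -scaleN1r mulL_mxZ scaleN1r.
case=> Db; first by exists 1%g; rewrite conjg1; apply: GLval_inj; rewrite Ds Dt Db.
have Ds' : GLval s = (\tr (GLval t))%:M - GLval t.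
  by rewrite Ds Db mulL_mx_Frobenius Dt.
have [||||x Dx] := @conjGL F t s; last by exists x.
- by [].
- apply: contra nst => /is_scalar_mxP[c Dc]; apply/is_scalar_mxP.
  exists (\tr (GLval t) - c).
  by rewrite raddfB /= -Dc Ds' opprB addrC subrK.
- by rewrite Ds' raddfB /= mxtrace_scalar mulr2n addrK.
by rewrite Ds' det_adj2.
Qed.

(** ** Conjugacy classes *)

(** Every scalar is the square of some s in the torus, because q + 1 is even.
For g without eigenvalue, this applies to the discriminant of g, and then
(tr g + s) / 2 has the characteristic polynomial of g. *)
Lemma elliptic_conj (g : gl2 F) : (forall a, ~~ eigenvalue (GLval g) a) ->
  exists2 t : gl2 F, t \in T & exists x : gl2 F, g = (t ^ x)%g.
Proof.
set tau := \tr (GLval g); set delta := \det (GLval g) => noeig.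
have nz2 := two_neq0.
have nz4 : 4%:R != 0 :> F by rewrite (natrM F 2 2) mulf_neq0.
pose D := tau ^+ 2 - 4%:R * delta.
have sqD c : c ^+ 2 != D.
  apply: contra (noeig ((tau + c) / 2%:R)) => /eqP cD; rewrite eigenvalue2.
  rewrite -/tau -/delta; apply/eqP; have -> : delta = (tau ^+ 2 - c ^+ 2) / 4%:R.
    by rewrite cD /D; field.
  by field; rewrite nz4 nz2.
have nzD : D != 0 by have := sqD 0; rewrite expr0n eq_sym.
have [c nzc Dc] := norm_onto nzD.
pose a := c ^+ (q.+1)./2; pose s := gl (M a).
have nza : a != 0 by rewrite expf_neq0.
have Da : GLval s = M a by rewrite glK ?det_mulL_mx.
have ss : GLval s *m GLval s = D%:M.
  have half_q : ((q.+1)./2 + (q.+1)./2 = q.+1)%N.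
    by rewrite addnn -[RHS]odd_double_half /= q_odd.
  by rewrite Da -mulL_mxM -exprD half_q -Dc mulL_mx_scalar.
have nss : ~~ is_scalar_mx (GLval s).
  apply/negP=> /is_scalar_mxP[d Dd]; case/negP: (sqD d).
  have /(congr1 (fun A : 'M_2 => A 0 0)) := ss.
  by rewrite Dd -scalar_mxM !mxE /= !mulr1n expr2 => ->.
have trs : \tr (GLval s) = 0.
  apply: contraNeq nss => nztr; apply/is_scalar_mxP.
  exists ((\tr (GLval s))^-1 * (D + \det (GLval s))).
  rewrite scalar_mxM raddfD /= -ss CayleyHamilton2 subrK mul_scalar_mx.
  by rewrite scalerA mulVf // scale1r.
have dets : \det (GLval s) = - D.
  have := ss; rewrite CayleyHamilton2 trs scale0r sub0r => /matrixP/(_ 0 0).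
  by rewrite !mxE /= !mulr1n => <-; rewrite opprK.
pose b := 2%:R^-1 *: (tau *: 1 + a).
have Mb : M b = 2%:R^-1 *: (tau%:M + GLval s).
  by rewrite mulL_mxZ mulL_mxD mulL_mx_scalar Da.
have trb : \tr (M b) = tau.
  by rewrite Mb mxtraceZ raddfD /= mxtrace_scalar trs addr0 -mulr_natl; field.
have detb : \det (M b) = delta.
  have : \det (tau%:M + GLval s) = tau ^+ 2 + tau * \tr (GLval s) + \det (GLval s).
    rewrite scalar2E det2E (det2E (GLval s)) tr2E.
    by rewrite ![(mk2 _ _ _ _ + _) _ _]mxE !mk2E; ring.
  by rewrite Mb detZ trs dets => ->; rewrite /D; field.
have Db : GLval (gl (M b)) = M b by rewrite glK // detb GL_det.
have nsb : ~~ is_scalar_mx (GLval (gl (M b))).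
  apply: contra nss; rewrite Db Mb => /is_scalar_mxP[d Dd]; apply/is_scalar_mxP.
  exists (2%:R * d - tau); rewrite raddfB /= -(scale_scalar_mx 2%:R) -Dd scalerA mulfV //.
  by rewrite scale1r addrC addKr.
exists (gl (M b)); first by apply/torusP; exists b.
have nsg : ~~ is_scalar_mx (GLval g).
  apply/negP=> /is_scalar_mxP[d Dd]; case/negP: (noeig d).
  rewrite eigenvalue2 Dd mxtrace_scalar det_scalar mulr2n.
  by apply/eqP; ring.
have [||x <-] := conjGL nsb nsg; rewrite ?Db //.
by exists x.
Qed.

Lemma nonscalar_cases (g : gl2 F) : ~~ is_scalar_mx (GLval g) ->
  [\/ exists z, exists x : gl2 F, g = (jordan z 1%R ^ x)%g,
      exists a b, [/\ a != b, eigenvalue (GLval g) a & eigenvalue (GLval g) b] |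
      exists2 t : gl2 F, t \in T & exists x : gl2 F, g = (t ^ x)%g].
Proof.
move=> nsg; have [a eig_a|noeig] := pickP (eigenvalue (GLval g)); last first.
  by apply: Or33; apply: elliptic_conj => a; rewrite noeig.
set tau := \tr (GLval g); set delta := \det (GLval g).
have ra : a ^+ 2 - tau * a + delta = 0 by apply/eqP; rewrite -eigenvalue2.
have [eqa|neqa] := eqVneq a (tau - a); last first.
  apply: Or32; exists a, (tau - a); split=> //; rewrite eigenvalue2 -/tau -/delta.
  by rewrite -ra; apply/eqP; ring.
have Dtau : tau = 2%:R * a by rewrite mulr_natl mulr2n {1}eqa subrK.
have Ddelta : delta = a ^+ 2.
  apply: (addIr (a ^+ 2 - tau * a)); rewrite addrC ra Dtau; ring.
have nza : a != 0.
  by apply: contraNneq (GL_det g) => a0; rewrite -/delta Ddelta a0 expr0n.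
apply: Or31; exists (to_unit a).
have [||||x <-] := @conjGL F (jordan (to_unit a) 1) g; last by exists x.
- exact/jordan_nonscalar/oner_neq0.
- by [].
- by rewrite tr_jordan val_to_unit.
- by rewrite det_jordan val_to_unit.
Qed.

(** ** Summing class functions *)

Lemma card_GL2 : #|[set: (gl2 F)]| = (q * q.-1 ^ 2 * q.+1)%N.
Proof. exact: card_GL_2. Qed.

Definition unip_reps : {set (gl2 F)} :=
  [set jordan z 1 | z : {unit F}].

Definition elliptic_reps : {set (gl2 F)} :=
  [set t in T | ~~ is_scalar_mx (GLval t)].

Lemma card_unip_class s : s \in unip_reps ->
  #|s ^: [set: (gl2 F)]|%g = (q.-1 * q.+1)%N.
Proof.
(* The centraliser of a Jordan block consists of the jordan y x. *)
case/imsetP=> z _ ->{s}; pose f (zx : {unit F} * F) := jordan zx.1 zx.2.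
have q1_gt0 : (0 < q.-1)%N by rewrite -ltnS prednK ?q_gt1 // ltnW ?q_gt1.
have cC : #|f @: setT| = (q.-1 * q)%N.
  rewrite card_imset ?cardsT ?card_prod; last first.
    by move=> [? ?] [? ?] /jordan_inj.
  by rewrite -cardsT card_finField_unit.
apply/eqP; rewrite -(eqn_pmul2r (_ : 0 < #|f @: setT|)%N); last first.
  by rewrite cC muln_gt0 q1_gt0 ltnW ?q_gt1.
rewrite card_class_centraliser ?card_GL2 ?cC; first by rewrite -mulnn; apply/eqP; ring.
move=> h; apply/imsetP/eqP=> [[[y x] _ ->]|eqh].
  apply: GLval_inj; rewrite !glM_mx !jordanE.
  by apply: mx2_eq; rewrite !mulmx2E !mk2E; ring.
have [a [b Dh]] : exists a b, GLval h = a%:M + b *: GLval (jordan z 1).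
  apply: commutant2; first exact/jordan_nonscalar/oner_neq0.
  by rewrite -!glM_mx eqh.
have {}Dh : GLval h = mk2 (a + b * val z) b 0 (a + b * val z).
  rewrite Dh jordanE scalar2E.
  by apply: mx2_eq; rewrite [LHS]mxE [(b *: mk2 _ _ _ _) _ _]mxE !mk2E; ring.
have nz : a + b * val z != 0.
  apply: contraNneq (GL_det h) => az0; rewrite Dh det2E !mk2E az0; apply/eqP; ring.
exists (to_unit (a + b * val z), b) => //.
by apply: GLval_inj; rewrite Dh /f jordanE val_to_unit.
Qed.

Lemma card_elliptic_class s : s \in elliptic_reps ->
  #|s ^: [set: (gl2 F)]|%g = (q * q.-1)%N.
Proof.
rewrite inE => /andP[Ts nss].
have q1_gt0 : (0 < q.-1)%N by rewrite -ltnS prednK ?q_gt1 // ltnW ?q_gt1.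
apply/eqP; rewrite -(eqn_pmul2r (_ : 0 < #|T|)%N); last first.
  by rewrite card_torus muln_gt0 q1_gt0.
rewrite card_class_centraliser ?card_GL2 ?card_torus; last first.
  move=> h; apply/idP/eqP=> [Th|]; last exact: torus_centraliser.
  have [/torusP[a Da] /torusP[b Db]] := (Ts, Th).
  by apply: GLval_inj; rewrite !glM_mx Da Db -!mulL_mxM mulrC.
by apply/eqP; ring.
Qed.

Lemma unip_unique s : s \in unip_reps ->
  #|[set s' in unip_reps | s \in s' ^: [set: (gl2 F)]]|%g = 1%N.
Proof.
case/imsetP=> z _ Ds; apply/eqP/cards1P; exists s; apply/setP=> s'.
rewrite !inE; apply/andP/eqP=> [[/imsetP[z' _ Ds'] /imsetP[x _ Dx]]|->].
  have := tr_conj s' x; rewrite -Dx Ds Ds' !tr_jordan => /(mulfI two_neq0).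
  by move/val_inj->.
by rewrite class_refl Ds; split=> //; apply/imsetP; exists z.
Qed.

Lemma elliptic_two s : s \in elliptic_reps ->
  #|[set s' in elliptic_reps | s \in s' ^: [set: (gl2 F)]]|%g = 2%N.
Proof.
rewrite inE => /andP[/torusP[a Da] nss]; have nza := torus_val_neq0 Da.
have nq : gl (M a) != gl (M (a ^+ q)).
  apply: contra nss => /eqP/(congr1 (@GLval 2 F)).
  rewrite !glK ?det_mulL_mx ?expf_neq0 // => /mulL_mx_inj aq.
  by rewrite Da mulL_mx_is_scalar -aq.
transitivity #|[set gl (M a); gl (M (a ^+ q))]|; last by rewrite cards2 nq.
apply: eq_card => s'; rewrite inE [_ \in elliptic_reps]inE in_set2.
have conjP b : GLval s' = M b ->
    (s \in s' ^: [set: (gl2 F)])%g <-> b = a \/ b = a ^+ q.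
  move=> Db; rewrite -(torus_conjugates Db Da nss); split.
    by case/imsetP=> x _ ->; exists x^-1%g; rewrite conjgK.
  by case=> x ->; apply/imsetP; exists x^-1%g; rewrite ?inE ?conjgK.
apply/andP/orP=> [[/andP[/torusP[b Db] _] /(conjP b Db)[<-|<-]]|].
- by left; apply/eqP/GLval_inj; rewrite Db glK ?det_mulL_mx ?(torus_val_neq0 Db).
- by right; apply/eqP/GLval_inj; rewrite Db glK ?det_mulL_mx ?(torus_val_neq0 Db).
have Ms (b : L) : b != 0 -> s' = gl (M b) -> GLval s' = M b.
  by move=> nzb ->; rewrite glK ?det_mulL_mx.
case=> /eqP/Ms Db.
- have {}Db := Db nza; split; last by apply/(conjP a Db); left.
  apply/andP; split; first by apply/torusP; exists a.
  by rewrite Db -Da.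
have {}Db := Db (expf_neq0 _ nza); split; last by apply/(conjP _ Db); right.
apply/andP; split; first by apply/torusP; exists (a ^+ q).
rewrite Db mulL_mx_is_scalar; apply: contra nss => /eqP aqq.
rewrite Da mulL_mx_is_scalar -subr_eq0.
have : (a ^+ q - a) ^+ q == 0.
  have -> : (a ^+ q - a) ^+ q = (a ^+ q) ^+ q - a ^+ q.
    by apply: (addIr (a ^+ q)); rewrite -exprD_q !subrK.
  by rewrite aqq subrr.
by rewrite expf_eq0 => /andP[].
Qed.

Lemma conj_of_nonscalar (S : {set (gl2 F)}) g :
    {in S, forall s, ~~ is_scalar_mx (GLval s)} -> g \in conj_of S ->
  ~~ is_scalar_mx (GLval g).
Proof. by move=> nsS /conj_ofP[s Ss [x ->]]; rewrite scalarGL_conj nsS. Qed.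

Lemma unip_nonscalar : {in unip_reps, forall s, ~~ is_scalar_mx (GLval s)}.
Proof. by move=> _ /imsetP[z _ ->]; apply/jordan_nonscalar/oner_neq0. Qed.

Lemma elliptic_nonscalar : {in elliptic_reps, forall s, ~~ is_scalar_mx (GLval s)}.
Proof. by move=> s; rewrite inE => /andP[]. Qed.

Lemma unip_elliptic_disjoint g :
  g \in conj_of unip_reps -> g \in conj_of elliptic_reps -> False.
Proof.
case/conj_ofP=> _ /imsetP[z _ ->] [x ->].
case/conj_ofP=> t; rewrite inE => /andP[/torusP[a Da] nst] [y Dy].
have := congr1 (fun h => \tr (GLval h)) Dy.
have := congr1 (fun h => \det (GLval h)) Dy.
rewrite /= !tr_conj !det_conj tr_jordan det_jordan Da => detE trE.
have := charpoly_root a; rewrite -detE -trE => ra.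
have : (a - val z *: 1) * (a - val z *: 1) = 0.
  transitivity (a * a + (val z *: 1) * (val z *: 1) -
    ((val z *: 1) * a + (val z *: 1) * a)); first by ring.
  rewrite -2!scalerAl !mul1r scalerA -expr2 -scalerDl -mulr2n -[val z *+ 2]mulr_natl.
  by rewrite ra subrr.
move/eqP; rewrite mulf_eq0 orbb subr_eq0 => /eqP az.
case/negP: nst; rewrite Da az mulL_mx_scalar; exact: scalar_mx_is_scalar.
Qed.

(** Weyl's integration formula, without its split term. Each elliptic class meets
T twice, whence the factor 2. *)
Lemma nonsplit_sum (V : nmodType) (f : gl2 F -> V) :
    (forall g x, f (g ^ x)%g = f g) ->
    (forall g a b, a != b -> eigenvalue (GLval g) a -> eigenvalue (GLval g) b ->
       f g = 0) ->
  (\sum_g f g) *+ 2 = (\sum_z f (scalGL z)) *+ 2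
    + (\sum_z f (jordan z 1)) *+ (2 * (q.-1 * q.+1))
    + (\sum_(t in elliptic_reps) f t) *+ (q * q.-1).
Proof.
move=> fJ f0; rewrite mulnC mulrnA.
have -> : \sum_z f (jordan z 1) = \sum_(s in unip_reps) f s.
  rewrite big_imset /= => [|z z' _ _ /jordan_inj[]] //.
rewrite -(conj_of_sum fJ card_unip_class unip_unique) mulr1n.
rewrite -(conj_of_sum fJ card_elliptic_class elliptic_two) -!mulrnDl.
congr (_ *+ 2); rewrite (bigID (fun g : gl2 F => is_scalar_mx (GLval g))) /=.
rewrite -addrA; congr (_ + _).
  rewrite (reindex_onto (@scalGL F) (fun g => to_unit (GLval g 0 0))) /=.
    apply: eq_bigl => z; rewrite scalar_mx_is_scalar /= !mxE /= to_unitK.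
    by rewrite eqxx.
  move=> g /is_scalarGL[z ->]; rewrite /= mxE /= to_unitK //.
rewrite (bigID (mem (conj_of unip_reps))) /=; congr (_ + _).
  apply: eq_bigl => g; apply/andP/idP=> [[]//|Rg]; split=> //.
  exact: conj_of_nonscalar unip_nonscalar Rg.
rewrite big_mkcond [RHS]big_mkcond; apply: eq_bigr => g _.
have [Eg|nEg] := boolP (g \in conj_of elliptic_reps).
  rewrite (conj_of_nonscalar elliptic_nonscalar Eg) /=.
  by case: ifP => // /negbFE Ug; case: (unip_elliptic_disjoint Ug Eg).
case: ifP => // /andP[nsg nUg].
case: (nonscalar_cases nsg) => [[z [x Dg]]|[a [b [nab]]]|[t Tt [x Dg]]].
- case/negP: nUg; apply/conj_ofP; exists (jordan z 1); last by exists x.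
  by apply/imsetP; exists z.
- exact: f0.
case/negP: nEg; apply/conj_ofP; exists t; last by exists x.
by rewrite inE Tt -(scalarGL_conj t x) -Dg.
Qed.

End Torus.

(** * Sums of characters, roots of unity, common eigenvectors *)

Section CharacterSums.

Variables (K : numClosedFieldType) (gT : finGroupType) (T : {group gT}).

Definition mult_on (f : gT -> K) : Prop :=
  f 1%g = 1 /\ {in T &, {morph f : x y / (x * y)%g >-> x * y}}.

Lemma mult_on_neq0 f t : mult_on f -> t \in T -> f t != 0.
Proof.
move=> [f1 fM] Tt; apply/eqP=> ft0; move/eqP: f1.
by rewrite -(mulgV t) fM ?groupV // ft0 mul0r eq_sym oner_eq0.
Qed.

Lemma mult_onV f t : mult_on f -> t \in T -> f t^-1%g = (f t)^-1.
Proof.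
move=> mf Tt; have [f1 fM] := mf; apply: (mulfI (mult_on_neq0 mf Tt)).
by rewrite -fM ?groupV // mulgV f1 mulfV ?mult_on_neq0.
Qed.

Lemma mult_on_div f g :
  mult_on f -> mult_on g -> mult_on (fun t => f t / g t).
Proof.
move=> [f1 fM] [g1 gM]; split=> [|x y Tx Ty]; first by rewrite f1 g1 invr1 mulr1.
by rewrite fM // gM // invfM mulrACA.
Qed.

(** If f s is not 1, then multiplication by f s, which translates the sum by s,
does not change it. *)
Lemma sum_char f : mult_on f ->
  \sum_(t in T) f t = if [forall t in T, f t == 1] then #|T|%:R else 0.
Proof.
move=> [f1 fM]; case: ifPn => [/forall_inP fT|].
  by rewrite (eq_bigr (fun=> 1)) ?sumr_const // => t /fT/eqP.
rewrite negb_forall_in => /exists_inP[s Ts fs].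
have : f s * \sum_(t in T) f t = \sum_(t in T) f t.
  rewrite mulr_sumr [RHS](reindex_inj (mulgI s)) /=.
  rewrite [RHS](eq_bigl (mem T)) => [|t]; last by rewrite /= groupMl.
  by apply: eq_bigr => t Tt; rewrite fM.
move/eqP; rewrite -subr_eq0 -{2}[\sum_(t in T) _]mul1r -mulrBl mulf_eq0.
by rewrite subr_eq0 (negPf fs) => /eqP.
Qed.

(** The scalar product of f1 with the left side, hence with the right side, is
not 0. *)
Lemma char_pair_independent f1 f2 g1 g2 :
    mult_on f1 -> mult_on f2 ->
    mult_on g1 -> mult_on g2 ->
    {in T, forall t, f1 t + f2 t = g1 t + g2 t} ->
  {in T, f1 =1 g1} \/ {in T, f1 =1 g2}.
Proof.
move=> mf1 mf2 mg1 mg2 eqfg.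
have eq_div f g : [forall t in T, f t / g t == 1 :> K] -> mult_on g ->
    {in T, g =1 f}.
  move=> /forall_inP fg mg t Tt; have nz := mult_on_neq0 mg Tt.
  by apply: (mulIf (invr_neq0 nz)); rewrite (eqP (fg t Tt)) mulfV.
have : \sum_(t in T) (f1 t / f1 t) + \sum_(t in T) (f2 t / f1 t) =
    \sum_(t in T) (g1 t / f1 t) + \sum_(t in T) (g2 t / f1 t).
  rewrite -!big_split; apply: eq_bigr => t Tt /=.
  by rewrite -!mulrDl eqfg.
rewrite !sum_char; try exact: mult_on_div.
case: (boolP [forall t in T, g1 t / f1 t == 1]) => [/eq_div e1 _|_].
  by left; apply: e1.
case: (boolP [forall t in T, g2 t / f1 t == 1]) => [/eq_div e2 _|_].
  by right; apply: e2.
rewrite addr0 ifT; last first.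
  by apply/forall_inP=> t Tt; rewrite mulfV ?(mult_on_neq0 mf1).
case: ifP => _ /eqP; rewrite ?addr0 -?natrD pnatr_eq0 ?addn_eq0.
  by rewrite (gtn_eqF (cardG_gt0 T)).
by rewrite (gtn_eqF (cardG_gt0 T)).
Qed.

End CharacterSums.

Section ClosedField.

Variable K : numClosedFieldType.

Lemma primitive_root_exists n : (0 < n)%N -> exists z : K, n.-primitive_root z.
Proof.
move=> n_gt0; have [r Dr] := closed_field_poly_normal ('X^n - 1 : {poly K}).
rewrite (monicP _) ?monicXnsubC // scale1r in Dr.
have unity_r : all n.-unity_root r.
  by apply/allP=> z; rewrite -root_prod_XsubC -Dr.
have uniq_r : uniq r.
  by rewrite -separable_prod_XsubC -Dr separable_Xn_sub_1 // pnatr_eq0 -lt0n.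
have size_r : (n <= size r)%N.
  by rewrite -ltnS -(size_prod_XsubC r id) -Dr size_XnsubC.
by have /hasP[z _ prim_z] := has_prim_root n_gt0 unity_r uniq_r size_r; exists z.
Qed.

(** The matrices of the restrictions to U, in a basis of U, still commute. *)
Lemma common_eigenvector_in n (U : 'M[K]_n) (As : seq 'M[K]_n) :
    U != 0 -> {in As, forall A, stablemx U A} ->
    {in As &, forall A B, comm_mx A B} ->
  exists v : 'rV[K]_n, [/\ v != 0, (v <= U)%MS & {in As, forall A, stablemx v A}].
Proof.
move=> nzU stabU commA; pose B := row_base U.
have freeB : row_free B := row_base_free U.
pose res (A : 'M[K]_n) := B *m A *m pinvmx B.
have resE A : A \in As -> res A *m B = B *m A.
  move=> /stabU stabA; rewrite /res mulmxKpV //.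
  apply: submx_trans (submxMr A (_ : B <= U)%MS) _; first by rewrite eq_row_base.
  by apply: submx_trans stabA _; rewrite eq_row_base.
have [||v nzv stab_v] := @common_eigenvector K (\rank U) (map res As).
- by rewrite lt0n mxrank_eq0.
- move=> _ _ /mapP[A As_A ->] /mapP[A' As_A' ->]; apply: (row_free_inj freeB).
  rewrite /= -(mulmxA (res A)) -(mulmxA (res A')) !resE //.
  rewrite (mulmxA (res A) B) (mulmxA (res A') B) !resE // -!(mulmxA B).
  by congr (_ *m _); apply: commA.
exists (v *m B); split.
- by apply: contra_neq nzv => vB0; apply: (row_free_inj freeB); rewrite /= vB0 mul0mx.
- by rewrite -(eq_row_base U) submxMl.
move=> A As_A; rewrite -mulmxA -resE // mulmxA submxMr //.
by apply: (allP stab_v); apply: map_f.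
Qed.

Lemma stable_rowE n (v : 'rV[K]_n) (A : 'M[K]_n) : stablemx v A ->
  v *m A = (v *m A *m pinvmx v) 0 0 *: v.
Proof. by move=> vA; rewrite -mul_scalar_mx -mx11_scalar mulmxKpV. Qed.

Lemma scalar_row_inj n (v : 'rV[K]_n) a b : v != 0 -> a *: v = b *: v -> a = b.
Proof.
move=> nzv /eqP; rewrite -subr_eq0 -scalerBl scaler_eq0 (negPf nzv) orbF.
by rewrite subr_eq0 => /eqP.
Qed.

End ClosedField.

(** * Vectors fixed by the unipotent group *)

Section UnipotentSum.

Variables (K : numClosedFieldType) (F : finFieldType).
Notation GL2 := 'GL_2[F]%G.
Notation Fchar := (lin_char K [set: {unit F}]).
Variables (n : nat) (rV : mx_representation K GL2 n).

(** Up to the factor q, the projection of V onto the vectors fixed by U. *)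
Definition uni_sum : 'M[K]_n := \sum_x rV (uni x).

Lemma reprM g h : rV (g * h)%g = rV g *m rV h.
Proof. by rewrite repr_mxM ?inE. Qed.

Lemma uni_sum_fixed y : uni_sum *m rV (uni y) = uni_sum.
Proof.
rewrite /uni_sum mulmx_suml [RHS](reindex_inj (addIr y)) /=.
by apply: eq_bigr => x _; rewrite -reprM uniD.
Qed.

Lemma uni_sum_dia a d : uni_sum *m rV (dia a d) = rV (dia a d) *m uni_sum.
Proof.
rewrite /uni_sum mulmx_suml mulmx_sumr.
have nz : val a / val d != 0 by rewrite mulf_neq0 ?invr_neq0 ?unitF_neq0.
rewrite (reindex_inj (mulfI nz)) /=; apply: eq_bigr => x _.
by rewrite -!reprM dia_uni mulrAC.
Qed.

(** The diagonal matrices commute with each other and stabilise the space of the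
vectors fixed by U. *)
Lemma Borel_eigenvector : uni_sum != 0 ->
  exists alpha beta : Fchar, exists2 v : 'rV[K]_n, v != 0 &
    {in Borel F, forall b, v *m rV b = Borel_fun alpha beta b *: v}.
Proof.
move=> nzE; pose As := [seq rV (dia ad.1 ad.2) | ad : {unit F} * {unit F}].
have inAs a d : rV (dia a d) \in As.
  by apply/mapP; exists (a, d); rewrite ?mem_enum.
have [||v [nzv vE stab_v]] := @common_eigenvector_in K n uni_sum As nzE.
- by move=> _ /mapP[[a d] _ ->]; rewrite uni_sum_dia submxMl.
- move=> _ _ /mapP[[a d] _ ->] /mapP[[a' d'] _ ->]; rewrite /comm_mx -!reprM -!diaM.
  by congr (rV (dia _ _)); apply: val_inj; apply: mulrC.
pose ev a d := (v *m rV (dia a d) *m pinvmx v) 0 0.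
have evE a d : v *m rV (dia a d) = ev a d *: v by apply: stable_rowE; apply: stab_v.
have ev1 : ev 1%g 1%g = 1.
  apply: (scalar_row_inj nzv); rewrite -evE -scal_dia.
  have -> : scalGL 1 = 1%g :> gl2 F by apply: GLval_inj.
  by rewrite repr_mx1 mulmx1 scale1r.
have evM a d a' d' : ev (a * a')%g (d * d')%g = ev a d * ev a' d'.
  apply: (scalar_row_inj nzv); rewrite -evE diaM reprM mulmxA evE -scalemxAl evE.
  by rewrite scalerA.
have alphaM : {in [set: {unit F}] &, {morph (fun a => ev a 1%g) :
    x y / (x * y)%g >-> x * y}}.
  by move=> x y _ _; rewrite /= -{1}(mulg1 1%g) evM.
have betaM : {in [set: {unit F}] &, {morph (fun d => ev 1%g d) :
    x y / (x * y)%g >-> x * y}}.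
  by move=> x y _ _; rewrite /= -{1}(mulg1 1%g) evM.
exists (@LinChar K _ _ (fun a => ev a 1%g) ev1 alphaM).
exists (@LinChar K _ _ (fun d => ev 1%g d) ev1 betaM); exists v => // b Bb.
rewrite {1}(Borel_dec Bb) reprM mulmxA evE -scalemxAl /Borel_fun /=.
rewrite -evM mulg1 mul1g; congr (_ *: _).
by have /submxP[w ->] := vE; rewrite -mulmxA uni_sum_fixed.
Qed.

End UnipotentSum.

(** * Cuspidal representations: values on the Borel subgroup *)

Section CuspidalBorel.

Variables (K : numClosedFieldType) (F : finFieldType).
Notation GL2 := 'GL_2[F]%G.
Notation q := #|F|.
Variables (n : nat) (rV : mx_representation K GL2 n).

Lemma trace_conj (g x : gl2 F) : \tr (rV (g ^ x)%g) = \tr (rV g).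
Proof. by rewrite conjgE !reprM mxtrace_mulC -mulmxA -reprM mulgV repr_mx1 mulmx1. Qed.

Lemma trace_conjV (g x : gl2 F) : \tr (rV (g ^ x)^-1%g) = \tr (rV g^-1%g).
Proof. by rewrite -conjVg trace_conj. Qed.

Hypothesis irrV : mx_irreducible rV.

Lemma scalar_repr z : rV (scalGL z) = (\tr (rV (scalGL z)) / n%:R)%:M.
Proof.
have [n_gt0 _] := (mx_irrP _).1 irrV.
have nzn : n%:R != 0 :> K by rewrite pnatr_eq0 -lt0n.
have [|c ->] := @Schur_scalar _ _ _ _ rV (rV (scalGL z)) irrV.
  by move=> g _; rewrite -!reprM scalGL_commute.
by rewrite mxtrace_scalar -[c *+ n]mulr_natr mulfK.
Qed.

Definition central (z : {unit F}) : K := \tr (rV (scalGL z)) / n%:R.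

Lemma trace_central_mul z g : \tr (rV (scalGL z * g)%g) = central z * \tr (rV g).
Proof. by rewrite reprM scalar_repr mul_scalar_mx mxtraceZ. Qed.

Lemma n_neq0 : n%:R != 0 :> K.
Proof. by have [n_gt0 _] := (mx_irrP _).1 irrV; rewrite pnatr_eq0 -lt0n. Qed.

Lemma trace_scal z : \tr (rV (scalGL z)) = n%:R * central z.
Proof. by rewrite /central mulrCA mulfV ?n_neq0 ?mulr1. Qed.

Lemma centralM : {morph central : x y / (x * y)%g >-> x * y}.
Proof.
move=> x y; rewrite {1}/central.
have -> : scalGL (x * y)%g = (scalGL x * scalGL y)%g.
  by rewrite !scal_dia diaM.
by rewrite trace_central_mul trace_scal mulrCA mulrC mulKf ?n_neq0.
Qed.

Lemma scalGL1 : scalGL 1%g = 1%g :> gl2 F.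
Proof. exact: GLval_inj. Qed.

Lemma central1 : central 1%g = 1.
Proof. by rewrite /central scalGL1 repr_mx1 mxtrace1 mulfV ?n_neq0. Qed.

Hypothesis cuspV : uni_sum rV = 0.

Lemma cusp_sum g : \sum_x \tr (rV (g * uni x)%g) = 0.
Proof.
under eq_bigr => x _ do rewrite reprM.
by rewrite -raddf_sum -mulmx_sumr /= -/(uni_sum rV) cuspV mulmx0 mxtrace0.
Qed.

(** The products of diag(a, b) with the elements of U are all conjugate to g, and
their traces add up to 0. *)
Lemma cusp_split (g : gl2 F) a b : a != b ->
  eigenvalue (GLval g) a -> eigenvalue (GLval g) b -> \tr (rV g) = 0.
Proof.
move=> nab; rewrite !eigenvalue2 => /eqP ra /eqP rb.
set tau := \tr (GLval g) in ra rb; set delta := \det (GLval g) in ra rb.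
have trE : tau = a + b.
  apply: (mulfI (_ : a - b != 0)); first by rewrite subr_eq0.
  by apply/eqP; rewrite -subr_eq0 -(subr0 0) -{1}rb -ra; apply/eqP; ring.
have detE : delta = a * b.
  by apply/eqP; rewrite -subr_eq0 -ra trE; apply/eqP; ring.
have nzab : a * b != 0 by rewrite -detE GL_det.
have [nza nzb] : a != 0 /\ b != 0 by apply/andP; rewrite -negb_or -mulf_eq0.
pose d := dia (to_unit a) (to_unit b).
have DU x : GLval (d * uni x)%g = mk2 a (a * x) 0 b.
  rewrite glM_mx diaE uniE !val_to_unit //.
  by apply: mx2_eq; rewrite mulmx2E !mk2E; ring.
have nsg : ~~ is_scalar_mx (GLval g).
  apply/negP=> /is_scalar_mxP[c Dc]; case/eqP: nab.
  have rc y : y ^+ 2 - tau * y + delta = (y - c) ^+ 2.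
    by rewrite /tau /delta Dc mxtrace_scalar det_scalar mulr2n; ring.
  move/eqP: ra; rewrite rc expf_eq0 subr_eq0 => /eqP->.
  by move/eqP: rb; rewrite rc expf_eq0 subr_eq0 => /eqP->.
have eqd x : \tr (rV (d * uni x)%g) = \tr (rV g).
  have [||||y <-] := @conjGL F g (d * uni x)%g; rewrite ?DU ?trace_conj //.
  - by rewrite is_scalar2 !mk2E (negPf nab).
  - by rewrite -/tau trE tr2E !mk2E.
  - by rewrite -/delta detE det2E !mk2E mulr0 subr0.
have := cusp_sum d; rewrite (eq_bigr (fun=> \tr (rV g))) // sumr_const => /eqP.
by rewrite mulrn_eq0 (gtn_eqF (ltnW (finNzRing_gt1 F))) => /eqP.
Qed.

Lemma trace_uni x : x != 0 -> \tr (rV (uni x)) = \tr (rV (uni 1)).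
Proof.
move=> nzx; have [||||y <-] := @conjGL F (uni 1) (uni x); rewrite ?trace_conj //.
- exact/uni_nonscalar/oner_neq0.
- exact: uni_nonscalar.
- by rewrite !uniE !tr2E !mk2E.
- by rewrite !uniE !det2E !mk2E !mulr0.
Qed.

Lemma trace_jordan z x : x != 0 ->
  \tr (rV (jordan z x)) = central z * \tr (rV (uni 1)).
Proof.
move=> nzx; rewrite jordan_scal_uni trace_central_mul trace_uni //.
by rewrite mulf_neq0 ?invr_neq0 ?unitF_neq0.
Qed.

Lemma natr_q1 : q.-1%:R = q%:R - 1 :> K.
Proof. by rewrite -subn1 natrB // ltnW ?finNzRing_gt1. Qed.

Lemma cusp_uni : (q%:R - 1) * \tr (rV (uni 1)) = - n%:R.
Proof.
have := cusp_sum 1%g; rewrite (bigD1 0) //= uni0 mulg1 repr_mx1 mxtrace1 => /eqP.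
rewrite (eq_bigr (fun=> \tr (rV (uni 1)))) => [|x nzx]; last first.
  by rewrite mul1g trace_uni.
rewrite sumr_const cardC1 addrC addr_eq0 => /eqP <-.
by rewrite -natr_q1 mulr_natl.
Qed.

(** V restricts to U as a multiple of the sum of the nontrivial characters of
U: the multiplicity of any character that occurs is n / (q - 1). *)
Lemma cusp_dim : exists2 m, (0 < m)%N & n = (m * q.-1)%N.
Proof.
have [n_gt0 _] := (mx_irrP _).1 irrV.
have q_gt1 : (1 < q)%N := finNzRing_gt1 F.
have nz1 : (1%:M : 'M[K]_n) != 0 by rewrite -mxrank_eq0 mxrank1 -lt0n.
pose As := [seq rV (uni x) | x : F].
have [||v [nzv _ stab_v]] := @common_eigenvector_in K n 1%:M As nz1.
- by move=> A _; apply: submx1.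
- move=> _ _ /mapP[x _ ->] /mapP[y _ ->]; rewrite /comm_mx -!reprM -!uniD.
  by rewrite addrC.
pose psi x := (v *m rV (uni x) *m pinvmx v) 0 0.
have psiE x : v *m rV (uni x) = psi x *: v.
  by apply: stable_rowE; apply: stab_v; apply/mapP; exists x; rewrite ?mem_enum.
have psi0 : psi 0 = 1.
  by apply: (scalar_row_inj nzv); rewrite -psiE uni0 repr_mx1 mulmx1 scale1r.
have psiD x y : psi (x + y) = psi x * psi y.
  apply: (scalar_row_inj nzv); rewrite -psiE uniD reprM mulmxA psiE -scalemxAl.
  by rewrite psiE scalerA.
have sum_psi : \sum_x psi x = 0.
  apply: (scalar_row_inj nzv); rewrite scaler_suml scale0r.
  transitivity (v *m uni_sum rV); last by rewrite cuspV mulmx0.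
  rewrite /uni_sum mulmx_sumr.
  by apply: eq_bigr => x _; rewrite psiE.
pose U := [set uni x | x : F].
have gU : group_set U.
  apply/group_setP; split; first by apply/imsetP; exists 0; rewrite ?uni0.
  by move=> _ _ /imsetP[x _ ->] /imsetP[y _ ->]; rewrite -uniD imset_f.
pose f (g : gl2 F) := psi (GLval g 0 1).
have fE x : f (uni x) = psi x by rewrite /f uniE mk2E.
have [||m Dm] := @multiplicity_nat K _ (Group gU) n
    (subg_repr rV (subsetT _)) f.
- by rewrite -uni0 fE.
- by move=> _ _ /imsetP[x _ ->] /imsetP[y _ ->]; rewrite /= -uniD !fE psiD.
have uni_inj : injective (@uni F).
  by move=> x y /(congr1 (fun g : gl2 F => GLval g 0 1)); rewrite !uniE !mk2E.
have uniV x : (uni x)^-1%g = uni (- x).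
  by apply: (mulgI (uni x)); rewrite mulgV -uniD subrr uni0.
have cU : #|U| = q by rewrite card_imset // cardsT.
have {Dm} Dm : n%:R - \tr (rV (uni 1)) = m%:R * q%:R.
  rewrite -natrM -cU -Dm big_imset /= => [|x y _ _ /uni_inj //].
  rewrite (eq_bigl predT) => [|x]; last by rewrite inE.
  rewrite (bigD1 0) //= uniV oppr0 fE psi0 mul1r uni0 repr_mx1 mxtrace1.
  rewrite (eq_bigr (fun x => psi (- x) * \tr (rV (uni 1)))) => [|x nzx].
    rewrite -mulr_suml; congr (_ + _); rewrite -mulN1r; congr (_ * _).
    have : \sum_x psi (- x) = 0.
      by rewrite -(reindex_inj oppr_inj (P := predT) (F := psi)).
    by rewrite (bigD1 0) //= oppr0 psi0 => /eqP; rewrite addrC addr_eq0 => /eqP.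
  by rewrite uniV fE trace_uni.
have q1 : q%:R = 1 + q.-1%:R :> K by rewrite -[1]/(1%:R) -natrD add1n prednK // ltnW.
exists m.
  rewrite lt0n; apply: contraTneq n_gt0 => m0; rewrite -leqNgt leqn0.
  have := cusp_uni; move/eqP: Dm; rewrite m0 mul0r subr_eq0 => /eqP <-.
  rewrite mulrBl mul1r => /eqP; rewrite -subr_eq0 opprK subrK mulf_eq0 => /orP[].
    by rewrite pnatr_eq0 => /eqP q0; rewrite q0 in q_gt1.
  by rewrite pnatr_eq0.
apply/eqP; rewrite -(eqr_nat K) natrM; apply/eqP.
have nzq : q%:R != 0 :> K by rewrite pnatr_eq0 -lt0n ltnW.
apply: (mulfI nzq); transitivity ((m%:R * q%:R) * q.-1%:R : K); last by ring.
have := cusp_uni; rewrite -Dm q1 => e.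
transitivity (n%:R * q.-1%:R - (1 + q.-1%:R - 1) * \tr (rV (uni 1)) : K); last by ring.
by rewrite e; ring.
Qed.

End CuspidalBorel.

(** * Fourier analysis on the torus *)

(** The integers d i ^+ 2 - d i are nonnegative and have the sum 2 - 2 m. *)
Lemma int_sum_two (I : finType) (d : I -> int) (m : nat) :
    (0 < m)%N -> \sum_i d i ^+ 2 = 2 -> \sum_i d i = (2 * m)%:Z ->
  m = 1%N /\ exists i1 i2, i1 != i2 /\ forall i, d i = (i == i1)%:R + (i == i2)%:R.
Proof.
move=> m_gt0 sum_sq sum_d.
have ge0 i : 0 <= d i ^+ 2 - d i.
  case: (d i) => [[|l]|l]; rewrite ?expr0n ?subrr //.
    by rewrite subr_ge0 expr2 ler_peMr.
have sumE : \sum_i (d i ^+ 2 - d i) = 2 - (2 * m)%:Z by rewrite sumrB sum_sq sum_d.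
have m1 : m = 1%N.
  have : 0 <= \sum_i (d i ^+ 2 - d i) by apply: sumr_ge0.
  rewrite sumE subr_ge0 -[2]/(2%:Z) lez_nat; rewrite -[X in (_ <= X)%N]/(2 * 1)%N leq_pmul2l // => m_le1.
  by apply/eqP; rewrite eqn_leq m_le1.
split=> //; move: sumE; rewrite m1 muln1 subrr => /eqP.
rewrite psumr_eq0 // => /allP all0.
have d01 i : d i = (d i == 1)%:R.
  have := all0 i (mem_index_enum i); rewrite /= subr_eq0 expr2 => /eqP.
  case: eqP => [->//|d1 dd]; apply/eqP; apply: contraT => nz.
  by case: d1; apply: (mulfI nz); rewrite mulr1.
pose A := [set i | d i == 1].
have : #|A| == 2%N.
  rewrite -eqz_nat; apply/eqP; transitivity (\sum_i d i); last by rewrite sum_d m1.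
  rewrite -[LHS]natz -sumr_const big_mkcond; apply: eq_bigr => i _.
  by rewrite d01 inE; case: (d i == 1).
case/cards2P=> [i1 [i2 [n12 DA]]]; exists i1, i2; split=> // i.
have := n12; rewrite d01 -[d i == 1](in_set (fun i => d i == 1)) -/A DA !inE.
by have [->|_] := eqVneq i i1; [move/negPf-> | rewrite add0r].
Qed.

Section TorusCharacters.

Variables (K : numClosedFieldType) (F : finFieldType) (p k : nat).
Hypotheses (p_prime : prime p) (p_odd : odd p) (cardF : #|F| = (p ^ k)%N).
Variables (L : fieldExtType F) (e : 2.-tuple L).
Hypothesis basis_e : basis_of {:L} e.

Notation M := (mulL_mx e).
Notation q := #|F|.
Notation T := (torus_group basis_e).
Notation N := (q.-1 * q.+1)%N.

Variables (a0 : L) (zeta : K).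
Hypothesis gen_a0 : forall a, a != 0 -> exists m, a = a0 ^+ m.
Hypothesis ord_a0 : forall m, (a0 ^+ m == 1) = (N %| m)%N.
Hypothesis prim_zeta : N.-primitive_root zeta.

Lemma N_gt0 : (0 < N)%N.
Proof. exact: prim_order_gt0 prim_zeta. Qed.

Lemma natrN_neq0 : N%:R != 0 :> K.
Proof. by rewrite pnatr_eq0 -lt0n N_gt0. Qed.

Lemma a0_neq0 : a0 != 0.
Proof.
apply/eqP=> a00; have := ord_a0 N; rewrite dvdnn a00 expr0n.
by rewrite (gtn_eqF N_gt0) eq_sym oner_eq0.
Qed.

Lemma prim_a0 : N.-primitive_root a0.
Proof.
have a0N : a0 ^+ N = 1 by apply/eqP; rewrite ord_a0.
have [m prim_m mN] := prim_order_exists N_gt0 a0N.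
suff -> : N = m by [].
by apply/eqP; rewrite eqn_dvd mN andbT -ord_a0 (prim_expr_order prim_m).
Qed.

Definition tor (i : nat) : gl2 F := gl (M (a0 ^+ i)).

Lemma torE i : GLval (tor i) = M (a0 ^+ i).
Proof. by rewrite glK // det_mulL_mx // expf_neq0 ?a0_neq0. Qed.

Lemma tor_in i : tor i \in T.
Proof. by apply/torusP=> //; exists (a0 ^+ i); rewrite torE. Qed.

Lemma tor_eq i j : (tor i == tor j) = (i == j %[mod N]).
Proof.
rewrite -(eq_prim_root_expr prim_a0); apply/eqP/eqP=> [eqt|eqa].
  by apply: (mulL_mx_inj basis_e); rewrite -!torE eqt.
by rewrite /tor eqa.
Qed.

Lemma torus_tor t : t \in T -> exists i : 'I_N, t = tor i.
Proof.
move=> /(torusP basis_e)[a Dt]; have nza := torus_val_neq0 Dt.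
have [m Dm] := gen_a0 nza; exists (Ordinal (ltn_pmod m N_gt0)).
apply: GLval_inj; rewrite Dt Dm torE /=; congr M; apply/eqP.
by rewrite (eq_prim_root_expr prim_a0) modn_mod.
Qed.

Lemma torM i j : tor (i + j) = (tor i * tor j)%g.
Proof. by apply: GLval_inj; rewrite glM_mx !torE exprD mulL_mxM. Qed.

Lemma card_torusN : #|T| = N.
Proof. exact: (card_torus basis_e). Qed.

(** The logarithm in base a0; its value 0 outside T is arbitrary. *)
Definition torus_log (t : gl2 F) : nat :=
  if [pick i : 'I_N | t == tor i] is Some i then i else 0.

Lemma torus_log_tor i : torus_log (tor i) = i %[mod N].
Proof.
rewrite /torus_log; case: pickP => [j|no].
  by rewrite tor_eq => /eqP.
by have [j eqj] := torus_tor (tor_in i); have := no j; rewrite -eqj eqxx.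
Qed.

(** As j runs through the numbers less than N, these are all the characters of T. *)
Definition Lam (j : nat) (t : gl2 F) : K := zeta ^+ (j * torus_log t).

Lemma Lam_tor j i : Lam j (tor i) = zeta ^+ (j * i).
Proof.
by apply/eqP; rewrite (eq_prim_root_expr prim_zeta) -modnMmr torus_log_tor modnMmr.
Qed.

Lemma Lam_mult j : mult_on T (Lam j).
Proof.
split=> [|s t /torus_tor[i ->] /torus_tor[l ->]].
  have -> : 1%g = tor 0 by apply: GLval_inj; rewrite torE expr0 mulL_mx1.
  by rewrite Lam_tor muln0 expr0.
by rewrite -torM !Lam_tor mulnDr exprD.
Qed.

Lemma Lam_neq0 j t : Lam j t != 0.
Proof. by rewrite expf_neq0 // (prim_root_eq0 prim_zeta) -lt0n N_gt0. Qed.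

Lemma Lam_column_orthogonality s t : s \in T -> t \in T ->
  \sum_(j < N) Lam j s / Lam j t = if s == t then N%:R else 0.
Proof.
case/torus_tor=> i ->; case/torus_tor=> l ->; rewrite tor_eq.
have nzz m : zeta ^+ m != 0.
  by rewrite expf_neq0 // (prim_root_eq0 prim_zeta) -lt0n N_gt0.
pose rho := zeta ^+ i / zeta ^+ l.
have -> : \sum_(j < N) Lam j (tor i) / Lam j (tor l) = \sum_(j < N) rho ^+ j.
  apply: eq_bigr => j _; rewrite !Lam_tor mulnC exprM (mulnC j) exprM.
  by rewrite expr_div_n.
rewrite -(eq_prim_root_expr prim_zeta); case: eqP => [eqz|neqz].
  by rewrite (eq_bigr (fun=> 1)) ?sumr_const ?card_ord // => j _; rewrite /rho eqz mulfV ?expr1n.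
have : rho ^+ N - 1 = 0.
  have zN m : (zeta ^+ m) ^+ N = 1.
    by rewrite -exprM (mulnC m) exprM (prim_expr_order prim_zeta) expr1n.
  by rewrite /rho expr_div_n !zN divr1 subrr.
rewrite subrX1 => /eqP; rewrite mulf_eq0 subr_eq0 => /orP[/eqP rho1|/eqP//].
by case: neqz; rewrite -[LHS](divfK (nzz l)) -/rho rho1 mul1r.
Qed.

Variable D : gl2 F -> K.

Definition coef (j : nat) : K := N%:R^-1 * \sum_(t in T) D t / Lam j t.

Lemma Fourier_inversion s : s \in T -> \sum_(j < N) coef j * Lam j s = D s.
Proof.
move=> Ts; rewrite /coef.
under eq_bigr => j _ do rewrite mulrAC mulr_sumr.
rewrite exchange_big /= (bigD1 s) //= [X in _ + X]big1 ?addr0 => [|t /andP[Tt nts]].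
  have -> : \sum_(j < N) N%:R^-1 * Lam j s * (D s / Lam j s) =
      \sum_(j < N) (N%:R^-1 * D s).
    by apply: eq_bigr => j _; rewrite -mulrA [_ * (_ / _)]mulrCA mulfV ?Lam_neq0 // mulr1.
  by rewrite sumr_const card_ord -[LHS]mulr_natr mulrAC mulVf ?natrN_neq0 // mul1r.
have -> : \sum_(j < N) N%:R^-1 * Lam j s * (D t / Lam j t) =
    N%:R^-1 * D t * \sum_(j < N) Lam j s / Lam j t.
  by rewrite mulr_sumr; apply: eq_bigr => j _; ring.
by rewrite Lam_column_orthogonality // eq_sym (negPf nts) mulr0.
Qed.

Lemma Parseval :
  \sum_(j < N) coef j ^+ 2 = N%:R^-1 * \sum_(t in T) D t * D t^-1%g.
Proof.
rewrite mulr_sumr (eq_bigr (fun j : 'I_N =>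
    \sum_(t in T) N%:R^-1 * (D t * (coef j * Lam j t^-1%g)))) => [|j _].
  rewrite exchange_big /=; apply: eq_bigr => t Tt.
  by rewrite -2!mulr_sumr Fourier_inversion ?groupV.
rewrite expr2 {2}/coef mulr_sumr mulr_sumr; apply: eq_bigr => t Tt.
by rewrite (mult_onV (Lam_mult j)) //; ring.
Qed.

End TorusCharacters.

(** * Cuspidal representations: values on the anisotropic torus *)

Section CuspidalTorus.

Variables (K : numClosedFieldType) (F : finFieldType) (p k : nat).
Hypotheses (p_prime : prime p) (p_odd : odd p) (cardF : #|F| = (p ^ k)%N).
Variables (L : fieldExtType F) (e : 2.-tuple L).
Hypothesis basis_e : basis_of {:L} e.

Notation GL2 := 'GL_2[F]%G.
Notation Fchar := (lin_char K [set: {unit F}]).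
Notation M := (mulL_mx e).
Notation q := #|F|.
Notation T := (torus_group basis_e).
Notation N := (q.-1 * q.+1)%N.
Notation elliptic := (elliptic_reps e).

Variables (a0 : L) (zeta : K).
Hypothesis gen_a0 : forall a, a != 0 -> exists m, a = a0 ^+ m.
Hypothesis ord_a0 : forall m, (a0 ^+ m == 1) = (N %| m)%N.
Hypothesis prim_zeta : N.-primitive_root zeta.
Notation Lam := (Lam e a0 zeta).
Notation tor := (tor e a0).

Variables (n : nat) (rV : mx_representation K GL2 n).
Hypothesis irrV : mx_irreducible rV.
Hypothesis cuspV : uni_sum rV = 0.
Variable m : nat.
Hypotheses (m_gt0 : (0 < m)%N) (n_eq : n = (m * q.-1)%N).

Local Notation Q := (q%:R : K).
Local Notation c := (central rV).

Lemma natr_q_succ : q.+1%:R = Q + 1.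
Proof. by rewrite -addn1 natrD. Qed.

Lemma Q_neq0 : Q != 0.
Proof. by rewrite pnatr_eq0 -lt0n ltnW ?finNzRing_gt1. Qed.

Lemma Q1_neq0 : Q - 1 != 0.
Proof.
by rewrite -natr_q1 pnatr_eq0 -lt0n -ltnS prednK ?finNzRing_gt1 // ltnW ?finNzRing_gt1.
Qed.

Lemma Q1p_neq0 : Q + 1 != 0.
Proof. by rewrite -natr_q_succ pnatr_eq0. Qed.

Lemma natr_n : n%:R = m%:R * (Q - 1) :> K.
Proof. by rewrite n_eq natrM natr_q1. Qed.

Lemma trace_uni1 : \tr (rV (uni 1)) = - m%:R.
Proof.
apply: (mulfI Q1_neq0); rewrite cusp_uni // natr_n; ring.
Qed.

Lemma centralV z : c z^-1%g * c z = 1.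
Proof. by rewrite -centralM // mulVg central1. Qed.

Lemma card_unitsK : #|{: {unit F}}|%:R = Q - 1.
Proof. by rewrite -natr_q1 -cardsT card_finField_unit. Qed.

Lemma sum_torus_split (f : gl2 F -> K) :
  \sum_(t in T) f t = \sum_z f (scalGL z) + \sum_(t in elliptic) f t.
Proof.
rewrite (bigID (fun g : gl2 F => is_scalar_mx (GLval g))) /=; congr (_ + _).
  rewrite (reindex_onto (@scalGL F) (fun g => to_unit (GLval g 0 0))) /=.
    apply: eq_bigl => z; rewrite (torus_scal basis_e) scalar_mx_is_scalar /=.
    by rewrite !mxE /= to_unitK eqxx.
  by move=> g /andP[_ /is_scalarGL[z ->]]; rewrite /= mxE /= to_unitK.
by apply: eq_bigl => t; rewrite [RHS]inE.
Qed.

(** If V corresponded to Lambda, this would be Lambda + Lambda^q: it is the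
difference between m times the representation induced to the torus from the
central character of V, and V. *)
Definition defect (t : gl2 F) : K :=
  (if is_scalar_mx (GLval t) then m%:R * (Q + 1) * (\tr (rV t) / n%:R) else 0)
    - \tr (rV t).

Lemma defect_scal z : defect (scalGL z) = 2%:R * m%:R * c z.
Proof.
rewrite /defect scalar_mx_is_scalar -/(c z) (trace_scal irrV) natr_n; ring.
Qed.

Lemma defect_elliptic t : ~~ is_scalar_mx (GLval t) -> defect t = - \tr (rV t).
Proof. by move=> nst; rewrite /defect (negPf nst) sub0r. Qed.

Lemma scalGLV (z : {unit F}) : (scalGL z)^-1%g = scalGL z^-1%g.
Proof.
apply: (mulgI (scalGL z)); rewrite mulgV !scal_dia -diaM mulgV -scal_dia.
by rewrite scalGL1.
Qed.

Lemma scalarGLV (g : gl2 F) :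
  is_scalar_mx (GLval g^-1%g) = is_scalar_mx (GLval g).
Proof.
have sV (h : gl2 F) : is_scalar_mx (GLval h) -> is_scalar_mx (GLval h^-1%g).
  by move=> /is_scalarGL[z ->]; rewrite scalGLV scalar_mx_is_scalar.
by apply/idP/idP=> /sV //; rewrite invgK.
Qed.

Lemma jordanV (z : {unit F}) x :
  (jordan z x)^-1%g = jordan z^-1%g (- x / val z ^+ 2).
Proof.
apply: (mulgI (jordan z x)); rewrite mulgV; apply: GLval_inj.
have nz := unitF_neq0 z.
rewrite glM_mx !jordanE FinRing.val_unitV GLval1 scalar2E.
by apply: mx2_eq; rewrite mulmx2E !mk2E; field.
Qed.

Lemma eigenvalueV (g : gl2 F) a :
  eigenvalue (GLval g) a -> eigenvalue (GLval g^-1%g) a^-1.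
Proof.
move=> eig_a; have := GL_det g; have := eig_a; rewrite !eigenvalue2.
have -> : \det (GLval g^-1%g) = (\det (GLval g))^-1 by rewrite GLvalV det_inv.
have -> : \tr (GLval g^-1%g) = \tr (GLval g) / \det (GLval g).
  rewrite inv2E mxtraceZ !tr2E !mk2E; ring.
set tau := \tr _; set delta := \det _ => /eqP ra nzd.
have nza : a != 0.
  by apply: contraNneq nzd => a00; rewrite -ra a00; apply/eqP; ring.
apply/eqP; apply: (mulIf (mulf_neq0 nzd (expf_neq0 2 nza))).
rewrite mul0r -[RHS]ra; field; by rewrite nza nzd.
Qed.

(** The character of V has norm 1 and is known outside the elliptic elements. *)
Lemma elliptic_trace_norm :
  \sum_(t in elliptic) \tr (rV t) * \tr (rV t^-1%g) =
    2%:R * (Q - 1) * (Q + 1) - 4%:R * m%:R ^+ 2 * (Q - 1).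
Proof.
pose f g := \tr (rV g) * \tr (rV g^-1%g).
have fJ g x : f (g ^ x)%g = f g by rewrite /f -conjVg !trace_conj.
have f0 g a b : a != b -> eigenvalue (GLval g) a -> eigenvalue (GLval g) b -> f g = 0.
  by move=> nab eig_a eig_b; rewrite /f (cusp_split cuspV nab) ?mul0r.
have sumG : \sum_g f g = Q * (Q - 1) ^+ 2 * (Q + 1).
  transitivity (#|[set: gl2 F]|%:R : K); last first.
    by rewrite card_GL2 !natrM natr_q1 natr_q_succ; ring.
  rewrite -(irr_trace_norm irrV); apply: eq_big => [g|g _]; first by rewrite inE.
  by rewrite /f mulrC.
have sumZ : \sum_z f (scalGL z) = m%:R ^+ 2 * (Q - 1) ^+ 3.
  rewrite (eq_bigr (fun=> m%:R ^+ 2 * (Q - 1) ^+ 2)) => [|z _].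
    by rewrite sumr_const -[LHS]mulr_natr card_unitsK; ring.
  rewrite /f scalGLV !(trace_scal irrV) natr_n.
  transitivity ((m%:R * (Q - 1)) ^+ 2 * (c z^-1%g * c z)); first by ring.
  by rewrite centralV mulr1 exprMn.
have sumU : \sum_z f (jordan z 1) = m%:R ^+ 2 * (Q - 1).
  rewrite (eq_bigr (fun=> m%:R ^+ 2)) => [|z _].
    by rewrite sumr_const -[LHS]mulr_natr card_unitsK.
  have nz : - 1 / val z ^+ 2 != 0.
    by rewrite mulf_neq0 ?oppr_eq0 ?oner_eq0 // invr_eq0 expf_neq0 ?unitF_neq0.
  rewrite /f jordanV !(trace_jordan irrV) ?oner_eq0 // trace_uni1.
  by transitivity (m%:R ^+ 2 * (c z^-1%g * c z)); [ring | rewrite centralV mulr1].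
have := nonsplit_sum p_prime p_odd cardF basis_e fJ f0.
set SG := \sum_g f g in sumG *; set SZ := \sum_z f (scalGL z) in sumZ *.
set SU := \sum_z f (jordan z 1) in sumU *; set SE := \sum_(t in elliptic) f t.
rewrite -[SG *+ _]mulr_natr -[SZ *+ _]mulr_natr -[SU *+ _]mulr_natr.
rewrite -[SE *+ _]mulr_natr sumG sumZ sumU !natrM natr_q1 natr_q_succ => eqG.
rewrite -/SE.
have nz : Q * (Q - 1) != 0 by rewrite mulf_neq0 ?Q_neq0 ?Q1_neq0.
apply: (mulIf nz); apply: (addrI (m%:R ^+ 2 * (Q - 1) ^+ 3 * 2%:R +
  m%:R ^+ 2 * (Q - 1) * (2%:R * ((Q - 1) * (Q + 1))))).
by rewrite -eqG; ring.
Qed.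

Lemma defect_norm : \sum_(t in T) defect t * defect t^-1%g = 2%:R * N%:R.
Proof.
rewrite sum_torus_split.
rewrite [X in X + _](eq_bigr (fun=> 4%:R * m%:R ^+ 2)) => [|z _]; last first.
  rewrite scalGLV !defect_scal.
  by transitivity (4%:R * m%:R ^+ 2 * (c z^-1%g * c z)); [ring | rewrite centralV mulr1].
rewrite sumr_const -[_ *+ #|_|]mulr_natr card_unitsK.
rewrite [X in _ + X](eq_bigr (fun t => \tr (rV t) * \tr (rV t^-1%g))) => [|t].
  by rewrite elliptic_trace_norm natrM natr_q1 natr_q_succ; ring.
by rewrite inE => /andP[_ nst]; rewrite !defect_elliptic ?scalarGLV // mulrNN.
Qed.

Lemma Lam_scal_mult j : mult_on [set: {unit F}]%G (fun z => Lam j (scalGL z)).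
Proof.
have [Lam1 LamM] := Lam_mult basis_e gen_a0 ord_a0 prim_zeta j.
split=> [|x y _ _]; first by rewrite scalGL1.
have -> : scalGL (x * y)%g = (scalGL x * scalGL y)%g by rewrite !scal_dia diaM.
by rewrite LamM ?(torus_scal basis_e).
Qed.

Lemma central_mult : mult_on [set: {unit F}]%G c.
Proof. by split=> [|x y _ _]; rewrite ?central1 ?centralM. Qed.

(** A coefficient is the difference of two multiplicities; the first one is m if
Lam j extends the central character of V and 0 otherwise. *)
Lemma coef_defect_int : exists d : 'I_N -> int, forall j : 'I_N,
  coef basis_e a0 zeta defect j = (d j)%:~R /\
  (0 < d j -> forall z, Lam j (scalGL z) = c z).
Proof.
suff /fin_all_exists dj : forall j : 'I_N, exists d : int,
    coef basis_e a0 zeta defect j = d%:~R /\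
    (0 < d -> forall z, Lam j (scalGL z) = c z) by [].
move=> j; have [Lam1 LamM] := Lam_mult basis_e gen_a0 ord_a0 prim_zeta j.
have [l Dl] := @multiplicity_nat K _ T n (subg_repr rV (subsetT T)) _ Lam1 LamM.
have sumV : \sum_(t in T) \tr (rV t) / Lam j t = l%:R * N%:R.
  transitivity ((l * #|T|)%:R : K); last by rewrite card_torusN natrM.
  rewrite -Dl; apply: eq_bigr => t Tt /=.
  by rewrite (mult_onV (conj Lam1 LamM) Tt) mulrC.
pose isc := [forall z in [set: {unit F}]%G, c z / Lam j (scalGL z) == 1].
exists ((if isc then m%:Z else 0) - l%:Z); split; last first.
  rewrite /isc; case: ifPn => [/forall_inP is1 _ z|_]; last first.
    by rewrite sub0r oppr_gt0 ltNge.
  have := is1 z (in_setT z) => /eqP cz.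
  by rewrite -[RHS](divfK (Lam_neq0 e a0 prim_zeta j (scalGL z))) cz mul1r.
have sumC : \sum_z c z / Lam j (scalGL z) = if isc then Q - 1 else 0.
  have := sum_char (mult_on_div central_mult (Lam_scal_mult j)).
  rewrite card_finField_unit natr_q1 => <-; apply: eq_bigl => z.
  by rewrite inE.
rewrite /coef (eq_bigr (fun t =>
  (if is_scalar_mx (GLval t) then m%:R * (Q + 1) * (\tr (rV t) / n%:R) else 0)
    / Lam j t - \tr (rV t) / Lam j t)) => [|t _]; last by rewrite mulrBl.
rewrite sumrB sumV sum_torus_split [X in _ + X - _]big1 => [|t]; last first.
  by rewrite inE => /andP[_ /negPf->]; rewrite mul0r.
rewrite (eq_bigr (fun z => m%:R * (Q + 1) * (c z / Lam j (scalGL z)))); last first.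
  by move=> z _; rewrite scalar_mx_is_scalar mulrA.
rewrite -mulr_sumr sumC addr0 natrM natr_q1 natr_q_succ.
have [nz1 nz2] := (Q1_neq0, Q1p_neq0).
by case: isc {sumC}; rewrite rmorphB /=; field; rewrite nz1 nz2.
Qed.

(** By Parseval the squares of the coefficients add up to 2, and the value at 1
shows that the coefficients add up to 2 m. *)
Lemma defect_two_chars : m = 1%N /\ exists j1 j2 : 'I_N, [/\ j1 != j2,
    {in T, forall t, defect t = Lam j1 t + Lam j2 t},
    forall z, Lam j1 (scalGL z) = c z & forall z, Lam j2 (scalGL z) = c z].
Proof.
have [d Dd] := coef_defect_int.
have coefE (j : 'I_N) : coef basis_e a0 zeta defect j = (d j)%:~R by case: (Dd j).
have sum_sq : \sum_j d j ^+ 2 = 2.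
  apply/eqP; rewrite -(eqr_int K) rmorph_sum /=; apply/eqP.
  rewrite (eq_bigr (fun j : 'I_N => coef basis_e a0 zeta defect j ^+ 2)).
    rewrite (Parseval basis_e gen_a0 ord_a0 prim_zeta) defect_norm mulrCA mulVf ?mulr1 //.
    exact: natrN_neq0 prim_zeta.
  by move=> j _; rewrite coefE rmorphXn.
have sum_d : \sum_j d j = (2 * m)%:Z.
  apply/eqP; rewrite -(eqr_int K) rmorph_sum /=; apply/eqP.
  transitivity (defect 1%g); last first.
    by rewrite -scalGL1 defect_scal central1 // mulr1 -natrM.
  rewrite -(Fourier_inversion gen_a0 ord_a0 prim_zeta defect (group1 T)).
  apply: eq_bigr => j _; rewrite coefE.
  by have [-> _] := Lam_mult basis_e gen_a0 ord_a0 prim_zeta j; rewrite mulr1.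
have [m1 [j1 [j2 [n12 Dj]]]] := int_sum_two m_gt0 sum_sq sum_d.
split=> //; exists j1, j2; split=> //.
- move=> t Tt; rewrite -(Fourier_inversion gen_a0 ord_a0 prim_zeta defect Tt).
  rewrite (bigD1 j1) //= (bigD1 j2) 1?eq_sym //= big1 => [|j /andP[nj1 nj2]].
    rewrite !coefE !Dj !eqxx (negPf n12) eq_sym (negPf n12) addr0 add0r.
    by rewrite !mul1r addr0.
  by rewrite coefE Dj (negPf nj1) (negPf nj2) addr0 mul0r.
- by case: (Dd j1) => _; apply; rewrite Dj eqxx (negPf n12).
by case: (Dd j2) => _; apply; rewrite Dj eqxx eq_sym (negPf n12).
Qed.

End CuspidalTorus.

(** * The parameter of a cuspidal representation *)

Section DeterminantCharacters.

Variables (K : numClosedFieldType) (F : finFieldType).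
Notation GL2 := 'GL_2[F]%G.
Notation Fchar := (lin_char K [set: {unit F}]).
Variables (n : nat) (rV : mx_representation K GL2 n).
Hypothesis cuspV : uni_sum rV = 0.

(** The projection of V to its alpha \o det component has its image in the
vectors fixed by U. *)
Lemma det_sum0 (alpha : Fchar) :
  \sum_(g : gl2 F) \tr (rV g) / alpha (detGL g) = 0.
Proof.
pose S := \sum_(g : gl2 F) (alpha (detGL g))^-1 *: rV g.
have det_uni y : detGL (uni y) = 1%g :> {unit F}.
  by apply: val_inj; rewrite /= uniE det2E !mk2E mulr0 subr0 mulr1.
have Su y : S *m rV (uni y) = S.
  rewrite /S mulmx_suml [RHS](reindex_inj (mulIg (uni y))) /=.
  apply: eq_bigr => g _.
  by rewrite -scalemxAl -reprM detGLM det_uni mulg1.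
have : S *m uni_sum rV = 0 by rewrite cuspV mulmx0.
rewrite /uni_sum mulmx_sumr (eq_bigr (fun=> S)) // sumr_const -scaler_nat => /eqP.
rewrite scaler_eq0 pnatr_eq0 (gtn_eqF (ltnW (finNzRing_gt1 F))) => /eqP S0.
transitivity (\tr S); last by rewrite S0 mxtrace0.
rewrite /S raddf_sum; apply: eq_bigr => g _ /=.
by rewrite mxtraceZ mulrC.
Qed.

End DeterminantCharacters.

Section CuspidalIdentification.

Variables (K : numClosedFieldType) (F : finFieldType) (p k : nat).
Hypotheses (p_prime : prime p) (p_odd : odd p) (cardF : #|F| = (p ^ k)%N).
Variables (L : fieldExtType F) (e : 2.-tuple L).
Hypothesis basis_e : basis_of {:L} e.

Notation GL2 := 'GL_2[F]%G.
Notation Fchar := (lin_char K [set: {unit F}]).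
Notation M := (mulL_mx e).
Notation q := #|F|.
Notation T := (torus_group basis_e).
Notation N := (q.-1 * q.+1)%N.

Section Cuspidal.

Variables (n : nat) (rV : mx_representation K GL2 n).
Hypothesis irrV : mx_irreducible rV.
Hypothesis cuspV : uni_sum rV = 0.
Local Notation Q := (q%:R : K).
Local Notation c := (central rV).

Section NotDecomposable.

Hypothesis n_eq : n = (1 * q.-1)%N.
Variables f1 f2 : gl2 F -> K.
Hypotheses (mult1 : mult_on T f1) (mult2 : mult_on T f2).
Hypothesis neq12 : exists2 t, t \in T & f2 t != f1 t.
Hypothesis defectE : {in T, forall t, defect rV 1 t = f1 t + f2 t}.
Hypotheses (f1_scal : forall z, f1 (scalGL z) = c z).
Hypotheses (f2_scal : forall z, f2 (scalGL z) = c z).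

(** Otherwise the scalar product of V and of alpha \o det is -1/2. *)
Lemma defect_not_det (alpha : Fchar) :
  ~ {in T, forall t, f1 t = alpha (detGL t)}.
Proof.
move=> f1E; pose f (g : gl2 F) := \tr (rV g) / alpha (detGL g).
have detJ (g x : gl2 F) : detGL (g ^ x)%g = detGL g.
  by apply: val_inj; rewrite /= det_conj.
have fJ g x : f (g ^ x)%g = f g by rewrite /f trace_conj // detJ.
have f0 g a b : a != b -> eigenvalue (GLval g) a -> eigenvalue (GLval g) b -> f g = 0.
  by move=> nab eig_a eig_b; rewrite /f (cusp_split cuspV nab) ?mul0r.
have nzc z : c z != 0.
  have : c z^-1%g * c z != 0 by rewrite centralV // oner_eq0.
  by rewrite mulf_eq0 negb_or => /andP[].
have alphac z : alpha (detGL (scalGL z)) = c z.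
  by rewrite -f1E ?(torus_scal basis_e) // f1_scal.
have sumZ : \sum_z f (scalGL z) = (Q - 1) ^+ 2.
  rewrite (eq_bigr (fun=> Q - 1)) => [|z _].
    by rewrite sumr_const -[LHS]mulr_natr card_unitsK expr2.
  by rewrite /f alphac (trace_scal irrV) (natr_n K n_eq) mul1r mulfK.
have sumU : \sum_z f (jordan z 1) = - (Q - 1).
  rewrite (eq_bigr (fun=> -1)) => [|z _].
    by rewrite sumr_const -[LHS]mulr_natr card_unitsK mulN1r.
  rewrite /f (trace_jordan irrV) ?oner_eq0 // (trace_uni1 cuspV n_eq).
  have -> : detGL (jordan z 1) = detGL (scalGL z).
    by apply: val_inj; rewrite /= det_jordan det_scalar.
  by rewrite alphac mulrN1 mulNr mulfV.
have sumE : \sum_(t in elliptic_reps e) f t = 2%:R * (Q - 1) - (Q - 1) * (Q + 1).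
  have : \sum_(t in T) (f1 t + f2 t) / f1 t = (Q - 1) * (Q + 1).
    under eq_bigr => t Tt do rewrite mulrDl.
    rewrite big_split /= !sum_char; try exact: mult_on_div.
    rewrite ifT; last first.
      by apply/forall_inP=> t Tt; rewrite mulfV ?(mult_on_neq0 mult1).
    rewrite ifN ?addr0 ?card_torusN ?natrM ?natr_q1 ?natr_q_succ //.
    rewrite negb_forall_in; have [t Tt nt] := neq12; apply/exists_inP; exists t => //.
    apply: contra nt => /eqP ft; apply/eqP.
    by rewrite -[LHS](divfK (mult_on_neq0 mult1 Tt)) ft mul1r.
  rewrite sum_torus_split // (eq_bigr (fun=> 2%:R)) => [|z _]; last first.
    by rewrite f1_scal f2_scal mulrDl mulfV.
  rewrite sumr_const -[_ *+ #|_|]mulr_natr card_unitsK => <-.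
  rewrite opprD addrA subrr add0r -sumrN; apply: eq_bigr => t.
  rewrite inE => /andP[Tt nst].
  by rewrite -defectE // defect_elliptic // /f -f1E // mulNr opprK.
have := nonsplit_sum p_prime p_odd cardF basis_e fJ f0.
have -> : \sum_g f g = 0 by apply: det_sum0.
set SZ := \sum_z f (scalGL z) in sumZ *.
set SU := \sum_z f (jordan z 1) in sumU *.
set SE := \sum_(t in elliptic_reps e) f t in sumE *.
rewrite mul0rn -[SZ *+ _]mulr_natr -[SU *+ _]mulr_natr.
rewrite -[SE *+ _]mulr_natr sumE sumZ sumU !natrM natr_q1 natr_q_succ => eqG.
have : (Q - 1) ^+ 2 * Q * (Q + 1) == 0.
  by rewrite -oppr_eq0; apply/eqP; rewrite [RHS]eqG; ring.
by rewrite !mulf_eq0 (negPf (Q1_neq0 K F)) (negPf (Q_neq0 K F))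
  (negPf (Q1p_neq0 K F)).
Qed.

End NotDecomposable.

Lemma mult_onX (f : gl2 F -> K) l : mult_on T f -> mult_on T (fun t => f t ^+ l).
Proof.
by case=> f1 fM; split=> [|x y Tx Ty]; rewrite ?f1 ?expr1n // fM // exprMn.
Qed.

Lemma mult_on_inv (f : gl2 F -> K) : mult_on T f -> mult_on T (fun t => (f t)^-1).
Proof.
by case=> f1 fM; split=> [|x y Tx Ty]; rewrite ?f1 ?invr1 // fM // invfM.
Qed.

(** The pair of characters in the defect is preserved by t |-> t^q, which is
realised by conjugation in GL(2, F), and by inversion if V is self-dual. The
first map exchanges them, as otherwise they would factor through the determinant;
the second one does not fix them either, because q - 1 is even. Both maps thus
agree on Lambda. *)
Lemma cuspidal_parameter : self_dual rV -> exists Lambda : lin_char K (torus e),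
  [/\ ~ decomposable Lambda, forall x, bar Lambda x = 1
    & is_chi_cuspidal Lambda rV].
Proof.
move=> sdV.
have [a0 [gen ord]] := torus_generator basis_e.
have q_gt1 : (1 < q)%N := finNzRing_gt1 F.
have q1_gt0 : (0 < q.-1)%N by rewrite -ltnS prednK // ltnW.
have [zeta prim] : exists zeta : K, N.-primitive_root zeta.
  by apply: primitive_root_exists; rewrite muln_gt0 q1_gt0.
have [m m_gt0 n_eq] := cusp_dim irrV cuspV.
have [m1 [j1 [j2 [n12 defectE c1 c2]]]] := defect_two_chars p_prime p_odd cardF
  basis_e gen ord prim irrV cuspV m_gt0 n_eq.
rewrite {m m_gt0}m1 in n_eq defectE.
set f1 := Lam e a0 zeta j1 in defectE c1.
set f2 := Lam e a0 zeta j2 in defectE c2.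
pose t_ i := tor e a0 i.
have T_tor i : t_ i \in T by apply: tor_in prim i.
have torP t : t \in T -> exists i, t = t_ i.
  by case/(torus_tor gen ord prim) => i ->; exists i.
have LamX (j i l : nat) : Lam e a0 zeta j (t_ (i * l)%N) = Lam e a0 zeta j (t_ i) ^+ l.
  by rewrite !(Lam_tor basis_e gen ord prim) mulnA exprM.
have mult j : mult_on T (Lam e a0 zeta j) := Lam_mult basis_e gen ord prim j.
have torE i : GLval (t_ i) = M (a0 ^+ i) by apply: (torE basis_e ord prim).
have scal_tor i l (z : {unit F}) : (a0 ^+ i) ^+ l = val z *: 1 -> t_ (i * l)%N = scalGL z.
  by move=> aE; apply: GLval_inj; rewrite torE exprM aE mulL_mx_scalar.
have neq12 : exists2 t, t \in T & f2 t != f1 t.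
  exists (t_ 1%N); rewrite // /f1 /f2 !(Lam_tor basis_e gen ord prim) !muln1.
  by rewrite (eq_prim_root_expr prim) !modn_small // eq_sym.
have not_det := defect_not_det n_eq (mult j1) (mult j2) neq12 defectE c1 c2.
(* The character of V takes the same value at an element of T and at its
   Frobenius conjugate. *)
have defect_q i : defect rV 1 (t_ (i * q)%N) = defect rV 1 (t_ i).
  have [sc|nsc] := boolP (is_scalar_mx (GLval (t_ i))).
    congr defect; apply: GLval_inj; rewrite !torE exprM.
    move: sc; rewrite torE (mulL_mx_is_scalar basis_e).
    by move/eqP->.
  have Ds : GLval (t_ (i * q)%N) = M ((a0 ^+ i) ^+ q) by rewrite torE exprM.
  have [_ conj_q] := torus_conjugates p_prime cardF basis_e Ds (torE i) nsc.
  have [x Dx] := conj_q (or_intror erefl).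
  by rewrite Dx !defect_elliptic ?trace_conj // scalarGL_conj.
have eq_q : {in T, forall t, f1 t ^+ q + f2 t ^+ q = f1 t + f2 t}.
  by move=> _ /torP[i ->]; rewrite /f1 /f2 -!LamX -!defectE.
have not_fixed : ~ {in T, forall t, f1 t ^+ q = f1 t}.
  move=> fix1; have /eqP := fix1 _ (T_tor 1%N).
  rewrite /f1 -LamX !(Lam_tor basis_e gen ord prim) mul1n muln1.
  rewrite (eq_prim_root_expr prim) eqn_mod_dvd; last by rewrite leq_pmulr // ltnW.
  rewrite -{2}(muln1 j1) -mulnBr subn1 (mulnC j1) dvdn_pmul2l // => /dvdnP[l Dl].
  pose al (z : {unit F}) := Lam e a0 zeta l (scalGL z).
  have [al1 alM] := Lam_scal_mult basis_e gen ord prim l.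
  apply: (not_det (LinChar al1 alM)) => _ /torP[i ->] /=.
  rewrite -(scal_tor i q.+1); last first.
    by rewrite (norm_det p_prime cardF basis_e) /= torE.
  by rewrite /f1 !(Lam_tor basis_e gen ord prim) Dl mulnAC mulnA.
have f1q : {in T, forall t, f1 t ^+ q = f2 t}.
  have [fix1|//] := char_pair_independent (mult_onX q (mult j1))
    (mult_onX q (mult j2)) (mult j1) (mult j2) eq_q.
  by case: not_fixed => t Tt; apply: fix1.
have eq_inv : {in T, forall t, (f1 t)^-1 + (f2 t)^-1 = f1 t + f2 t}.
  move=> t Tt; rewrite -(mult_onV (mult j1) Tt) -(mult_onV (mult j2) Tt).
  rewrite -!defectE ?groupV // /defect scalarGLV.
  by rewrite (self_dual_trace sdV) ?inE.
have norm1 : {in T, forall t, f1 t ^+ q.+1 = 1}.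
  have [inv1|inv1] := char_pair_independent (mult_on_inv (mult j1))
    (mult_on_inv (mult j2)) (mult j1) (mult j2) eq_inv.
    case: not_fixed => t Tt; have nz := mult_on_neq0 (mult j1) Tt.
    have e1 : (f1 t)^-1 = f1 t := inv1 t Tt.
    have sq1 : f1 t ^+ 2 = 1 by rewrite expr2 -{1}e1 mulVf.
    rewrite -[q]odd_double_half (q_odd p_odd cardF) -mul2n exprD exprM sq1.
    by rewrite expr1n mulr1.
  move=> t Tt; have nz := mult_on_neq0 (mult j1) Tt.
  have e2 : (f1 t)^-1 = f2 t := inv1 t Tt.
  by rewrite exprS f1q // -e2 mulfV.
have [f1_1 f1M] := mult j1.
exists (LinChar f1_1 f1M); split=> [[alpha decE]|x|]; first exact: not_det decE.
  have [b nzb Db] := norm_onto basis_e (unitF_neq0 x).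
  have [i Di] := gen b nzb.
  by rewrite /bar /= -(scal_tor i q.+1) -?Di // /f1 LamX norm1.
split=> [x|x g Dg|g a b nab eig_a eig_b|t Tt nst].
- by rewrite /bar /= -/f1 c1 (trace_scal irrV) (natr_n K n_eq) mul1r.
- have -> : g = jordan x 1.
    apply: GLval_inj; rewrite Dg jordanE scalar2E.
    by apply: mx2_eq; rewrite [LHS]mxE [delta_mx _ _ _ _]mxE !mk2E ?addr0 ?add0r.
  rewrite (trace_jordan irrV) ?oner_eq0 // (trace_uni1 cuspV n_eq) mulrN1.
  by rewrite /bar /= -/f1 c1.
- exact: (cusp_split cuspV nab eig_a eig_b).
by rewrite f1q // -defectE // defect_elliptic // opprK.
Qed.

End Cuspidal.

(** As t^(q + 1) is a scalar, Lambda t ^+ q is the inverse of Lambda t, and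
inversion exchanges the two terms of the trace at t. *)
Lemma cuspidal_self_dual n (rV : mx_representation K GL2 n)
    (Lambda : lin_char K (torus e)) :
    mx_irreducible rV -> (forall x, bar Lambda x = 1) ->
  is_chi_cuspidal Lambda rV -> self_dual rV.
Proof.
move=> irrV bar1 [tr_scal tr_unip tr_split tr_ell].
apply/(self_dualE irrV) => g _.
have [/is_scalarGL[z ->]|nsg] := boolP (is_scalar_mx (GLval g)).
  by rewrite scalGLV !tr_scal !bar1.
have trJ z x : x != 0 -> \tr (rV (jordan z x)) = -1.
  move=> nzx; have [||||y <-] := @conjGL F (jordan z 1) (jordan z x).
  - exact/jordan_nonscalar/oner_neq0.
  - exact: jordan_nonscalar.
  - by rewrite !tr_jordan.
  - by rewrite !det_jordan.
  rewrite trace_conj (tr_unip z) ?bar1 // jordanE scalar2E.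
  by apply: mx2_eq; rewrite [RHS]mxE [delta_mx _ _ _ _]mxE !mk2E ?addr0 ?add0r.
case: (nonscalar_cases p_prime p_odd cardF basis_e nsg).
- move=> [z [x ->]]; rewrite trace_conjV trace_conj jordanV !trJ ?oner_eq0 //.
  by rewrite mulf_neq0 ?oppr_eq0 ?oner_eq0 // invr_eq0 expf_neq0 ?unitF_neq0.
- move=> [a [b [nab eig_a eig_b]]].
  rewrite (tr_split g a b) // (tr_split g^-1%g a^-1 b^-1) ?eigenvalueV //.
  by rewrite (inj_eq invr_inj).
move=> [t Tt [x Dg]]; rewrite Dg trace_conjV trace_conj.
have nst : ~~ is_scalar_mx (GLval t) by rewrite -(scalarGL_conj t x) -Dg.
have Tt' : t \in T by [].
have LamT : mult_on T Lambda by split; [apply: lc_fun1 | apply: lc_funM].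
rewrite !tr_ell ?scalarGLV // ?(groupV T) //; congr (- _).
have LamV : Lambda t^-1%g = (Lambda t)^-1 by apply: (mult_onV LamT Tt').
suff Lamq : Lambda t ^+ q = (Lambda t)^-1.
  by rewrite LamV exprVn Lamq invrK addrC.
have nzL : Lambda t != 0 := mult_on_neq0 LamT Tt'.
apply: (mulfI nzL); rewrite mulfV // -exprS.
have [a Da] := torusP basis_e t Tt; have nza := torus_val_neq0 Da.
have LamX l : Lambda (gl (M (a ^+ l))) = Lambda t ^+ l.
  elim: l => [|l IHl].
    transitivity (Lambda 1%g); last by rewrite lc_fun1 expr0.
    congr (Lambda _); apply: GLval_inj.
    by rewrite expr0 mulL_mx1 // glK ?det1 ?oner_eq0.
  rewrite [RHS]exprS -IHl -(proj2 LamT) ?gl_torus ?expf_neq0 //; congr (Lambda _).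
  by apply: GLval_inj; rewrite glM_mx !glK ?det_mulL_mx ?expf_neq0 // exprS mulL_mxM // Da.
rewrite -LamX (norm_det p_prime cardF basis_e) -(bar1 (detGL t)) /bar.
congr (Lambda _); apply: GLval_inj.
rewrite mulL_mx_scalar // -Da glK // det_scalar expf_neq0 //.
by rewrite Da det_mulL_mx.
Qed.

End CuspidalIdentification.

Local Open Scope complex_scope.

Theorem corollary1p3 (R : realType) (F : finFieldType) (p k : nat)
    (p_prime : prime p) (p_odd : odd p) (k_gt0 : (0 < k)%N)
    (cardF : #|F| = (p ^ k)%N)
    (* F_{q^2}, with a basis identifying it with F_q^2 *)
    (L : fieldExtType F) (e : 2.-tuple L) (basis_e : basis_of {:L} e)
    (* the character written -1 *)
    (sgn : lin_char R[i] [set: {unit F}])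
    (sgn_neq1 : exists x, sgn x != 1) (sgn_sq : forall x, sgn x ^+ 2 = 1)
    (n : nat) (rV : mx_representation R[i] 'GL_2[F]%G n)
    (irrV : mx_irreducible rV) :
  self_dual rV <->
  [\/ mx_rsim rV (char_det_repr (triv_char _ _)) \/
        mx_rsim rV (char_det_repr sgn),
      is_chi_q (triv_char _ _) rV \/ is_chi_q sgn rV,
      (exists2 alpha : lin_char R[i] [set: {unit F}],
         exists x, alpha x ^+ 2 != 1 &
         mx_rsim rV (Ind_Borel alpha (inv_char alpha))) \/
        mx_rsim rV (Ind_Borel (triv_char _ _) sgn)
    | exists Lam : lin_char R[i] (torus e),
        [/\ ~ decomposable Lam, forall x, bar Lam x = 1
          & is_chi_cuspidal Lam rV]].
Proof.
have triv_sq x : triv_char R[i] [set: {unit F}] x ^+ 2 = 1 by rewrite expr1n.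
split=> [sdV|].
  have [cuspV|noncuspV] := eqVneq (uni_sum rV) 0.
    exact: Or44 (cuspidal_parameter p_prime p_odd cardF basis_e irrV cuspV sdV).
  have [alpha [beta [v nzv Bv]]] := Borel_eigenvector noncuspV.
  case: (self_dual_principal irrV sgn_neq1 sgn_sq nzv Bv sdV).
  - exact: Or41.
  - exact: Or42.
  exact: Or43.
case=> [[simV|simV]|[chiV|chiV]|[[alpha alpha2 simV]|simV]|[Lam [_ bar1 cuspV]]].
- exact: self_dual_rsim simV (char_det_self_dual triv_sq).
- exact: self_dual_rsim simV (char_det_self_dual sgn_sq).
- exact: chi_q_self_dual irrV triv_sq chiV.
- exact: chi_q_self_dual irrV sgn_sq chiV.
- exact: Ind_inv_self_dual irrV alpha2 simV.
- exact: self_dual_rsim simV (Ind_quadratic_self_dual triv_sq sgn_sq).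
exact: (cuspidal_self_dual p_prime p_odd cardF basis_e irrV bar1 cuspV).
Qed.
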